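(* Assume that there are constants $\varrho,\eta,T_0,T_1,c>0$ such that every solution of $w_{tt}+Aw=0$, $w(0)=w_0$, $w_t(0)=w_1$ satisfies $$c\int_0^{T_0}\|B^*w_t\|^2\,dt\ \ge\ \|(w_0,w_1)\|^2_{X_{1/2-1/(2\varrho)}\times X_{-1/(2\varrho)}},\qquad c\int_0^{T_1}\|Cw\|^2\,dt\ \ge\ \|(w_0,w_1)\|^2_{X_{1/2-1/(2\eta)}\times X_{-1/(2\eta)}}.$$ Let $z\in V$. For $T>0$ let $(w^T,u^T)$ be the optimal state and control of the problem of minimizing $$\widetilde J_0^T(u)=\frac12\int_0^T\big(\|u(t)\|_U^2+\|Cw(t)-z\|_V^2\big)\,dt,\qquad u\in L^2(0,T;U),$$ subject to $w_{tt}+Aw=Bu$, $w(0)=w_0$, $w_t(0)=w_1$. Let $(\bar w,\bar u)$ be the optimal state and control of the stationary problem of minimizing $\|u\|_U^2+\|Cw-z\|_V^2$ subject to $Aw=Bu$, and let $\bar p$ be the stationary adjoint state, $A\bar p=C^*(C\bar w-z)$. Then, for any $(w_0-\bar w,w_1)\in\mathcal D(\mathcal A^k)$ with $k>0$, if $\bar p\in X_{(\widetilde k+1)/2}$ with $\widetilde k\ge1$, it holds as $T\to\infty$ that $$\frac1T\int_0^T\big(\|C(w^T-\bar w)\|_H^2+\|u^T-\bar u\|_H^2\big)\,dt\to0$$ and $$\Big\|\frac1T\int_0^T(w^T(t)-\bar w)\,dt\Big\|^2_{X_{1/2}}\to0.$$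
   Context: Setting. $H$ is a Hilbert space and $A:\mathcal D(A)\to H$ is self-adjoint, strictly positive, with compact resolvent. Its eigenvalues are $(\lambda_n^2)_{n\ge1}$ ($\lambda_n>0$) with eigenvectors $(\phi_n)$ forming an orthonormal basis of $H$. For $\beta\in\mathbb R$, $X_\beta$ is the Hilbert space with norm $\|\varphi\|_{X_\beta}^2=\sum_n\lambda_n^{4\beta}|\langle\varphi,\phi_n\rangle|^2$ (for $\beta\ge0$ the domain of $A^\beta$; for $\beta<0$ the completion of $H$, identified with the dual of $X_{-\beta}$ with pivot space $H$). The control and observation spaces are $U=V=H$; $B\in\mathcal L(U,H)$ and $C\in\mathcal L(X_{1/2},V)$, so $C^*\in\mathcal L(V,X_{-1/2})$. The state space is $\mathcal H=X_{1/2}\times H$. $\mathcal A=\begin{pmatrix}0&I\\-A&0\end{pmatrix}$ with $\mathcal D(\mathcal A)=X_1\times X_{1/2}$, and $\mathcal D(\mathcal A^s)=X_{(s+1)/2}\times X_{s/2}$ with the product norm. With $w_0=\sum a_n\phi_n$, $w_1=\sum b_n\phi_n$: $\|(w_0,w_1)\|^2_{X_{1/2-1/(2\varrho)}\times X_{-1/(2\varrho)}}=\sum_n\lambda_n^{-2/\varrho}(\lambda_n^2a_n^2+b_n^2)$, and the same with $\eta$. The optimality systems are: $w^T_{tt}+Aw^T=Bu^T$, $u^T=-B^*p^T$, $p^T_{tt}+Ap^T=C^*(Cw^T-z)$, $w^T(0)=w_0$, $w^T_t(0)=w_1$, $p^T(T)=p^T_t(T)=0$; and $A\bar w=B\bar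 u$, $\bar u=-B^*\bar p$, $A\bar p=C^*(C\bar w-z)$. *)

(* Defs.v *)
From HB Require Import structures.
From mathcomp Require Import all_boot all_order all_algebra.
From mathcomp Require Import sesquilinear.
From mathcomp Require Import all_classical all_reals all_analysis.
Set Implicit Arguments.
Unset Strict Implicit.
Unset Printing Implicit Defensive.
Import Order.TTheory GRing.Theory Num.Theory.
Import numFieldNormedType.Exports.
Local Open Scope classical_set_scope.
Local Open Scope ring_scope.

(* A real Hilbert space is a complete normed module H over R with a scalar
   product [ip] inducing its norm; an unbounded operator on H is a function
   A : H -> H, of which only the values on its domain D matter. *)

Section Operators.
Context (R : realType) (H : completeNormedModType R) (ip : {dot H for idfun}).

Definition induces_norm := forall x : H, ip x x = `|x| ^+ 2.

Definition linear_subspace (D : set H) :=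
  D 0 /\ forall (a : R) x y, D x -> D y -> D (a *: x + y).

Definition linear_on (D : set H) (L : H -> H) :=
  forall (a : R) x y, D x -> D y -> L (a *: x + y) = a *: L x + L y.

Definition adjoint_of (B Bs : H -> H) := forall x y, ip (B x) y = ip x (Bs y).

(* The last conjunct says that the domain of the adjoint is contained in D. *)
Definition self_adjoint (D : set H) (A : H -> H) :=
  [/\ closure D = setT,
      forall x y, D x -> D y -> ip (A x) y = ip x (A y) &
      forall y z, (forall x, D x -> ip (A x) y = ip x z) -> D y].

Definition strictly_positive (D : set H) (A : H -> H) :=
  exists2 m : R, 0 < m & forall x, D x -> m * `|x| ^+ 2 <= ip (A x) x.

Definition is_resolvent (D : set H) (A : H -> H) (mu : R) (K : {linear H -> H}) :=
  [/\ continuous K,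
      forall y, D (K y) /\ A (K y) - mu *: K y = y &
      forall x, D x -> K (A x - mu *: x) = x].

Definition compact_resolvent (D : set H) (A : H -> H) :=
  exists mu (K : {linear H -> H}), is_resolvent D A mu K /\
    compact (closure (K @` [set x | `|x| <= 1])).

Definition orthonormal_basis (phi : nat -> H) :=
  (forall i j, ip (phi i) (phi j) = (i == j)%:R) /\
  (forall x, series (fun n => ip x (phi n) *: phi n) @ \oo --> x).

Definition eigenpairs (D : set H) (A : H -> H) (lam : nat -> R) (phi : nat -> H) :=
  forall n, [/\ 0 < lam n, D (phi n) & A (phi n) = lam n ^+ 2 *: phi n].

End Operators.

Section Scale.
Context (R : realType) (H : completeNormedModType R) (ip : {dot H for idfun}).
Context (lam : nat -> R) (phi : nat -> H).

(* Squared norm of X_beta, for every real beta, on elements of H.  Every vector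
   measured in a space of negative order below belongs to H, so that the
   completion is needed only for X_{-1/2}, treated below as a dual space. *)
Definition normX2 (beta : R) (x : H) : \bar R :=
  (\sum_(0 <= n <oo) (lam n `^ (4 * beta) * ip x (phi n) ^+ 2)%:E)%E.

(* This is X_beta for beta >= 0, and X_beta `&` H for beta < 0. *)
Definition X (beta : R) : set H := [set x | (normX2 beta x < +oo)%E].

Definition dotX (beta : R) (x y : H) : R :=
  limn (series (fun n => lam n `^ (4 * beta) * ip x (phi n) * ip y (phi n))).

(* Domain of the s-th power of the wave operator. *)
Definition domain_pow (s : R) (x y : H) := X ((s + 1) / 2) x /\ X (s / 2) y.

Definition boundedX (beta : R) (L : H -> H) :=
  exists M : R, forall x, X beta x -> ((`|L x| ^+ 2)%:E <= M%:E * normX2 beta x)%E.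

(* X_{-1/2} is the dual of X_{1/2} with pivot H: its elements are functionals,
   of which only the values on X_{1/2} matter.  [Aext] is A extended to an
   operator from X_{1/2} to X_{-1/2}, and [Cstar C] is the adjoint of C. *)
Definition Aext (x : H) : H -> R := fun psi => dotX (1 / 2) x psi.
Definition Cstar (C : H -> H) (y : H) : H -> R := fun psi => ip y (C psi).
Definition eq_Xminus (l1 l2 : H -> R) := forall psi, X (1 / 2) psi -> l1 psi = l2 psi.

(* w_tt + A w = f on [0,T], w(0) = w0, w_t(0) = w1, with w in
   C([0,T]; X_{1/2}) and in C^1([0,T]; H), of derivative wt.  The equation holds
   in X_{-1/2}, tested against psi in X_{1/2} and integrated over [0,t]. *)
Definition wave_solution (T : R) (f : R -> H) (w0 w1 : H) (w wt : R -> H) :=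
  [/\ w 0 = w0 /\ wt 0 = w1,
      forall t, t \in `[0, T] -> X (1 / 2) (w t) /\
        (normX2 (1 / 2) (w s - w t) @[s --> within `[0, T] (nbhs t)] --> 0%E),
      {within `[0, T], continuous wt},
      forall t, t \in `[0, T] ->
        ((s - t)^-1 *: (w s - w t) @[s --> within `[0, T] (t^')] --> wt t) &
      forall psi t, X (1 / 2) psi -> t \in `[0, T] ->
        ip (wt t) psi = ip w1 psi +
          Rintegral lebesgue_measure `[0, t]
            (fun s => ip (f s) psi - Aext (w s) psi)].

End Scale.

Section Control.
Context (R : realType) (H : completeNormedModType R).

(* Borel measurability, which is strong measurability since H is separable in
   the presence of an orthonormal basis indexed by nat. *)
Definition bmeasurable (T : R) (u : R -> H) :=
  measurable_fun `[0, T] (u : measurableTypeR R -> g_sigma_algebraType (@open H)).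

Definition L2 (T : R) (u : R -> H) := bmeasurable T u /\
  (\int[lebesgue_measure]_(t in `[0%R, T]) (`|u t| ^+ 2)%:E < +oo)%E.

(* The list s stands for the simple function sum_(p in s) 1_{p.1} p.2. *)
Definition simple_fun (s : seq (set R * H)) (t : R) : H :=
  \sum_(p <- s) \1_(p.1) t *: p.2.

Definition simple_integral (T : R) (s : seq (set R * H)) : H :=
  \sum_(p <- s) fine (lebesgue_measure (`[0, T] `&` p.1)) *: p.2.

Definition is_bochner_integral (T : R) (f : R -> H) (v : H) :=
  bmeasurable T f /\ exists s : nat -> seq (set R * H),
  [/\ forall n p, p \in s n -> measurable (p.1 : set (measurableTypeR R)),
      (\int[lebesgue_measure]_(t in `[0%R, T])
         `|f t - simple_fun (s n) t|%:E)%E @[n --> \oo] --> 0%E &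
      simple_integral T (s n) @[n --> \oo] --> v].

Definition bochner_integral (T : R) (f : R -> H) : H :=
  get [set v | is_bochner_integral T f v].

Definition cost (C : H -> H) (z : H) (T : R) (w u : R -> H) : \bar R :=
  ((1 / 2)%:E * \int[lebesgue_measure]_(t in `[0%R, T])
    (`|u t| ^+ 2 + `|C (w t) - z| ^+ 2)%:E)%E.

Definition stationary_optimal (D : set H) (A B C : H -> H) (z w u : H) :=
  [/\ D w, A w = B u & forall w' u', D w' -> A w' = B u' ->
    `|u| ^+ 2 + `|C w - z| ^+ 2 <= `|u'| ^+ 2 + `|C w' - z| ^+ 2].

Context (ip : {dot H for idfun}) (lam : nat -> R) (phi : nat -> H).

Definition admissible (B : H -> H) (w0 w1 : H) (T : R) (w u : R -> H) :=
  L2 T u /\ exists wt, wave_solution ip lam phi T (B \o u) w0 w1 w wt.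

Definition optimal (B C : H -> H) (z w0 w1 : H) (T : R) (w u : R -> H) :=
  admissible B w0 w1 T w u /\
  forall w' u', admissible B w0 w1 T w' u' ->
    (cost C z T w u <= cost C z T w' u')%E.

End Control.

(* Main.v *)
(* Write y = w^T - wbar, v = u^T - ubar and I = int_0^T |v|^2 + |Cy|^2.  First-order
   optimality of (wbar, ubar) and the wave equation tested against pbar turn the
   cost into I/2 - <y_t(T), pbar> plus a constant, so that the optimal pair
   minimizes I - 2 <y_t(T), pbar>.
   - Upper bound.  By the inequality on B, no nonzero state is orthogonal to the
     states reachable at time T0 with step controls: these are dense, and some
     control, switched off at T0, leaves an energy smaller than e.  The energy
     being conserved afterwards, I <= K_e + M e T for this competitor.
   - Boundary term.  The inequality on C, applied to the free solution issued from
     (y, y_t)(T - T1), bounds each mode of y_t(T) by a multiple of sqrt I, whereas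
     the energy estimate |y_t(T)|^2 <= K (1 + T I) is multiplied by the tail of the
     expansion of pbar, which is small.
   Hence I = o(T).  Integrating the wave equation, A int_0^T y is equal to
   y_t(0) - y_t(T) + int_0^T B v, which is o(T) in H: this gives the second limit. *)
Require Import Defs.
From HB Require Import structures.
From mathcomp Require Import all_boot all_order all_algebra.
From mathcomp Require Import sesquilinear.
From mathcomp Require Import all_classical all_reals all_analysis.
From mathcomp Require Import measurable_realfun.
From mathcomp Require Import ring lra.
Set Implicit Arguments.
Unset Strict Implicit.
Unset Printing Implicit Defensive.
Import Order.TTheory GRing.Theory Num.Theory.
Import numFieldNormedType.Exports.
Local Open Scope classical_set_scope.
Local Open Scope ring_scope.

(** Both observability inequalities lose derivatives: they control each mode, with a constant that
    may degenerate along the spectrum, and yield no uniform decay. Hence the splitting of pbar at a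
    finite mode N. Given delta, the competitor and N are chosen before the horizon T, and every
    constant depending on N is paid for by taking T large. The wave equation is read mode by mode.
    Tested against phi_n it becomes a scalar oscillator, whose Duhamel formula holds for forces
    merely integrable in time; norms in H are recovered from finite sums of squared coordinates,
    through Bessel's inequality and a Minkowski inequality for sums of squared integrals. Step
    controls have an explicit response, so that only free solutions and responses to pulses have to
    be constructed. They also explain why the inequality on B bears on w_t: a vector orthogonal to
    all pulse responses yields a free solution psi for which (B h, psi(s)) is constant in s, and
    differentiating in s gives B* psi_t = 0. *)

Section Hilbert.
Context (R : realType) (H : completeNormedModType R) (ip : {dot H for idfun}).
Hypothesis hH : induces_norm ip.

(** * Algebra of the scalar product *)

Lemma ipC x y : ip x y = ip y x.
Proof. by rewrite hermC /= expr0 mul1r. Qed.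

Lemma ipDl x y z : ip (x + y) z = ip x z + ip y z.
Proof. exact: linearDl. Qed.

Lemma ipBl x y z : ip (x - y) z = ip x z - ip y z.
Proof. exact: linearBl. Qed.

Lemma ip0l z : ip 0 z = 0.
Proof. exact: linear0l. Qed.

Lemma ipZl a x z : ip (a *: x) z = a * ip x z.
Proof. exact: linearZl_LR. Qed.

Lemma ipDr x y z : ip z (x + y) = ip z x + ip z y.
Proof. by rewrite !(ipC z) ipDl. Qed.

Lemma ipBr x y z : ip z (x - y) = ip z x - ip z y.
Proof. by rewrite !(ipC z) ipBl. Qed.

Lemma ipZr a x z : ip z (a *: x) = a * ip z x.
Proof. by rewrite !(ipC z) ipZl. Qed.

Lemma ip_suml I (r : seq I) (P : pred I) (F : I -> H) z :
  ip (\sum_(i <- r | P i) F i) z = \sum_(i <- r | P i) ip (F i) z.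
Proof.
by apply: (big_morph (fun x => ip x z)) => [x y|]; [exact: ipDl|exact: ip0l].
Qed.

Lemma cauchy_schwarz (x y : H) : `|ip x y| <= `|x| * `|y|.
Proof.
have [->|y0] := eqVneq y 0.
  by rewrite ipC ip0l normr0 mulr_ge0.
(* The vector is |y|^2 times the component of x orthogonal to y; its squared norm is |y|^2 times the
   quantity to be proved nonnegative. *)
have h : 0 <= ip (ip y y *: x - ip x y *: y) (ip y y *: x - ip x y *: y).
  by rewrite hH sqr_ge0.
have yy : 0 < ip y y by rewrite hH exprn_gt0 ?normr_gt0.
rewrite -(@ler_pXn2r _ 2) ?nnegrE ?mulr_ge0 // exprMn -!hH.
rewrite real_normK ?num_real // -subr_ge0 -(pmulr_rge0 _ yy).
move: h; rewrite !(ipBl, ipBr, ipZl, ipZr) (ipC y x) => h.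
by apply: le_trans h _; rewrite le_eqVlt; apply/orP; left; apply/eqP; ring.
Qed.

Lemma norm2D (x y : H) : `|x + y| ^+ 2 = `|x| ^+ 2 + 2 * ip x y + `|y| ^+ 2.
Proof. by rewrite -!hH !(ipDl, ipDr) (ipC y x); ring. Qed.

Lemma norm2D_le (x y : H) : `|x + y| ^+ 2 <= 2 * `|x| ^+ 2 + 2 * `|y| ^+ 2.
Proof.
rewrite -subr_ge0 -!hH !(ipDl, ipDr) (ipC y x).
apply: le_trans (sqr_ge0 `|x - y|) _.
by rewrite -hH !(ipBl, ipBr) (ipC y x) le_eqVlt; apply/orP; left; apply/eqP; ring.
Qed.

Lemma cvg_ip (T : Type) (F : set_system T) {FF : Filter F} (f : T -> H) l (y : H) :
  f @ F --> l -> ip (f x) y @[x --> F] --> ip l y.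
Proof.
move=> fl; apply/cvgrPdist_lt => e e0.
have y1 : 0 < `|y| + 1 by rewrite ltr_pwDr.
move/cvgrPdist_lt : fl => /(_ _ (divr_gt0 e0 y1)); apply: filterS => x h.
rewrite -ipBl (le_lt_trans (cauchy_schwarz _ _))//.
rewrite (@le_lt_trans _ _ (`|l - f x| * (`|y| + 1)))//.
  by rewrite ler_wpM2l// lerDl.
by rewrite -ltr_pdivlMr.
Qed.

(** * Expansions in the orthonormal basis *)

Context (phi : nat -> H) (hphi : orthonormal_basis ip phi).

Lemma ip_phi i j : ip (phi i) (phi j) = (i == j)%:R.
Proof. by have [h _] := hphi; exact: h. Qed.

Lemma ip_comb (r : seq nat) (a : nat -> R) n : uniq r ->
  ip (\sum_(i <- r) a i *: phi i) (phi n) = if n \in r then a n else 0.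
Proof.
move=> ur; rewrite ip_suml; case: ifPn => nr.
  rewrite (bigD1_seq n)//= ipZl ip_phi eqxx mulr1 big1 ?addr0// => i ni.
  by rewrite ipZl ip_phi (negbTE ni) mulr0.
rewrite big1_seq// => i /andP[_ ir]; rewrite ipZl ip_phi.
by case: eqP => [ein|]; rewrite ?mulr0//; rewrite -ein ir in nr.
Qed.

Lemma norm_comb (r : seq nat) (a : nat -> R) : uniq r ->
  `|\sum_(i <- r) a i *: phi i| ^+ 2 = \sum_(i <- r) a i ^+ 2.
Proof.
move=> ur; rewrite -hH ip_suml; apply: eq_big_seq => i ir.
by rewrite ipZl ipC ip_comb// ir expr2.
Qed.

Definition psum (a : nat -> R) N : H := \sum_(0 <= n < N) a n *: phi n.

Lemma co_psum a N n : ip (psum a N) (phi n) = if (n < N)%N then a n else 0.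
Proof. by rewrite ip_comb ?iota_uniq// mem_index_iota. Qed.

Lemma norm_psum a N : `|psum a N| ^+ 2 = \sum_(0 <= n < N) a n ^+ 2.
Proof. by rewrite norm_comb ?iota_uniq. Qed.

Lemma ip_psum a N x : ip (psum a N) x = \sum_(0 <= n < N) a n * ip x (phi n).
Proof. by rewrite ip_suml; apply: eq_bigr => n _; rewrite ipZl (ipC x). Qed.

Lemma bessel x N : \sum_(0 <= n < N) ip x (phi n) ^+ 2 <= `|x| ^+ 2.
Proof.
set a := fun n => ip x (phi n).
have : 0 <= `|x - psum a N| ^+ 2 by rewrite sqr_ge0.
rewrite -hH !(ipBl, ipBr) !hH norm_psum (ipC x) ip_psum.
rewrite (_ : \sum_(0 <= n < N) a n * _ = \sum_(0 <= n < N) a n ^+ 2); last first.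
  by apply: eq_bigr => n _; rewrite expr2.
by rewrite subrr subr0 subr_ge0.
Qed.

Lemma cvg_psum_co x : psum (fun n => ip x (phi n)) N @[N --> \oo] --> x.
Proof. by have [_ h] := hphi; exact: h. Qed.

(** Converse of Bessel's inequality: the partial sums tend to x in norm. Most norm estimates below
    are obtained in this way from estimates on modes. *)
Lemma norm2_le x K : (forall N, \sum_(0 <= n < N) ip x (phi n) ^+ 2 <= K) ->
  `|x| ^+ 2 <= K.
Proof.
move=> h.
have c : `|psum (fun n => ip x (phi n)) N| ^+ 2 @[N --> \oo] --> `|x| ^+ 2.
  by apply: cvgM; apply: cvg_norm; exact: cvg_psum_co.
rewrite -(cvg_lim _ c)//; apply: limr_le; first exact: cvgP c.
by near=> N; rewrite norm_psum.
Unshelve. all: by end_near. Qed.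

Lemma co_inj x y : (forall n, ip x (phi n) = ip y (phi n)) -> x = y.
Proof.
move=> h; apply/eqP; rewrite -subr_eq0 -normr_eq0 -sqrf_eq0 eq_le sqr_ge0 andbT.
apply: norm2_le => N; rewrite big1// => n _.
by rewrite ipBl h subrr expr0n.
Qed.

(** Square summability as a bound on partial sums, the form in which Bessel's inequality delivers
    it. *)
Definition sqs (a : nat -> R) :=
  exists K, forall N, \sum_(0 <= n < N) a n ^+ 2 <= K.

Lemma sqs_co x : sqs (fun n => ip x (phi n)).
Proof. by exists (`|x| ^+ 2) => N; exact: bessel. Qed.

Lemma sqs_bound a b k : sqs b -> (forall n, `|a n| <= k * `|b n|) -> sqs a.
Proof.
move=> [K hK] h; exists (k ^+ 2 * K) => N.
apply: (@le_trans _ _ (k ^+ 2 * \sum_(0 <= n < N) b n ^+ 2)); last first.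
  by rewrite ler_wpM2l// sqr_ge0.
rewrite mulr_sumr; apply: ler_sum => n _.
rewrite -(real_normK (num_real (a n))) -(real_normK (num_real (b n))) -exprMn.
by rewrite lerXn2r ?nnegrE// (le_trans _ (h n)).
Qed.

Lemma sqsD a b : sqs a -> sqs b -> sqs (fun n => a n + b n).
Proof.
move=> [K hK] [L hL]; exists (2 * K + 2 * L) => N.
apply: (@le_trans _ _ (2 * (\sum_(0 <= n < N) a n ^+ 2) + 2 * \sum_(0 <= n < N) b n ^+ 2)).
  rewrite !mulr_sumr -big_split/=; apply: ler_sum => n _.
  by rewrite -subr_ge0; apply: le_trans (sqr_ge0 (a n - b n)) _;
    rewrite le_eqVlt; apply/orP; left; apply/eqP; ring.
by rewrite lerD// ler_wpM2l.
Qed.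

Lemma sqs_tail a e : sqs a -> 0 < e -> exists N0, forall N1 N2, (N0 <= N1)%N ->
  \sum_(N1 <= n < N2) a n ^+ 2 <= e.
Proof.
move=> [K hK] e0.
have c : cvgn (series (fun n => a n ^+ 2)).
  apply: nondecreasing_is_cvgn.
    by apply: nondecreasing_series => n _ _; exact: sqr_ge0.
  by exists K => _ [N _ <-]; exact: hK.
have /cvg_cauchy/cauchy_seriesP/(_ e e0)[[A B] [[n1 _ h1] [n2 _ h2]] hAB] := c.
exists (maxn n1 n2) => N1 N2; rewrite geq_max => /andP[N11 N12].
have [N21|/ltnW N21] := leqP N2 N1; first by rewrite big_geq// ltW.
have := hAB (N1, N2) (conj (h1 _ N11) (h2 _ (leq_trans N12 N21))).
by move=> /= h; rewrite (le_trans (ler_norm _))// ltW.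
Qed.

(** Meaningful for square summable [a]; otherwise [lim] is a default value. *)
Definition synth a : H := lim (psum a @ \oo).

Lemma cvg_synth a : sqs a -> psum a N @[N --> \oo] --> synth a.
Proof.
move=> sa; apply: cauchy_cvg; apply/cauchy_seriesP => e e0.
have [N0 hN0] := sqs_tail sa (exprn_gt0 2 (divr_gt0 e0 (ltr0n _ 2))).
exists ([set n | (N0 <= n)%N], setT); first by split; [exists N0|exact: filterT].
move=> [N1 N2] [/= N01 _].
rewrite (@le_lt_trans _ _ (e / 2))//; last by lra.
rewrite -(@ler_pXn2r _ 2) ?nnegrE ?divr_ge0 ?(ltW e0)//.
by rewrite norm_comb ?iota_uniq ?hN0.
Qed.

Lemma co_synth a n : sqs a -> ip (synth a) (phi n) = a n.
Proof.
move=> sa; have /cvg_lim <- // : ip (psum a N) (phi n) @[N --> \oo] --> ip (synth a) (phi n).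
  by apply: cvg_ip; exact: cvg_synth.
apply: lim_near_cst => //; near=> N; rewrite co_psum.
by have -> : (n < N)%N by near: N; exact: nbhs_infty_gt.
Unshelve. all: by end_near. Qed.

Lemma norm_synth_le a K : (forall N, \sum_(0 <= n < N) a n ^+ 2 <= K) ->
  `|synth a| ^+ 2 <= K.
Proof.
move=> h; apply: norm2_le => N; apply: le_trans (h N).
by apply: ler_sum => n _; rewrite co_synth//; exists K.
Qed.

(** Dominated convergence for expansions: finitely many modes converge one by one, and the others
    are uniformly small because of the square summable bound [M]. Continuity and differentiability
    in time of the constructed solutions both come from it. *)
Lemma cvg_synth_dom (T : Type) (F : set_system T) {FF : ProperFilter F}
    (g : T -> nat -> R) (l M : nat -> R) : sqs M ->
  (\forall s \near F, forall n, `|g s n| <= M n) ->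
  (forall n, g s n @[s --> F] --> l n) ->
  synth (g s) @[s --> F] --> synth l.
Proof.
move=> sM gM gl.
have M0 n : 0 <= M n.
  by have [s /(_ n)] := filter_ex gM; apply: le_trans.
have lM n : `|l n| <= M n.
  have c : `|g s n| @[s --> F] --> `|l n| by apply: cvg_norm; exact: gl.
  rewrite -(cvg_lim _ c)//; apply: limr_le; first exact: cvgP c.
  by apply: filterS gM => s.
have sl : sqs l.
  by apply: (@sqs_bound l M 1 sM) => n; rewrite mul1r (ger0_norm (M0 n)).
apply/cvgrPdist_le => e e0.
(* The head contributes at most e^2 / 8. In the tail |l n - g s n| <= 2 M n, hence at most 4 e^2 /
   8; the total stays below e^2. *)
have e2 : 0 < e ^+ 2 / 8 by rewrite divr_gt0 ?exprn_gt0.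
have [N0 hN0] := sqs_tail sM e2.
have c : \sum_(0 <= n < N0) (l n - g s n) ^+ 2 @[s --> F] --> (0 : R).
  rewrite [X in _ --> X](_ : 0 = \sum_(0 <= n < N0) (l n - l n) ^+ 2); last first.
    by rewrite big1// => n _; rewrite subrr expr0n.
  apply: cvg_big => [|n _]; [exact: add_continuous|].
  by apply: cvgM; apply: cvgB; (try exact: cvg_cst); exact: gl.
move/cvgrPdist_le : c => /(_ _ e2) c.
move: gM c; apply: filterS2 => s gM c.
have sg : sqs (g s).
  by apply: (@sqs_bound _ M 1 sM) => n; rewrite mul1r (ger0_norm (M0 n)).
rewrite -(@ler_pXn2r _ 2) ?nnegrE ?(ltW e0)//; apply: norm2_le => N.
apply: (@le_trans _ _ (\sum_(0 <= n < N0) (l n - g s n) ^+ 2 +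
   4 * \sum_(N0 <= n < N) M n ^+ 2)).
  have tail (a b : nat) : (N0 <= a)%N ->
      \sum_(a <= n < b) ip (synth l - synth (g s)) (phi n) ^+ 2 <=
      4 * \sum_(a <= n < b) M n ^+ 2.
    move=> _; rewrite mulr_sumr; apply: ler_sum => n _.
    rewrite ipBl !co_synth// -(real_normK (num_real (_ - _))).
    rewrite (_ : 4 = 2 ^+ 2); last by ring.
    rewrite -exprMn lerXn2r ?nnegrE ?mulr_ge0//.
    by rewrite (le_trans (ler_normB _ _))// mulr2n mulrDl mul1r lerD.
  have [NN|/ltnW NN] := leqP N N0.
    rewrite (big_geq NN) mulr0 addr0 [leRHS](big_cat_nat _ NN)//=.
    rewrite [leLHS](_ : _ = \sum_(0 <= i < N) (l i - g s i) ^+ 2); last first.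
      by apply: eq_bigr => n _; rewrite ipBl !co_synth.
    by rewrite lerDl sumr_ge0// => n _; exact: sqr_ge0.
  rewrite [leLHS](big_cat_nat _ NN)//= lerD ?tail//.
  by apply: ler_sum => n _; rewrite ipBl !co_synth.
have := hN0 N0 N (leqnn _); move: c; rewrite sub0r normrN ger0_norm; last first.
  by apply: sumr_ge0 => n _; exact: sqr_ge0.
by move=> h1 h2; lra.
Qed.

Lemma cvg_parseval x y :
  \sum_(0 <= n < N) ip x (phi n) * ip y (phi n) @[N --> \oo] --> ip x y.
Proof.
under eq_fun do rewrite -(ip_psum (fun n => ip x (phi n))).
by apply: cvg_ip; exact: cvg_psum_co.
Qed.

End Hilbert.

(** * The space X_{1/2} through the square root of A *)

Section EnergySpace.
Context (R : realType) (H : completeNormedModType R) (ip : {dot H for idfun}).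
Hypothesis hH : induces_norm ip.
Context (phi : nat -> H) (hphi : orthonormal_basis ip phi).
Context (lam : nat -> R) (hlam : forall n, 0 < lam n).

Local Notation normX2 := (normX2 ip lam phi).
Local Notation X := (X ip lam phi).

(** The terms are nonnegative, so a bound on the extended real series is a bound on its real partial
    sums. *)
Lemma normX2_leP beta x K : (normX2 beta x <= K%:E)%E <->
  forall N, \sum_(0 <= n < N) lam n `^ (4 * beta) * ip x (phi n) ^+ 2 <= K.
Proof.
have ge0 n : (0 <= (lam n `^ (4 * beta) * ip x (phi n) ^+ 2)%:E)%E.
  by rewrite lee_fin mulr_ge0 ?powR_ge0 ?sqr_ge0.
split=> [h N|h].
  by rewrite -lee_fin -sumEFin; apply: le_trans h; exact: nneseries_lim_ge.
apply: lime_le; first exact: is_cvg_nneseries.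
by near=> N; rewrite sumEFin lee_fin.
Unshelve. all: by end_near. Qed.

Lemma powR_half n : lam n `^ (4 * (1 / 2)) = lam n ^+ 2.
Proof. by rewrite (_ : 4 * (1 / 2) = 2%:R) ?powR_mulrn ?ltW//; field. Qed.

Definition X12 (x : H) := sqs (fun n => lam n * ip x (phi n)).

Lemma X12P x : X (1 / 2) x <-> X12 x.
Proof.
split=> [xX|[K hK]].
  have n0 : (0 <= normX2 (1 / 2) x)%E.
    by apply: nneseries_ge0 => n _ _; rewrite lee_fin mulr_ge0 ?powR_ge0 ?sqr_ge0.
  exists (fine (normX2 (1 / 2) x)) => N.
  have /normX2_leP/(_ N) : (normX2 (1 / 2) x <= (fine (normX2 (1 / 2) x))%:E)%E.
    by rewrite fineK// ge0_fin_numE.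
  by under eq_bigr do rewrite powR_half -exprMn.
have : (normX2 (1 / 2) x <= K%:E)%E.
  apply/normX2_leP => N; apply: le_trans (hK N).
  by under eq_bigr do rewrite powR_half -exprMn.
by move=> h; rewrite /X/= (le_lt_trans h)// ltry.
Qed.

(* The square root of A, an isometry of X_{1/2} into H. *)
Definition Lop (x : H) := synth phi (fun n => lam n * ip x (phi n)).

Lemma co_Lop x n : X12 x -> ip (Lop x) (phi n) = lam n * ip x (phi n).
Proof. exact: co_synth. Qed.

Lemma normX2_half x : X12 x -> normX2 (1 / 2) x = (`|Lop x| ^+ 2)%:E.
Proof.
move=> xX; apply/eqP; rewrite eq_le; apply/andP; split.
  apply/normX2_leP => N; apply: le_trans (bessel hH hphi (Lop x) N).
  by apply: ler_sum => n _; rewrite co_Lop// powR_half exprMn.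
have /X12P xX' := xX.
have n0 : (0 <= normX2 (1 / 2) x)%E.
  by apply: nneseries_ge0 => n _ _; rewrite lee_fin mulr_ge0 ?powR_ge0 ?sqr_ge0.
rewrite -[leRHS]fineK ?ge0_fin_numE// lee_fin; apply: (norm2_le hH hphi) => N.
have /normX2_leP/(_ N) : (normX2 (1 / 2) x <= (fine (normX2 (1 / 2) x))%:E)%E.
  by rewrite fineK// ge0_fin_numE.
apply: le_trans; apply: ler_sum => n _.
by rewrite co_Lop// powR_half exprMn.
Qed.

Lemma dotX_half x y : X12 x -> X12 y ->
  dotX ip lam phi (1 / 2) x y = ip (Lop x) (Lop y).
Proof.
move=> xX yX; apply: cvg_lim => //; have := @cvg_parseval _ _ _ hH _ hphi (Lop x) (Lop y).
apply: cvg_trans; apply: near_eq_cvg; near=> N.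
apply: eq_bigr => n _.
by rewrite !co_Lop// powR_half; ring.
Unshelve. all: by end_near. Qed.

Lemma X12_lin a x y : X12 x -> X12 y -> X12 (a *: x + y).
Proof.
move=> xX yX; rewrite /X12.
under eq_fun do rewrite ipDl ipZl mulrDr; apply: sqsD => //.
apply: (sqs_bound xX (k := `|a|)) => n.
by rewrite -normrM mulrCA.
Qed.

Lemma X12_0 : X12 0.
Proof. by exists 0 => N; rewrite big1// => n _; rewrite ip0l mulr0 expr0n. Qed.

Lemma X12D x y : X12 x -> X12 y -> X12 (x + y).
Proof. by move=> xX yX; rewrite -[x]scale1r; exact: X12_lin. Qed.

Lemma X12Z a x : X12 x -> X12 (a *: x).
Proof. by move=> xX; rewrite -[a *: x]addr0; apply: X12_lin => //; exact: X12_0. Qed.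

Lemma X12B x y : X12 x -> X12 y -> X12 (x - y).
Proof. by move=> xX yX; rewrite -scaleN1r; apply: X12D => //; exact: X12Z. Qed.

Lemma Lop_lin a x y : X12 x -> X12 y -> Lop (a *: x + y) = a *: Lop x + Lop y.
Proof.
move=> xX yX; apply: (co_inj hH hphi) => n.
rewrite co_Lop; last exact: X12_lin.
by rewrite !(ipDl, ipZl) !co_Lop//; ring.
Qed.

Lemma LopD x y : X12 x -> X12 y -> Lop (x + y) = Lop x + Lop y.
Proof. by move=> xX yX; rewrite -[x]scale1r Lop_lin// !scale1r. Qed.

Lemma LopB x y : X12 x -> X12 y -> Lop (x - y) = Lop x - Lop y.
Proof.
move=> xX yX; rewrite [x - y]addrC -(scaleN1r y) Lop_lin//.
by rewrite scaleN1r addrC.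
Qed.

Lemma X12_phi n : X12 (phi n).
Proof.
apply: (sqs_bound (sqs_co hH hphi (lam n *: phi n)) (k := 1)) => i.
rewrite mul1r ipZl ip_phi//.
by have [->|ni] := eqVneq n i; rewrite ?mulr0 ?normr0.
Qed.

Lemma Lop_phi n : Lop (phi n) = lam n *: phi n.
Proof.
apply: (co_inj hH hphi) => i; rewrite co_Lop; last exact: X12_phi.
rewrite ipZl ip_phi//.
by have [->|ni] := eqVneq n i; rewrite ?mulr0 ?normr0.
Qed.

(* A [wave_solution] whose convergences are all in H. *)
Definition wsol (T : R) (f : R -> H) (w0 w1 : H) (w wt : R -> H) :=
  [/\ w 0 = w0 /\ wt 0 = w1,
      forall t, t \in `[0, T] -> X12 (w t),
      {within `[0, T], continuous (Lop \o w)},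
      {within `[0, T], continuous wt} &
      (forall t, t \in `[0, T] ->
        ((s - t)^-1 *: (w s - w t) @[s --> within `[0, T] (t^')] --> wt t)) /\
      (forall psi t, X12 psi -> t \in `[0, T] ->
        ip (wt t) psi = ip w1 psi +
          Rintegral lebesgue_measure `[0, t]
            (fun s => ip (f s) psi - ip (Lop (w s)) (Lop psi)))].

(** [Lop] carries the norm and scalar product of X_{1/2} to those of H: continuity of w in X_{1/2}
    is continuity of [Lop \o w] in H, and the form [Aext] becomes a scalar product of H. *)
Lemma wave_solutionP T f w0 w1 w wt :
  wave_solution ip lam phi T f w0 w1 w wt <-> wsol T f w0 w1 w wt.
Proof.
have sub t psi : X12 psi -> t \in `[0, T] ->
    (forall t, t \in `[0, T] -> X12 (w t)) ->
    Rintegral lebesgue_measure `[0, t]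
      (fun s => ip (f s) psi - Aext ip lam phi (w s) psi) =
    Rintegral lebesgue_measure `[0, t]
      (fun s => ip (f s) psi - ip (Lop (w s)) (Lop psi)).
  move=> psiX tT wX; apply: eq_Rintegral => s; rewrite inE/= => st.
  rewrite /Aext dotX_half//; apply: wX; move: st tT; rewrite !in_itv/=.
  by move=> /andP[-> h] /andP[_]; exact: le_trans.
split=> -[h1 h2 h3 h4 h5].
  have wX t : t \in `[0, T] -> X12 (w t) by move=> /h2[/X12P].
  split => //; last first.
    by split => // psi t psiX tT; rewrite -sub// h5//; exact/X12P.
  apply/subspace_continuousP => t tT; have [_ c] := h2 _ tT.
  apply/cvgrPdist_lt => e e0; move/fine_cvg : c => /cvgrPdist_lt.
  move=> /(_ _ (exprn_gt0 2 e0)).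
  rewrite !near_withinE; apply: filterS => s h sT; have := h sT.
  rewrite /= normX2_half; last by apply: X12B; exact: wX.
  rewrite sub0r normrN LopB; [|exact: wX..].
  rewrite /= ger0_norm ?sqr_ge0// distrC.
  by rewrite ltr_pXn2r ?nnegrE// ltW.
have [h5a h5b] := h5; split => //; last first.
  by move=> psi t /X12P psiX tT; rewrite h5b// sub.
move=> t tT; split; first by apply/X12P/h2.
move/subspace_continuousP : h3 => /(_ _ tT) c.
have E : \forall s \near within `[0, T] (nbhs t),
    normX2 (1 / 2) (w s - w t) = (`|Lop (w t) - Lop (w s)| ^+ 2)%:E.
  rewrite near_withinE; near=> s => sT; rewrite normX2_half.
    rewrite LopB; [|exact: h2..].
    by rewrite distrC.
  by apply: X12B; apply: h2.
apply: cvg_EFin; first by apply: filterS E => s ->.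
apply/cvgrPdist_lt => e e0; move/cvgrPdist_lt : c.
have s0 : 0 < Num.sqrt e by rewrite sqrtr_gt0.
move=> /(_ _ s0); apply: filterS2 E => s /= -> h.
rewrite /= sub0r normrN ger0_norm ?sqr_ge0//.
by rewrite -(sqr_sqrtr (ltW e0)) ltr_pXn2r ?nnegrE// sqrtr_ge0.
Unshelve. all: by end_near. Qed.

End EnergySpace.

(** * Real integrals over segments and Duhamel's formula for one oscillator *)

Section Calculus.
Context (R : realType).
Local Notation mu := (@lebesgue_measure R).
Implicit Types (f g F w v th : R -> R) (a b c : R).

Definition intg a b f := mu.-integrable `[a, b] (EFin \o f).
Definition itg a b f := \int[mu]_(x in `[a, b]) f x.

Lemma mitv a b : measurable (`[a, b]%classic : set (measurableTypeR R)).
Proof. exact: measurable_itv. Qed.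

Lemma intg_cont a b f : {within `[a, b], continuous f} -> intg a b f.
Proof. by move=> cf; apply: continuous_compact_integrable => //; exact: segment_compact. Qed.

Lemma intgD a b f g : intg a b f -> intg a b g -> intg a b (fun x => f x + g x).
Proof. by move=> hf hg; apply: (integrableD (mitv a b) hf hg). Qed.

Lemma intgZ a b k f : intg a b f -> intg a b (fun x => k * f x).
Proof. by move=> hf; apply: (integrableZl (mitv a b) k hf). Qed.

Lemma eq_intg a b f g : {in `[a, b], f =1 g} -> intg a b f -> intg a b g.
Proof.
move=> fg; apply: eq_integrable => // x; rewrite inE/= => xab.
by rewrite fg.
Qed.

Lemma intgB a b f g : intg a b f -> intg a b g -> intg a b (fun x => f x - g x).
Proof.
move=> hf hg; apply: eq_intg (intgD hf (intgZ (-1) hg)) => x _.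
by rewrite mulN1r.
Qed.

Lemma intg_sum a b (I : Type) (r : seq I) (h : I -> R -> R) :
  (forall i, intg a b (h i)) -> intg a b (fun x => \sum_(i <- r) h i x).
Proof.
move=> hh; elim: r => [|i r IH].
  apply: eq_intg (intg_cont (f := cst 0) _) => [x _|x]; first by rewrite big_nil.
  exact: cvg_cst.
by apply: eq_intg (intgD (hh i) IH) => x _; rewrite big_cons.
Qed.

Lemma intgS a b c d f : a <= c -> d <= b -> intg a b f -> intg c d f.
Proof.
move=> ac db; apply: integrableS => // x /=; rewrite !in_itv/= => /andP[cx xd].
by rewrite (le_trans ac)// (le_trans xd).
Qed.

Lemma intg_norm a b f : intg a b f -> intg a b (fun x => `|f x|).
Proof. by move=> hf; apply: (integrable_norm hf). Qed.

Lemma intg_measurable a b f : intg a b f -> measurable_fun `[a, b] f.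
Proof. by move=> /measurable_int/measurable_EFinP. Qed.

Lemma intg_dom a b f g : measurable_fun `[a, b] f -> intg a b g ->
  (forall x, x \in `[a, b] -> `|f x| <= g x) -> intg a b f.
Proof.
move=> mf hg fg; apply: (le_integrable (mitv a b) _ _ hg).
  exact/measurable_EFinP.
move=> x /= xab; rewrite lee_fin (le_trans (fg _ xab))//; exact: ler_norm.
Qed.

Lemma intgM a b K f g : intg a b f -> measurable_fun `[a, b] g ->
  (forall x, x \in `[a, b] -> `|g x| <= K) -> intg a b (fun x => g x * f x).
Proof.
move=> hf mg gK; apply: (@intg_dom _ _ _ (fun x => K * `|f x|)).
- by apply: measurable_funM => //; exact: intg_measurable.
- by apply: intgZ; exact: intg_norm.
- by move=> x xab; rewrite normrM ler_wpM2r// gK.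
Qed.

Lemma itgD a b f g : intg a b f -> intg a b g ->
  itg a b (fun x => f x + g x) = itg a b f + itg a b g.
Proof. by move=> hf hg; apply: RintegralD. Qed.

Lemma itgB a b f g : intg a b f -> intg a b g ->
  itg a b (fun x => f x - g x) = itg a b f - itg a b g.
Proof. by move=> hf hg; apply: RintegralB. Qed.

Lemma itgZ a b k f : intg a b f -> itg a b (fun x => k * f x) = k * itg a b f.
Proof. by move=> hf; apply: RintegralZl. Qed.

Lemma eq_itg a b f g : {in `[a, b], f =1 g} -> itg a b f = itg a b g.
Proof. by move=> fg; apply: eq_Rintegral => x; rewrite inE/= => xab; exact: fg. Qed.

Lemma itg_cst a b k : a <= b -> itg a b (cst k) = k * (b - a).
Proof.
move=> ab; rewrite /itg Rintegral_cst//= lebesgue_measure_itv/= lte_fin.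
move: ab; rewrite le_eqVlt => /predU1P[->|ab]; first by rewrite ltxx subrr.
by rewrite ab.
Qed.

Lemma itg_sum a b (I : Type) (r : seq I) (h : I -> R -> R) : a <= b ->
  (forall i, intg a b (h i)) ->
  itg a b (fun x => \sum_(i <- r) h i x) = \sum_(i <- r) itg a b (h i).
Proof.
move=> ab hh; elim: r => [|i r IH].
  rewrite big_nil -[RHS](mul0r (b - a)) -itg_cst//.
  by apply: eq_itg => x _; rewrite big_nil.
rewrite big_cons -IH -itgD//; last exact: intg_sum.
by apply: eq_itg => x _; rewrite big_cons.
Qed.

Lemma le_itg a b f g : intg a b f -> intg a b g ->
  (forall x, x \in `[a, b] -> f x <= g x) -> itg a b f <= itg a b g.
Proof. by move=> hf hg fg; apply: le_Rintegral. Qed.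

Lemma itg_ge0 a b f : (forall x, x \in `[a, b] -> 0 <= f x) -> 0 <= itg a b f.
Proof. by move=> f0; apply: Rintegral_ge0 => x; exact: f0. Qed.

Lemma norm_itg a b f : intg a b f -> `|itg a b f| <= itg a b (fun x => `|f x|).
Proof. by move=> hf; apply: le_normr_Rintegral. Qed.

Lemma itg_split a b c f : a <= c -> c <= b -> intg a b f ->
  itg a b f = itg a c f + itg c b f.
Proof.
move=> ac cb hf; apply/eqP; rewrite addrC -subr_eq; apply/eqP.
rewrite /itg (Rintegral_itvB hf) ?bnd_simp//.
rewrite Rintegral_itv_obnd_cbnd//; apply: integrableS hf => //.
move=> x /=; rewrite !in_itv/= => /andP[cx ->]; rewrite andbT.
by rewrite ltW// (le_lt_trans ac).
Qed.

Lemma itg_point a f : itg a a f = 0.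
Proof. by rewrite /itg set_itv1 Rintegral_set1. Qed.

Lemma ftc2 a b F f : a <= b -> {within `[a, b], continuous F} ->
  {within `[a, b], continuous f} ->
  (forall x, x \in `]a, b[ -> is_derive x (1 : R) F (f x)) ->
  itg a b f = F b - F a.
Proof.
rewrite le_eqVlt => /predU1P[-> *|ab cF cf dF].
  by rewrite itg_point subrr.
have /(continuous_within_itvP _ ab)[_ l r] := cF.
rewrite /itg /Rintegral (continuous_FTC2 (F := F) ab cf)//.
- by split => // x /dF [].
- by move=> x /dF h; rewrite derive1E; exact: derive_val.
Qed.

Lemma itv_oo_cc a b x : x \in `]a, b[ -> x \in `[a, b].
Proof. by rewrite !in_itv/= => /andP[/ltW-> /ltW->]. Qed.

Lemma cwithin_oo a b f x : {within `[a, b], continuous f} -> x \in `]a, b[ ->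
  {for x, continuous f}.
Proof.
move=> cf xab; apply: (within_continuous_continuous _ cf xab).
by move: xab; rewrite in_itv/= => /andP[/lt_trans]; apply.
Qed.

Lemma is_derive_itg a b f x : {within `[a, b], continuous f} -> x \in `]a, b[ ->
  is_derive x (1 : R) (fun t => itg a t f) (f x).
Proof.
move=> cf xab; have := xab; rewrite in_itv/= => /andP[ax xb].
have [h1 h2] := continuous_FTC1_closed xb (intg_cont cf) ax (cwithin_oo cf xab).
by apply: DeriveDef; [exact: h1|rewrite -h2 derive1E].
Qed.

Lemma cont_itg a b f : a <= b -> intg a b f ->
  {within `[a, b], continuous (fun t => itg a t f)}.
Proof. by move=> ab hf; exact: parameterized_integral_continuous. Qed.

Lemma cont_within (A : set R) f : continuous f -> {within A, continuous f}.
Proof. by move=> cf; apply: continuous_subspaceT. Qed.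

Lemma cwD (A : set R) f g : {within A, continuous f} ->
  {within A, continuous g} -> {within A, continuous (fun x => f x + g x)}.
Proof. by move=> cf cg x; apply: cvgD; [exact: cf|exact: cg]. Qed.

Lemma cwN (A : set R) f : {within A, continuous f} ->
  {within A, continuous (fun x => - f x)}.
Proof. by move=> cf x; apply: cvgN; exact: cf. Qed.

Lemma cwB (A : set R) f g : {within A, continuous f} ->
  {within A, continuous g} -> {within A, continuous (fun x => f x - g x)}.
Proof. by move=> cf cg; apply: cwD => //; exact: cwN. Qed.

Lemma cwM (A : set R) f g : {within A, continuous f} ->
  {within A, continuous g} -> {within A, continuous (fun x => f x * g x)}.
Proof. by move=> cf cg x; apply: cvgM; [exact: cf|exact: cg]. Qed.

Lemma le_itg_sub a b c d f : a <= c -> c <= d -> d <= b -> intg a b f ->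
  (forall x, x \in `[a, b] -> 0 <= f x) -> itg c d f <= itg a b f.
Proof.
move=> ac cd db hf f0.
have cb : c <= b by exact: le_trans cd db.
rewrite (itg_split ac cb hf) (itg_split (c := d) cd db); last exact: intgS hf.
have -> // : itg c d f <= itg a c f + (itg c d f + itg d b f).
have p1 : 0 <= itg a c f.
  apply: itg_ge0 => x; rewrite in_itv/= => /andP[h1 h2]; apply: f0.
  by rewrite in_itv/= h1 (le_trans h2).
have p2 : 0 <= itg d b f.
  apply: itg_ge0 => x; rewrite in_itv/= => /andP[h1 h2]; apply: f0.
  by rewrite in_itv/= h2 andbT (le_trans (le_trans ac cd)).
lra.
Qed.

Lemma parts_cont a b th th' g : a < b ->
  (forall x, is_derive x (1 : R) th (th' x)) -> continuous th' -> continuous g ->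
  itg a b (fun x => th x * g x) =
  th b * itg a b g - itg a b (fun x => th' x * itg a x g).
Proof.
move=> ab dth cth' cg.
have ig : intg a b g by apply: intg_cont; exact: cont_within.
have cth x : {for x, continuous th}.
  by apply/differentiable_continuous/derivable1_diffP; have [] := dth x.
have /(continuous_within_itvP _ ab)[_ l r] := cont_itg (ltW ab) ig.
rewrite /itg (Rintegration_by_parts (F := th) (G := fun t => itg a t g) (f := th')) //.
- by rewrite (_ : itg a a g = 0) ?mulr0 ?subr0// itg_point.
- exact: cont_within.
- split; first by move=> x _; have [] := dth x.
  + by apply: cvg_at_right_filter; exact: cth.
  + by apply: cvg_at_left_filter; exact: cth.
- by move=> x _; rewrite derive1E; have := dth x => h; exact: derive_val.
- exact: cont_within.
- split => // x xab.
  by have [] := is_derive_itg (cont_within (A := `[a, b]) cg) xab.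
- move=> x xab; rewrite derive1E.
  by have h := is_derive_itg (cont_within (A := `[a, b]) cg) xab; exact: derive_val.
Qed.

(* [f] is only integrable, so this is obtained by approximating it in L^1 by
   continuous functions. *)
Lemma parts_L1 a b th th' K f : a <= b ->
  (forall x, is_derive x (1 : R) th (th' x)) -> continuous th' ->
  (forall x, `|th x| <= K) -> (forall x, `|th' x| <= K) -> intg a b f ->
  itg a b (fun x => th x * f x) =
  th b * itg a b f - itg a b (fun x => th' x * itg a x f).
Proof.
move=> + dth cth' thK th'K hf; rewrite le_eqVlt => /predU1P[->|ab].
  by rewrite !itg_point mulr0 subrr.
have cth : continuous th.
  by move=> x; apply/differentiable_continuous/derivable1_diffP; have [] := dth x.
have K0 : 0 <= K by apply: le_trans (thK 0).
have [g [gc gi gl]] : exists g_ : (R -> R) ^nat, [/\ forall n, continuous (g_ n),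
    forall n, intg a b (g_ n) &
    (\int[mu]_(z in `[a, b]) `|(f z - g_ n z)%:E|)%E @[n --> \oo] --> 0%E].
  apply: approximation_continuous_integrable => //.
  rewrite -[X in (X < _)%E]/(lebesgue_measure `[a, b]).
  by rewrite lebesgue_measure_itv/=; case: ifP => _; rewrite ?ltry.
have mth : measurable_fun `[a, b] th.
  by apply: measurable_funTS; exact: continuous_measurable_fun.
have mth' : measurable_fun `[a, b] th'.
  by apply: measurable_funTS; exact: continuous_measurable_fun.
apply/eqP; rewrite -subr_eq0 -normr_le0; apply/ler_addgt0Pr => e e0; rewrite add0r.
(* Replacing [f] by [g n] costs three errors, which add up to L - 1 times the L^1 distance; the last
   1 makes [L] positive. *)
pose L := K + K + K * (b - a) + 1.
have L0 : 0 < L by rewrite /L ltr_wpDl// !addr_ge0// mulr_ge0// subr_ge0 ltW.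
move/fine_cvg/cvgrPdist_lt : gl => /(_ _ (divr_gt0 e0 L0))[n _ /(_ n (leqnn n))] /=.
set d := fine _.
have dE : d = itg a b (fun x => `|f x - g n x|) by [].
rewrite sub0r normrN dE => {}dE' /=.
have {dE'} dle : itg a b (fun x => `|f x - g n x|) <= e / L.
  by rewrite ltW// (le_lt_trans _ dE')// ler_norm.
have hd := intgB hf (gi n); have hdn := intg_norm hd.
have PB := parts_cont ab dth cth' (gc n).
have ithf : intg a b (fun x => th x * f x) by exact: intgM hf mth (fun x _ => thK x).
have ithg : intg a b (fun x => th x * g n x) by exact: intgM (gi n) mth (fun x _ => thK x).
have iG h : intg a b h -> intg a b (fun x => th' x * itg a x h).
  move=> hh; apply: (@intgM _ _ K) => //.
  by apply: intg_cont; apply: cont_itg => //; exact: ltW.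
pose A := itg a b (fun x => th x * f x - th x * g n x).
rewrite (_ : itg a b (fun x => th x * f x) = A + itg a b (fun x => th x * g n x)); last first.
  by rewrite /A itgB// subrK.
rewrite {}PB.
set B := itg a b f; set C := itg a b (g n).
have -> : A + (th b * C - itg a b (fun x => th' x * itg a x (g n))) -
   (th b * B - itg a b (fun x => th' x * itg a x f)) =
   A - th b * (B - C) + (itg a b (fun x => th' x * itg a x f) -
       itg a b (fun x => th' x * itg a x (g n))) by ring.
rewrite -itgB; [|exact: iG|exact: iG].
rewrite /B /C -itgB//.
have b1 : `|A| <= K * (e / L).
  apply: (@le_trans _ _ (K * itg a b (fun x => `|f x - g n x|))); last exact: ler_wpM2l.
  apply: (le_trans (norm_itg (intgB ithf ithg))).
  rewrite -itgZ//; apply: le_itg; [exact/intg_norm/intgB|exact: intgZ|].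
  by move=> x _; rewrite -mulrBr normrM ler_wpM2r.
have b2 c : a <= c -> c <= b -> `|itg a c (fun x => f x - g n x)| <= e / L.
  move=> ac cb; apply: le_trans (norm_itg (intgS (lexx a) cb hd)) _.
  by apply: le_trans dle; apply: le_itg_sub.
have b3 : `|itg a b (fun x => th' x * itg a x f - th' x * itg a x (g n))| <=
    K * (e / L) * (b - a).
  apply: le_trans (norm_itg (intgB (iG _ hf) (iG _ (gi n)))) _.
  rewrite -itg_cst ?(ltW ab)//; apply: le_itg.
  - by apply/intg_norm/intgB; exact: iG.
  - by apply: intg_cont; apply: cont_within; exact: cst_continuous.
  - move=> x; rewrite in_itv/= => /andP[ax xb].
    rewrite -mulrBr normrM ler_pM//.
    rewrite -itgB; [|exact: intgS hf|exact: intgS (gi n)].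
    exact: b2.
apply: (le_trans (ler_normD _ _)).
apply: (@le_trans _ _ (K * (e / L) + K * (e / L) + K * (e / L) * (b - a))).
  apply: lerD b3; apply: (le_trans (ler_normB _ _)); apply: lerD => //.
  by rewrite normrM ler_pM// b2// ltW.
have -> : K * (e / L) + K * (e / L) + K * (e / L) * (b - a) = (L - 1) * (e / L).
  by rewrite /L; ring.
rewrite mulrBl mul1r mulrCA divff ?gt_eqF// mulr1.
by rewrite lerBlDr lerDl divr_ge0// ltW.
Qed.

(** Formally (th v - th' w)' = th f, since v' = f - l^2 w and th'' = - l^2 th. As f is only
    integrable, v need not be differentiable: its forced part, the integral of f, is treated by
    [parts_L1], and the rest by the fundamental theorem of calculus. *)
Lemma duhamel a b l K w v f th th' : a <= b ->
  {within `[a, b], continuous w} -> {within `[a, b], continuous v} ->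
  (forall x, x \in `]a, b[ -> is_derive x (1 : R) w (v x)) ->
  intg a b f ->
  (forall t, t \in `[a, b] -> v t = v a + itg a t (fun s => f s - l ^+ 2 * w s)) ->
  (forall x, is_derive x (1 : R) th (th' x)) ->
  (forall x, is_derive x (1 : R) th' (- l ^+ 2 * th x)) ->
  (forall x, `|th x| <= K) -> (forall x, `|th' x| <= K) ->
  th b * v b - th' b * w b = th a * v a - th' a * w a + itg a b (fun x => th x * f x).
Proof.
move=> ab cw cv dw hf hv dth dth' thK th'K.
have iw := intg_cont cw.
have cth : continuous th.
  by move=> x; apply/differentiable_continuous/derivable1_diffP; have [] := dth x.
have cth' : continuous th'.
  by move=> x; apply/differentiable_continuous/derivable1_diffP; have [] := dth' x.
have hv' t : t \in `[a, b] -> v t = v a + itg a t f - l ^+ 2 * itg a t w.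
  move=> tab; rewrite hv//; move: tab; rewrite in_itv/= => /andP[at_ tb].
  rewrite itgB; [|exact: intgS hf|exact: intgZ (intgS _ _ iw)].
  by rewrite itgZ ?addrA//; exact: intgS iw.
(* This is th v - th' w with the integral of f removed from v. It is differentiable inside the
   interval, of derivative - th' times that integral. *)
pose Phi t := th t * (v a - l ^+ 2 * itg a t w) - th' t * w t.
have dPhi : itg a b (fun x => - (th' x * itg a x f)) = Phi b - Phi a.
  have cG := cont_itg ab hf; have cW := cont_itg ab iw.
  have c1 := cont_within (A := `[a, b]) cth; have c2 := cont_within (A := `[a, b]) cth'.
  apply: (ftc2 ab).
  - apply: cwB; apply: cwM => //; apply: cwB; first exact/cont_within/cst_continuous.
    by apply: cwM => //; exact/cont_within/cst_continuous.
  - by apply: cwN; exact: cwM.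
  - move=> x xab; have h1 := dth x; have h2 := dth' x; have h3 := dw _ xab.
    have h4 := is_derive_itg cw xab.
    rewrite /Phi; apply: is_derive_eq.
    rewrite /GRing.scale/= (hv' _ (itv_oo_cc xab)); ring.
have := parts_L1 ab dth cth' thK th'K hf.
have E : itg a b (fun x => - (th' x * itg a x f)) =
  - itg a b (fun x => th' x * itg a x f).
  rewrite -[RHS]mulN1r -itgZ; first by apply: eq_itg => x _; rewrite mulN1r.
  apply: (@intgM _ _ K) => //; first by apply: intg_cont; exact: cont_itg.
  by apply: measurable_funTS; exact: continuous_measurable_fun.
move=> ->; move: dPhi; rewrite E /Phi itg_point (hv' b); last by rewrite in_itv/= ab lexx.
move=> h; have {h} -> : itg a b (fun x => th' x * itg a x f) =
  - (th b * (v a - l ^+ 2 * itg a b w) - th' b * w b -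
       (th a * (v a - l ^+ 2 * 0) - th' a * w a)) by rewrite -h opprK.
ring.
Qed.

End Calculus.

(** * Square integrable functions with values in H, and the modes of a solution *)

Section SquareIntegrable.
Context (R : realType) (H : completeNormedModType R).
Implicit Types (u : R -> H) (a b T : R).

Lemma bmeasurable_real T u (g : H -> R) : bmeasurable T u -> continuous g ->
  measurable_fun `[0, T] (fun t => g (u t)).
Proof.
move=> mu_ /continuousP cg; apply: (measurability _ (RGenOpens.measurableE R)).
move=> _ [_ [x [y ->]] <-].
have := mu_ (mitv 0 T) (g @^-1` `]x, y[%classic).
apply; apply: sub_sigma_algebra; exact/cg/interval_open.
Qed.

Lemma bmeasurable_comp T u (g : H -> H) : bmeasurable T u -> continuous g ->
  bmeasurable T (g \o u).
Proof.
move=> mu_ /continuousP cg; rewrite /bmeasurable.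
apply: (measurability (rT := g_sigma_algebraType (@open H)) (@open H)) => //.
move=> _ [A oA <-]; have := mu_ (mitv 0 T) (g @^-1` A).
apply; apply: sub_sigma_algebra; exact: cg.
Qed.

Lemma bmeasurable_cont T u : {within `[0, T], continuous u} -> bmeasurable T u.
Proof.
move=> /continuousP cu; rewrite /bmeasurable.
apply: (measurability (rT := g_sigma_algebraType (@open H)) (@open H)) => //.
by move=> _ [A oA <-]; apply: open_measurable_subspace => //; exact: cu.
Qed.

Lemma norm_continuous_H : continuous (fun x : H => `|x|).
Proof. by move=> x; exact: norm_continuous. Qed.

Lemma L2P T u : L2 T u <-> bmeasurable T u /\ intg 0 T (fun t => `|u t| ^+ 2).
Proof.
split=> -[mu_ h]; split => //.
  apply/integrableP; split.
    apply/measurable_EFinP; apply: measurable_funX.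
    exact: bmeasurable_real mu_ norm_continuous_H.
  by under eq_integral do rewrite /= ger0_norm ?sqr_ge0//.
move/integrableP : h => [_]; congr (_ < _)%E.
by apply: eq_integral => t _; rewrite /= ger0_norm ?sqr_ge0.
Qed.

Lemma intg_cst a b k : intg a b (fun=> k : R).
Proof. by apply: intg_cont; apply: cont_within; exact: cst_continuous. Qed.

Lemma L2_intg T u (g : H -> R) k : L2 T u -> continuous g ->
  (forall x, `|g x| <= k * `|x|) -> intg 0 T (fun t => g (u t)).
Proof.
move=> /L2P[mu_ iu] cg gk.
apply: (@intg_dom _ _ _ _ (fun t => `|k| + `|k| * `|u t| ^+ 2)).
- exact: bmeasurable_real.
- by apply: intgD; [exact: intg_cst|exact: intgZ].
- move=> t _; apply: (le_trans (gk _)).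
  rewrite -[X in X + _]mulr1 -mulrDr.
  apply: (@le_trans _ _ (`|k| * `|u t|)); first by rewrite ler_wpM2r// ler_norm.
  rewrite ler_wpM2l//; have := sqr_ge0 (`|u t| - 1); have := normr_ge0 (u t).
  by nra.
Qed.

Lemma L2_norm T u : L2 T u -> intg 0 T (fun t => `|u t|).
Proof.
move=> hu; apply: (L2_intg hu norm_continuous_H (k := 1)) => x.
by rewrite normr_id mul1r.
Qed.

Lemma L2_addc T u h : L2 T u -> L2 T (fun t => u t + h).
Proof.
move=> /L2P[mu_ iu].
have mb : bmeasurable T (fun t => u t + h).
  apply: (bmeasurable_comp (g := fun x => x + h) mu_) => x.
  by apply: cvgD; [exact: cvg_id|exact: cvg_cst].
apply/L2P; split => //.
apply: (@intg_dom _ _ _ _ (fun t => 2 * `|u t| ^+ 2 + 2 * `|h| ^+ 2)).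
- by apply: measurable_funX; exact: bmeasurable_real mb norm_continuous_H.
- by apply: intgD; [exact: intgZ|exact: intg_cst].
- move=> t _; rewrite ger0_norm ?sqr_ge0//.
  have h1 := ler_normD (u t) h.
  have := sqr_ge0 (`|u t| - `|h|); have := normr_ge0 (u t + h).
  by have := normr_ge0 (u t); have := normr_ge0 h; nra.
Qed.

Lemma cauchy_schwarz_itg a b (f : R -> R) : a <= b -> intg a b f ->
  intg a b (fun t => f t ^+ 2) ->
  itg a b f ^+ 2 <= (b - a) * itg a b (fun t => f t ^+ 2).
Proof.
rewrite le_eqVlt => /predU1P[->|ab] hf hf2.
  by rewrite !itg_point subrr mulr0 expr0n.
have L0 : 0 < b - a by rewrite subr_gt0.
(* The mean of f: the inequality is the nonnegativity of the integral of (f - m)^2. *)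
pose m := itg a b f / (b - a).
have : 0 <= itg a b (fun t => f t ^+ 2 - 2 * m * f t + m ^+ 2).
  apply: itg_ge0 => t _; apply: le_trans (sqr_ge0 (f t - m)) _.
  by rewrite le_eqVlt; apply/orP; left; apply/eqP; ring.
set Q := itg a b (fun t => f t ^+ 2); set I := itg a b f.
have -> : itg a b (fun t => f t ^+ 2 - 2 * m * f t + m ^+ 2) =
    Q - 2 * m * I + m ^+ 2 * (b - a).
  rewrite itgD; [|by apply: intgB => //; exact: intgZ|exact: intg_cst].
  rewrite itgB//; last exact: intgZ.
  by rewrite (itgZ (2 * m) hf) (itg_cst (m ^+ 2) (ltW ab)).
have mI : m * (b - a) = I by rewrite /m divfK ?gt_eqF.
have -> : Q - 2 * m * I + m ^+ 2 * (b - a) = Q - m * I.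
  by rewrite -mI; ring.
rewrite subr_ge0 => h; rewrite -mI.
have := ler_wpM2l (ltW L0) h; apply: le_trans.
by rewrite -mI le_eqVlt; apply/orP; left; apply/eqP; ring.
Qed.

Context (ip : {dot H for idfun}).
Hypothesis hH : induces_norm ip.
Context (phi : nat -> H) (hphi : orthonormal_basis ip phi).

Lemma continuous_ip y : continuous (fun x : H => ip x y).
Proof. by move=> x; apply: (cvg_ip hH); exact: cvg_id. Qed.

Lemma L2_ip T u y : L2 T u -> intg 0 T (fun t => ip (u t) y).
Proof.
move=> hu; apply: (L2_intg hu (@continuous_ip y) (k := `|y|)) => x.
by rewrite mulrC; exact: cauchy_schwarz.
Qed.

(* The sum on the left is the integral of the product of F with the vector of
   coordinates e n * c n, where e is the vector of the integrals. *)
Lemma minkowski_modes a b (F : R -> H) (c : nat -> R -> R) N : a <= b ->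
  intg a b (fun t => `|F t|) ->
  (forall n, intg a b (fun t => c n t * ip (F t) (phi n))) ->
  (forall n t, `|c n t| <= 1) ->
  \sum_(0 <= n < N) itg a b (fun t => c n t * ip (F t) (phi n)) ^+ 2 <=
    itg a b (fun t => `|F t|) ^+ 2.
Proof.
move=> ab iF ic c1; set e := fun n => itg a b (fun t => c n t * ip (F t) (phi n)).
rewrite -/e; set S := \sum_(_ <= _ < _) _; set I := itg _ _ _.
have S0 : 0 <= S by apply: sumr_ge0 => n _; exact: sqr_ge0.
have I0 : 0 <= I by apply: itg_ge0.
have ie n : intg a b (fun t => e n * (c n t * ip (F t) (phi n))) by exact: intgZ.
have SI : S <= Num.sqrt S * I.
  have E : S =
      itg a b (fun t => \sum_(0 <= n < N) e n * (c n t * ip (F t) (phi n))).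
    rewrite itg_sum//; apply: eq_bigr => n _.
    by rewrite itgZ// expr2.
  rewrite {1}E /I -itgZ//.
  apply: le_itg; [exact: intg_sum|exact: intgZ|] => t _.
  have -> : \sum_(0 <= n < N) e n * (c n t * ip (F t) (phi n)) =
      ip (psum phi (fun n => e n * c n t) N) (F t).
    by rewrite ip_psum; apply: eq_bigr => n _; rewrite mulrA.
  apply: (le_trans (ler_norm _)); apply: (le_trans (cauchy_schwarz hH _ _)).
  rewrite ler_wpM2r// -(@ler_pXn2r _ 2) ?nnegrE ?sqrtr_ge0// sqr_sqrtr//.
  rewrite (norm_psum hH hphi) /S; apply: ler_sum => n _.
  rewrite exprMn ler_piMr ?sqr_ge0// -(real_normK (num_real (c n t))).
  by rewrite expr_le1.
have [->|s0] := eqVneq S 0; first by rewrite sqr_ge0.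
have sS : 0 < Num.sqrt S by rewrite sqrtr_gt0 lt_def s0.
rewrite -(sqr_sqrtr S0) ler_pXn2r ?nnegrE ?sqrtr_ge0//.
by rewrite -(ler_pM2l sS) -expr2 sqr_sqrtr.
Qed.

Context (lam : nat -> R) (hlam : forall n, 0 < lam n).

Lemma cw_ip (A : set R) (u : R -> H) y : {within A, continuous u} ->
  {within A, continuous (fun t => ip (u t) y)}.
Proof. by move=> cu x; apply: (cvg_ip hH); exact: cu. Qed.

Lemma is_derive_within T (g : R -> R) l x : x \in `]0, T[ ->
  (s - x)^-1 * (g s - g x) @[s --> within `[0, T] (x^')] --> l ->
  is_derive x (1 : R) g l.
Proof.
move=> xT /cvgrPdist_lt c.
have {}c : h^-1 *: ((g \o shift x) (h *: (1 : R)) - g x) @[h --> (0 : R)^'] --> l.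
  apply/cvgrPdist_lt => e e0; have := c _ e0.
  rewrite !near_withinE => -[d /= d0 hd].
  move: xT; rewrite in_itv/= => /andP[x0 xT].
  have m0 : 0 < Num.min d (Num.min x (T - x)) by rewrite !lt_min d0 x0 subr_gt0.
  exists (Num.min d (Num.min x (T - x))) => //= h.
  rewrite /= sub0r normrN !lt_min => /and3P[h1 h2 h3] hn0.
  rewrite -[h%:A]/(h * 1) mulr1.
  have := hd (h + x); rewrite /= opprD addrA addrK; apply.
  - by rewrite addrAC subrr sub0r normrN.
  - by apply: contra_neq hn0 => E; apply: (addIr x); rewrite add0r.
  - move: h2 h3; rewrite !ltr_norml !in_itv/= => /andP[? ?] /andP[? ?].
    by apply/andP; split; lra.
by apply: DeriveDef; [exact: cvgP c|exact: cvg_lim c].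
Qed.

(** Each phi_n lies in X_{1/2} and may be used as a test vector: the wave equation turns into the
    oscillator w_n'' + lam_n^2 w_n = f_n, in integrated form. *)
Lemma wsol_modes T f w0 w1 w wt n : wsol ip phi lam T f w0 w1 w wt ->
  intg 0 T (fun s => ip (f s) (phi n)) ->
  [/\ {within `[0, T], continuous (fun t => ip (w t) (phi n))},
    {within `[0, T], continuous (fun t => ip (wt t) (phi n))},
    (forall x, x \in `]0, T[ ->
      is_derive x (1 : R) (fun t => ip (w t) (phi n)) (ip (wt x) (phi n))) &
    forall b, b \in `[0, T] -> ip (wt b) (phi n) = ip w1 (phi n) +
      itg 0 b (fun s => ip (f s) (phi n) - lam n ^+ 2 * ip (w s) (phi n))].
Proof.
move=> [h0 hX hL hv [hd hw]] hf; split.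
- apply: (@subspace_eq_continuous _ _ _
    (fun t => (lam n)^-1 * ip (Lop ip phi lam (w t)) (phi n))).
    move=> t; rewrite inE/= => tT.
    by rewrite (co_Lop hH hphi _ (hX _ tT)) mulKf// gt_eqF.
  by apply: cwM; [exact/cont_within/cst_continuous|exact: (cw_ip (y := phi n) hL)].
- exact: (cw_ip (y := phi n) hv).
- move=> x xT; apply: (is_derive_within xT).
  under eq_fun do rewrite -ipBl -ipZl.
  by apply: (cvg_ip hH); apply: hd; exact: itv_oo_cc.
- move=> b bT; rewrite (hw _ _ (X12_phi hH hphi lam n) bT); congr (_ + _).
  apply: eq_itg => s sb; rewrite (Lop_phi hH hphi) ipZr (co_Lop hH hphi).
    by rewrite mulrA -expr2.
  apply: hX; move: sb bT; rewrite !in_itv/= => /andP[-> h1] /andP[_ h2].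
  exact: le_trans h2.
Qed.

(** [duhamel] with the kernels sin (lam n * (b - s)) and cos (lam n * (b - s)). At s = b the first
    one retains only the displacement and the second one only the velocity. The constant 1 + lam n
    bounds both kernels and their derivatives. *)
Lemma wsol_duhamel T f w0 w1 w wt n a b : 0 <= a -> a <= b -> b <= T ->
  wsol ip phi lam T f w0 w1 w wt -> intg 0 T (fun s => ip (f s) (phi n)) ->
  lam n * ip (w b) (phi n) = lam n * cos (lam n * (b - a)) * ip (w a) (phi n) +
    sin (lam n * (b - a)) * ip (wt a) (phi n) +
    itg a b (fun s => sin (lam n * (b - s)) * ip (f s) (phi n)) /\
  ip (wt b) (phi n) = cos (lam n * (b - a)) * ip (wt a) (phi n) -
    lam n * sin (lam n * (b - a)) * ip (w a) (phi n) +
    itg a b (fun s => cos (lam n * (b - s)) * ip (f s) (phi n)).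
Proof.
move=> a0 ab bT sol hf; have [cw cv dw hv] := wsol_modes sol hf.
have sub : `[a, b] `<=` `[0, T].
  move=> x /=; rewrite !in_itv/= => /andP[h1 h2].
  by rewrite (le_trans a0 h1) (le_trans h2).
have cw' := continuous_subspaceW sub cw; have cv' := continuous_subspaceW sub cv.
have dw' x : x \in `]a, b[ ->
    is_derive x (1 : R) (fun t => ip (w t) (phi n)) (ip (wt x) (phi n)).
  rewrite in_itv/= => /andP[h1 h2]; apply: dw.
  by rewrite in_itv/= (le_lt_trans a0 h1) (lt_le_trans h2).
have hf' := intgS a0 bT hf; have iw := intg_cont cw.
have hv' t : t \in `[a, b] -> ip (wt t) (phi n) = ip (wt a) (phi n) +
    itg a t (fun s => ip (f s) (phi n) - lam n ^+ 2 * ip (w s) (phi n)).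
  move=> tab; have aT : a \in `[0, T] by apply: sub; rewrite /= in_itv/= lexx.
  rewrite (hv _ (sub _ tab)) (hv _ aT) -addrA; congr (_ + _).
  move: tab (sub _ tab); rewrite /= !in_itv/= => /andP[h1 h2] /andP[h3 h4].
  apply: itg_split => //.
  by apply: intgS h4 _ => //; apply: intgB => //; exact: intgZ.
have l0 := ltW (hlam n).
pose arg (s : R) := lam n * (b - s).
have darg x : is_derive x (1 : R) arg (- lam n).
  by rewrite /arg; apply: is_derive_eq; rewrite /GRing.scale/=; ring.
have dsin x : is_derive x (1 : R) (fun s => sin (arg s)) (- lam n * cos (arg x)).
  by apply: is_derive_eq; rewrite /GRing.scale/=; ring.
have dcos x : is_derive x (1 : R) (fun s => cos (arg s)) (lam n * sin (arg x)).
  by apply: is_derive_eq; rewrite /GRing.scale/=; ring.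
have dsin' x : is_derive x (1 : R) (fun s => lam n * sin (arg s))
    (- lam n ^+ 2 * cos (arg x)).
  by have h := dsin x; apply: is_derive_eq; rewrite /GRing.scale/=; ring.
have dcos' x : is_derive x (1 : R) (fun s => - lam n * cos (arg s))
    (- lam n ^+ 2 * sin (arg x)).
  by have h := dcos x; apply: is_derive_eq; rewrite /GRing.scale/=; ring.
have s1 (x : R) : `|sin x| <= 1 by rewrite ler_norml sin_geN1 sin_le1.
have c1 (x : R) : `|cos x| <= 1 by rewrite ler_norml cos_geN1 cos_le1.
have k1 (x : R) : `|x| <= 1 -> `|x| <= 1 + lam n by move=> h; rewrite (le_trans h)// lerDl.
have kl (x y : R) : `|x| <= 1 -> `|y| = lam n -> `|y * x| <= 1 + lam n.
  move=> h1 h2; rewrite normrM h2 (le_trans (ler_wpM2l l0 h1))// mulr1.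
  by rewrite lerDr.
have pl : `|lam n| = lam n by rewrite gtr0_norm.
have nl : `|- lam n| = lam n by rewrite normrN.
have argb : arg b = 0 by rewrite /arg subrr mulr0.
split.
- have := duhamel ab cw' cv' dw' hf' hv' dsin dcos' (K := 1 + lam n).
  move=> /(_ (fun x => k1 _ (s1 _)) (fun x => kl _ _ (c1 _) nl)).
  rewrite argb sin0 cos0.
  rewrite /arg mul0r sub0r mulr1 mulNr opprK => ->; ring.
- have := duhamel ab cw' cv' dw' hf' hv' dcos dsin' (K := 1 + lam n).
  move=> /(_ (fun x => k1 _ (c1 _)) (fun x => kl _ _ (s1 _) pl)).
  rewrite argb sin0 cos0.
  by rewrite /arg mulr0 mul0r subr0 mul1r => ->.
Qed.

End SquareIntegrable.

(** * The scalar oscillator driven by a pulse *)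

Section Scalar.
Context (R : realType).

Lemma is_derive_dnbhsP (g : R -> R) l x : is_derive x (1 : R) g l <->
  (s - x)^-1 * (g s - g x) @[s --> x^'] --> l.
Proof.
split=> [dg|/cvgrPdist_lt c].
  have : h^-1 *: ((g \o shift x) (h *: (1 : R)) - g x) @[h --> (0 : R)^'] --> l.
    by have [h1 <-] := dg; exact: h1.
  move=> /cvgrPdist_lt c; apply/cvgrPdist_lt => e /c.
  rewrite !near_withinE => -[d /= d0 hd].
  exists d => //= s sd sx; have := hd (s - x).
  rewrite /= sub0r normrN distrC subr_eq0 => /(_ sd sx).
  by rewrite -[(s - x)%:A]/((s - x) * 1) mulr1 subrK.
have {}c : h^-1 *: ((g \o shift x) (h *: (1 : R)) - g x) @[h --> (0 : R)^'] --> l.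
  apply/cvgrPdist_lt => e /c.
  rewrite !near_withinE => -[d /= d0 hd]; exists d => //= h hd' h0.
  have := hd (h + x); rewrite /= opprD addrCA subrr addr0.
  rewrite -[h%:A]/(h * 1) mulr1 addrK; apply.
    by rewrite /= sub0r in hd'.
  by apply: contra_neq h0 => E; apply: (addIr x); rewrite add0r.
by apply: DeriveDef; [exact: cvgP c|exact: cvg_lim c].
Qed.

Lemma cont_comp (f g : R -> R) : continuous f -> continuous g ->
  continuous (fun x => g (f x)).
Proof. by move=> cf cg x; exact: (@continuous_comp _ _ _ f g x (cf x) (cg _)). Qed.

Lemma is_derive_continuous (f f' : R -> R) :
  (forall x, is_derive x (1 : R) f (f' x)) -> continuous f.
Proof.
move=> df x; apply/differentiable_continuous/derivable1_diffP.
by have [] := df x.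
Qed.

Lemma lipschitz_derive (g g' : R -> R) K s t :
  (forall x, is_derive x (1 : R) g (g' x)) -> (forall x, `|g' x| <= K) ->
  `|g s - g t| <= K * `|s - t|.
Proof.
move=> dg gK; wlog ts : s t / t <= s.
  move=> W; have [/W//|/ltW/W] := leP t s.
  by rewrite distrC (distrC t).
have cg : {within `[t, s], continuous g}.
  apply: continuous_subspaceT.
  exact: is_derive_continuous dg.
have [c _ ->] := MVT_segment ts (fun x _ => dg x) cg.
by rewrite normrM ler_wpM2r.
Qed.

(* Up to factors of l, the response at rest of a mode of frequency l to a unit
   force switched on at time 0, and its velocity. *)
Definition rampc (l t : R) := 1 - cos (l * Num.max t 0).
Definition ramps (l t : R) := sin (l * Num.max t 0).

Lemma max_continuous : continuous (fun t : R => Num.max t 0).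
Proof. by move=> t; apply: continuous_max; [exact: cvg_id|exact: cvg_cst]. Qed.

Lemma ramps_continuous l : continuous (ramps l).
Proof.
apply: (cont_comp (f := fun t => l * Num.max t 0)); last exact: continuous_sin.
by move=> t; apply: cvgM; [exact: cvg_cst|exact: max_continuous].
Qed.

Lemma is_derive_1cos l t : is_derive t (1 : R) (fun s => 1 - cos (l * s)) (l * sin (l * t)).
Proof. by apply: is_derive_eq; rewrite /GRing.scale/=; ring. Qed.

(** The force jumps at time 0 but the displacement stays differentiable: its difference quotient at
    0 is dominated by that of 1 - cos (l s), whose derivative vanishes there. *)
Lemma is_derive_rampc l t : is_derive t (1 : R) (rampc l) (l * ramps l t).
Proof.
have [t0|t0|->] := ltgtP t 0.
- rewrite /ramps (max_r (ltW t0)) mulr0 sin0 mulr0.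
  apply: (near_eq_is_derive (f := cst 0)).
  near=> s; rewrite /rampc max_r ?mulr0 ?cos0 ?subrr//.
  by apply/ltW; near: s; exact: lt_nbhsl.
- rewrite /ramps (max_l (ltW t0)).
  apply: near_eq_is_derive (is_derive_1cos l t).
  near=> s; rewrite /rampc max_l//.
  by apply/ltW; near: s; exact: lt_nbhsr.
- rewrite /ramps maxxx mulr0 sin0 mulr0; apply/is_derive_dnbhsP.
  have /is_derive_dnbhsP := is_derive_1cos l 0.
  rewrite mulr0 sin0 mulr0 cos0 => /cvgr0_norm_lt c.
  apply/cvgr0Pnorm_lt => e e0; have := c _ e0; apply: filterS => s.
  apply: le_lt_trans; rewrite !normrM ler_wpM2l//.
  rewrite /rampc maxxx mulr0 cos0 !subrr !subr0.
  by have [s0|s0] := leP s 0; rewrite // mulr0 cos0 subrr normr0.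
Unshelve. all: by end_near. Qed.

Lemma ramps_le1 l t : `|ramps l t| <= 1.
Proof. by rewrite ler_norml sin_geN1 sin_le1. Qed.

Lemma rampc_le2 l t : `|rampc l t| <= 2.
Proof.
rewrite /rampc (le_trans (ler_normB _ _))// normr1 (_ : 2 = 1 + 1)// lerD2l.
by rewrite ler_norml cos_geN1 cos_le1.
Qed.

(** The left endpoint is negligible. This matters because a pulse keeps, at its switching time, the
    value it has before. *)
Lemma eq_itg_oc a b (f g : R -> R) : {in `]a, b], f =1 g} -> intg a b f ->
  intg a b g -> itg a b f = itg a b g.
Proof.
move=> fg hf hg; have sub : `]a, b]%classic `<=` `[a, b]%classic.
  by move=> x /=; rewrite !in_itv/= => /andP[/ltW -> ->].
rewrite /itg -!Rintegral_itv_obnd_cbnd; [|exact: integrableS hg|exact: integrableS hf].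
by apply: eq_Rintegral => x; rewrite inE/=; exact: fg.
Qed.

Lemma intg_step a b tau (c d : R) : intg a b (fun s => if s <= tau then c else d).
Proof.
apply: (@intg_dom _ _ _ _ (fun=> `|c| + `|d|)).
- apply: measurable_funTS; apply: measurable_fun_ifT => //.
  by apply: measurable_fun_ler.
- exact: intg_cst.
- by move=> x _; case: ifP => _; rewrite ?lerDl ?lerDr.
Qed.

(** The once integrated equation of an oscillator at rest under a unit force on [0, tau]: the
    difference of [rampc] is l^2 times the displacement, and the right-hand side is the velocity.
    The integrand is cos (l s) up to [tau], and a difference of two cosines afterwards. *)
Lemma itg_ramp l tau t : 0 < l -> 0 <= tau -> 0 <= t ->
  itg 0 t (fun s => (if s <= tau then 1 else 0) - (rampc l s - rampc l (s - tau))) =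
  (ramps l t - ramps l (t - tau)) / l.
Proof.
move=> l0 tau0 t0.
have l1 : l != 0 by rewrite gt_eqF.
have crampc : continuous (rampc l).
  exact: is_derive_continuous (is_derive_rampc l).
have crampc' : continuous (fun s => rampc l (s - tau)).
  apply: (cont_comp (f := fun s => s - tau)) => // x.
  by apply: cvgB; [exact: cvg_id|exact: cvg_cst].
have ii a b : intg a b (fun s => (if s <= tau then 1 else 0) -
    (rampc l s - rampc l (s - tau))).
  apply: intgB; first exact: intg_step.
  by apply: intgB; apply: intg_cont; exact: continuous_subspaceT.
have dsin x : is_derive x (1 : R) (fun s => sin (l * s) / l) (cos (l * x)).
  by apply: is_derive_eq; rewrite /GRing.scale/=; field.
have ccos : continuous (fun s => cos (l * s)).
  apply: (cont_comp (f := fun s => l * s)); last exact: continuous_cos.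
  by move=> x; apply: cvgM; [exact: cvg_cst|exact: cvg_id].
have csin : continuous (fun s => sin (l * s) / l).
  exact: is_derive_continuous dsin.
have H1 u : 0 <= u -> u <= tau -> itg 0 u (fun s => (if s <= tau then 1 else 0) -
    (rampc l s - rampc l (s - tau))) = sin (l * u) / l.
  move=> u0 ut; rewrite (@eq_itg _ _ _ _ (fun s => cos (l * s))); last first.
    move=> s; rewrite in_itv/= => /andP[s0 su]; rewrite (le_trans su ut).
    rewrite /rampc max_l// max_r ?mulr0 ?cos0; first by ring.
    by rewrite subr_le0 (le_trans su).
  rewrite (@ftc2 _ _ _ (fun s => sin (l * s) / l) _ u0) ?mulr0 ?sin0 ?mul0r ?subr0//.
    exact: continuous_subspaceT.
  exact: continuous_subspaceT.
have [tt|/ltW tt] := leP t tau.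
  rewrite H1// /ramps max_l// max_r ?mulr0 ?sin0 ?subr0//.
  by rewrite subr_le0.
rewrite (itg_split tau0 tt)// H1//.
pose G s := (sin (l * s) - sin (l * (s - tau))) / l.
pose g s := cos (l * s) - cos (l * (s - tau)).
have dG x : is_derive x (1 : R) G (g x).
  by rewrite /G; apply: is_derive_eq; rewrite /GRing.scale/= /g; field.
have cg : continuous g.
  move=> x; apply: cvgB; first exact: ccos.
  apply: (cont_comp (f := fun s => s - tau) (g := fun s => cos (l * s))) => // y.
  by apply: cvgB; [exact: cvg_id|exact: cvg_cst].
have cG : continuous G.
  exact: is_derive_continuous dG.
rewrite (@eq_itg_oc _ _ _ g _ (ii _ _)); last first.
- by apply: intg_cont; exact: continuous_subspaceT.
- move=> s; rewrite in_itv/= => /andP[s1 s2]; rewrite leNgt s1/=.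
  rewrite /rampc !max_l ?subr_ge0 ?(ltW s1)// ?(le_trans tau0 (ltW s1))//.
  by rewrite /g; ring.
rewrite (@ftc2 _ _ _ G g tt)//; [|exact: continuous_subspaceT..].
rewrite /G subrr mulr0 sin0 subr0 /ramps !max_l// ?subr_ge0//.
by field.
Qed.

End Scalar.

(** * Construction of solutions of the wave equation from their modes *)

Section Solutions.
Context (R : realType) (H : completeNormedModType R) (ip : {dot H for idfun}).
Hypothesis hH : induces_norm ip.
Context (phi : nat -> H) (hphi : orthonormal_basis ip phi).
Context (lam : nat -> R) (lam0 : R).
Hypotheses (hlam0 : 0 < lam0) (hlam : forall n, lam0 <= lam n).

Local Notation synth := (synth phi).
Local Notation Lop := (Lop ip phi lam).
Local Notation X12 := (X12 ip phi lam).
Local Notation wsol := (wsol ip phi lam).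

Lemma lam_gt0 n : 0 < lam n. Proof. exact: lt_le_trans (hlam n). Qed.

Lemma sqs_divlam a : sqs (fun n => lam n * a n) -> sqs a.
Proof.
move=> s; apply: (sqs_bound s (k := lam0^-1)) => n.
rewrite normrM mulrA gtr0_norm ?lam_gt0// ler_peMl//.
by rewrite -(ler_pM2l hlam0) mulrA mulfV ?gt_eqF// mul1r mulr1.
Qed.

Lemma synth_lin k a b : sqs a -> sqs b ->
  synth (fun n => k * (a n - b n)) = k *: (synth a - synth b).
Proof.
move=> sa sb; apply: (co_inj hH hphi) => n.
have sab : sqs (fun n => k * (a n - b n)).
  have sN : sqs (fun n => - b n).
    by apply: (sqs_bound sb (k := 1)) => i; rewrite normrN mul1r.
  by apply: (sqs_bound (sqsD sa sN) (k := `|k|)) => i; rewrite normrM.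
by rewrite ipZl ipBl !(co_synth hH hphi).
Qed.

Lemma X12_synth a : sqs (fun n => lam n * a n) -> X12 (synth a).
Proof.
move=> s; rewrite (_ : X12 _ = sqs (fun n => lam n * a n))//.
congr (sqs _); apply/funext => n.
by rewrite (co_synth hH hphi _ (sqs_divlam s)).
Qed.

Lemma Lop_synth a : sqs (fun n => lam n * a n) ->
  Lop (synth a) = synth (fun n => lam n * a n).
Proof.
move=> s; congr (synth _); apply/funext => n.
by rewrite (co_synth hH hphi _ (sqs_divlam s)).
Qed.

Lemma X12_psum a N : X12 (psum phi a N).
Proof.
rewrite /psum; apply: big_ind; [exact: X12_0|by move=> x y; exact: X12D|].
by move=> n _; apply/X12Z/(X12_phi hH hphi).
Qed.

Lemma Lop_psum a N : Lop (psum phi a N) = psum phi (fun n => lam n * a n) N.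
Proof.
apply: (co_inj hH hphi) => n; rewrite (co_Lop hH hphi); last exact: X12_psum.
by rewrite !(co_psum hphi); case: ifP; rewrite ?mulr0.
Qed.

Lemma cvg_Lop_psum psi : X12 psi ->
  Lop (psum phi (fun n => ip psi (phi n)) N) @[N --> \oo] --> Lop psi.
Proof.
move=> psiX; under eq_fun do rewrite Lop_psum.
by apply: (cvg_synth hH hphi); exact: psiX.
Qed.

Lemma continuous_synth (g : R -> nat -> R) M : sqs M ->
  (forall t n, `|g t n| <= M n) -> (forall n, continuous (g ^~ n)) ->
  continuous (fun t => synth (g t)).
Proof.
move=> sM gM cg t.
apply: (@cvg_synth_dom _ _ _ hH _ hphi _ (nbhs t) _ g (g t) M sM).
  by apply: nearW => s n; exact: gM.
by move=> n; exact: cg.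
Qed.

(** The bound [M], uniform in time, dominates the modes, their velocities and, by the mean value
    theorem, their difference quotients, so that [cvg_synth_dom] gives all the required limits in H.
    The equation holds against each phi_n by assumption, then against finite combinations, then
    against psi in X_{1/2}, approximated by its partial sums in H and in energy. *)
Lemma wsol_construct T f (q q' : R -> nat -> R) M K : 0 <= T -> sqs M ->
  (forall t n, `|lam n * q t n| <= M n) -> (forall t n, `|q' t n| <= M n) ->
  (forall n t, is_derive t (1 : R) (q ^~ n) (q' t n)) ->
  (forall n, continuous (q' ^~ n)) ->
  (forall psi, intg 0 T (fun s => ip (f s) psi)) -> (forall s, `|f s| <= K) ->
  (forall n t, 0 <= t -> t <= T -> q' t n = q' 0 n +
    itg 0 t (fun s => ip (f s) (phi n) - lam n ^+ 2 * q s n)) ->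
  wsol T f (synth (q 0)) (synth (q' 0)) (fun t => synth (q t)) (fun t => synth (q' t)).
Proof.
move=> T0 sM qM q'M dq cq' fi fK hq.
have absM n : `|M n| = M n by rewrite ger0_norm// (le_trans _ (q'M 0 n)).
have sq t : sqs (fun n => lam n * q t n).
  by apply: (sqs_bound sM (k := 1)) => n; rewrite mul1r absM.
have sq' t : sqs (q' t).
  by apply: (sqs_bound sM (k := 1)) => n; rewrite mul1r absM.
have sq0 t := sqs_divlam (sq t).
have cq n : continuous (q ^~ n) by exact: is_derive_continuous (dq n).
pose W t := synth (fun n => lam n * q t n).
have LW t : Lop (synth (q t)) = W t by exact: Lop_synth.
have cW : continuous W.
  apply: (continuous_synth sM qM) => n t.
  by apply: cvgM; [exact: cvg_cst|exact: cq].
have cq2 : continuous (fun t => synth (q' t)).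
  exact: (continuous_synth sM q'M).
have [KW hKW] := sM.
(* Only the square is bounded by [KW]; then x <= 1 + x^2. *)
have WK t : `|W t| <= 1 + KW.
  have : `|W t| ^+ 2 <= KW.
    apply: (norm_synth_le hH hphi) => N; apply: le_trans (hKW N).
    apply: ler_sum => n _; rewrite -(real_normK (num_real (_ * _))).
    by rewrite lerXn2r ?nnegrE// (le_trans _ (q'M 0 n)).
  by have := sqr_ge0 (`|W t| - 1); have := normr_ge0 (W t); nra.
split => //.
- by move=> t _; exact: X12_synth.
- apply: continuous_subspaceT; rewrite (_ : _ \o _ = W)//.
  by apply/funext => t; exact: LW.
- exact: continuous_subspaceT.
split.
  move=> t _; apply: cvg_within_filter.
  under eq_fun do rewrite -synth_lin//.
  apply: (@cvg_synth_dom _ _ _ hH _ hphi _ (t^') _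
    (fun s n => (s - t)^-1 * (q s n - q t n)) (q' t) M sM).
    rewrite near_withinE; near=> s => st n.
    rewrite normrM normfV mulrC ler_pdivrMr ?normr_gt0 ?subr_eq0//.
    exact: lipschitz_derive.
  by move=> n; apply/is_derive_dnbhsP; exact: dq.
move=> psi t psiX; rewrite in_itv/= => /andP[t0 tT].
pose psiN N := psum phi (fun n => ip psi (phi n)) N.
have fi' x : intg 0 t (fun s => ip (f s) x) by apply: intgS (fi x).
have Wi x : intg 0 t (fun s => ip (W s) x).
  by apply: intg_cont; apply: (cw_ip hH); exact: continuous_subspaceT.
have qi n : intg 0 t (fun s => lam n ^+ 2 * q s n).
  by apply: intgZ; apply: intg_cont; exact: continuous_subspaceT.
have cN : psiN N @[N --> \oo] --> psi by exact: cvg_psum_co.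
have cL : Lop (psiN N) @[N --> \oo] --> Lop psi by exact: cvg_Lop_psum.
pose RHS x y := itg 0 t (fun s => ip (f s) x - ip (W s) y).
rewrite [X in _ = _ + X](_ : _ = RHS psi (Lop psi)); last first.
  by apply: eq_itg => s _; rewrite LW.
have eN N : ip (synth (q' t)) (psiN N) =
    ip (synth (q' 0)) (psiN N) + RHS (psiN N) (Lop (psiN N)).
  rewrite !(ipC ip _ (psiN N)) !ip_psum.
  have -> : RHS (psiN N) (Lop (psiN N)) = itg 0 t (fun s => \sum_(0 <= n < N)
      ip psi (phi n) * (ip (f s) (phi n) - lam n ^+ 2 * q s n)).
    apply: eq_itg => s _; rewrite Lop_psum !(ipC ip _ (psum _ _ _)) !ip_psum -sumrB.
    apply: eq_bigr => n _; rewrite (co_synth hH hphi _ (sq s)).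
    by ring.
  rewrite itg_sum//; last by move=> n; apply: intgZ; exact: intgB.
  rewrite -big_split/=; apply: eq_bigr => n _.
  rewrite !(co_synth hH hphi) // itgZ; last exact: intgB.
  by rewrite -mulrDr -hq.
have c1 x : ip x (psiN N) @[N --> \oo] --> ip x psi.
  by rewrite (ipC ip x); under eq_fun do rewrite (ipC ip x); apply: (cvg_ip hH); exact: cN.
have cR : RHS (psiN N) (Lop (psiN N)) @[N --> \oo] --> RHS psi (Lop psi).
  apply/cvgrPdist_le => e e0.
  have K0 : 0 <= K by apply: le_trans (fK 0).
  have KW0 : 0 <= 1 + KW by apply: le_trans (WK 0).
  (* If psi and Lop psi move by at most d, the integrand moves by at most d * (K + (1 + KW)),
     uniformly in time; the added 1 keeps the denominator positive. *)
  pose d := e / (T * (K + (1 + KW)) + 1).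
  have D0 : 0 < T * (K + (1 + KW)) + 1 by rewrite ltr_wpDl// mulr_ge0// addr_ge0.
  have d0 : 0 < d by rewrite divr_gt0.
  move/cvgrPdist_le : cN => /(_ _ d0); move/cvgrPdist_le : cL => /(_ _ d0).
  apply: filterS2 => N h1 h2; rewrite /RHS -itgB; [|exact: intgB|exact: intgB].
  apply: (le_trans (norm_itg _)); first by apply: intgB; exact: intgB.
  apply: (@le_trans _ _ (itg 0 t (cst (d * (K + (1 + KW)))))).
    apply: le_itg; [by apply/intg_norm/intgB; exact: intgB|exact: intg_cst|].
    move=> s _.
    have -> : ip (f s) psi - ip (W s) (Lop psi) -
        (ip (f s) (psiN N) - ip (W s) (Lop (psiN N))) =
        ip (f s) (psi - psiN N) - ip (W s) (Lop psi - Lop (psiN N)).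
      by rewrite !ipBr; ring.
    rewrite mulrDr; apply: (le_trans (ler_normB _ _)); apply: lerD.
      by apply: (le_trans (cauchy_schwarz hH _ _)); rewrite mulrC ler_pM//.
    by apply: (le_trans (cauchy_schwarz hH _ _)); rewrite mulrC ler_pM//.
  rewrite itg_cst// subr0.
  apply: (@le_trans _ _ (d * (K + (1 + KW)) * T)).
    by rewrite ler_wpM2l//; apply: mulr_ge0; [exact: ltW|exact: addr_ge0].
  have -> : d * (K + (1 + KW)) * T = e / (T * (K + (1 + KW)) + 1) * (T * (K + (1 + KW))).
    by rewrite /d; ring.
  by rewrite mulrAC ler_pdivrMr// ler_wpM2l ?(ltW e0)// lerDl.
have c2 : ip (synth (q' t)) (psiN N) @[N --> \oo] -->
    ip (synth (q' 0)) psi + RHS psi (Lop psi).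
  by under eq_fun do rewrite eN; apply: cvgD.
exact: (cvg_unique _ (c1 _) c2).
Unshelve. all: by end_near. Qed.

Lemma wsol_add T f g w0 w1 w wt v0 v1 v vt :
  (forall psi, intg 0 T (fun s => ip (f s) psi)) ->
  (forall psi, intg 0 T (fun s => ip (g s) psi)) ->
  wsol T f w0 w1 w wt -> wsol T g v0 v1 v vt ->
  wsol T (fun t => f t + g t) (w0 + v0) (w1 + v1) (fun t => w t + v t)
    (fun t => wt t + vt t).
Proof.
move=> hf hg [[a1 a2] a3 a4 a5 [a6 a7]] [[b1 b2] b3 b4 b5 [b6 b7]]; split.
- by rewrite a1 a2 b1 b2.
- by move=> t tT; apply: X12D; [exact: a3|exact: b3].
- apply: (@subspace_eq_continuous _ _ _ (fun t => Lop (w t) + Lop (v t))).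
    move=> t; rewrite inE/= => tT; rewrite -[RHS]/(Lop (w t + v t)).
    by rewrite (LopD hH hphi)//; [exact: a3|exact: b3].
  by move=> t; apply: cvgD; [exact: a4|exact: b4].
- by move=> t; apply: cvgD; [exact: a5|exact: b5].
split=> [t tT|psi t psiX tT].
  under eq_fun do rewrite opprD addrACA scalerDr.
  by apply: cvgD; [exact: a6|exact: b6].
rewrite ipDl a7// b7// addrACA -ipDl; congr (_ + _).
have sub s : s \in `[0, t] -> s \in `[0, T].
  move: tT; rewrite !in_itv/= => /andP[_ h] /andP[-> h']; exact: le_trans h.
have subT : `[0, t]%classic `<=` `[0, T]%classic by move=> s; exact: sub.
have tT' : t <= T by move: tT; rewrite in_itv/= => /andP[].
have i1 : intg 0 t (fun s => ip (f s) psi - ip (Lop (w s)) (Lop psi)).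
  apply: intgB; first exact: intgS (hf psi).
  by apply: intg_cont; apply: (cw_ip hH (u := Lop \o w)); exact: continuous_subspaceW a4.
have i2 : intg 0 t (fun s => ip (g s) psi - ip (Lop (v s)) (Lop psi)).
  apply: intgB; first exact: intgS (hg psi).
  by apply: intg_cont; apply: (cw_ip hH (u := Lop \o v)); exact: continuous_subspaceW b4.
rewrite -[RHS]/(itg 0 t _) -[LHS]/(itg 0 t _ + itg 0 t _) -itgD//.
apply: eq_itg => s /sub sT.
by rewrite (LopD hH hphi); [rewrite !ipDl; ring|exact: a3|exact: b3].
Qed.

(** Parseval's identity, with one factor lam n moved from psi to x. It turns the equation A x = g,
    known on coordinates, into its weak form in X_{-1/2}. *)
Lemma Lop_weak x g psi : X12 x -> (forall n, lam n ^+ 2 * ip x (phi n) = ip g (phi n)) ->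
  X12 psi -> ip (Lop x) (Lop psi) = ip g psi.
Proof.
move=> xX xg psiX.
have c1 := @cvg_parseval _ _ _ hH _ hphi (Lop x) (Lop psi).
have E N : \sum_(0 <= n < N) ip (Lop x) (phi n) * ip (Lop psi) (phi n) =
    \sum_(0 <= n < N) ip g (phi n) * ip psi (phi n).
  by apply: eq_bigr => n _; rewrite !(co_Lop hH hphi)// -xg; ring.
have c2 : \sum_(0 <= n < N) ip (Lop x) (phi n) * ip (Lop psi) (phi n)
    @[N --> \oo] --> ip g psi.
  by under eq_fun do rewrite E; exact: (@cvg_parseval _ _ _ hH _ hphi g psi).
exact: (cvg_unique _ c1 c2).
Qed.

Lemma wsol_const T x g : X12 x ->
  (forall n, lam n ^+ 2 * ip x (phi n) = ip g (phi n)) ->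
  wsol T (fun=> g) x 0 (fun=> x) (fun=> 0).
Proof.
move=> xX xg; split => //.
- by move=> t; exact: cvg_cst.
- by move=> t; exact: cvg_cst.
split=> [t _|psi t psiX _].
  by under eq_fun do rewrite subrr scaler0; exact: cvg_cst.
rewrite ip0l add0r (Lop_weak xX xg psiX) subrr.
by rewrite Rintegral_cst// mul0r.
Qed.

(* Modes of the free solution with w(0)_n = a n / lam n and w_t(0)_n = b n. *)
Definition freeq (a b : nat -> R) (t : R) n :=
  (a n * cos (lam n * t) + b n * sin (lam n * t)) / lam n.

Definition freeq' (a b : nat -> R) (t : R) n :=
  b n * cos (lam n * t) - a n * sin (lam n * t).

Lemma wsol_free T a b : 0 <= T -> sqs a -> sqs b ->
  wsol T (fun=> 0) (synth (fun n => a n / lam n)) (synth b)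
    (fun t => synth (freeq a b t)) (fun t => synth (freeq' a b t)).
Proof.
move=> T0 sa sb.
have l0 n : lam n != 0 by rewrite gt_eqF// lam_gt0.
have sM : sqs (fun n => `|a n| + `|b n|).
  apply: sqsD.
    by apply: (sqs_bound sa (k := 1)) => n; rewrite normr_id mul1r.
  by apply: (sqs_bound sb (k := 1)) => n; rewrite normr_id mul1r.
have E0 : freeq a b 0 = (fun n => a n / lam n).
  by apply/funext => n; rewrite /freeq mulr0 cos0 sin0 mulr1 mulr0 addr0.
have E0' : freeq' a b 0 = b.
  by apply/funext => n; rewrite /freeq' mulr0 cos0 sin0 mulr1 mulr0 subr0.
have sin1 (x : R) : `|sin x| <= 1 by rewrite ler_norml sin_geN1 sin_le1.
have cos1 (x : R) : `|cos x| <= 1 by rewrite ler_norml cos_geN1 cos_le1.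
have dq n t : is_derive t (1 : R) (freeq a b ^~ n) (freeq' a b t n).
  by rewrite /freeq /freeq'; apply: is_derive_eq; rewrite /GRing.scale/=; field.
have dq' n t : is_derive t (1 : R) (freeq' a b ^~ n) (- (lam n ^+ 2 * freeq a b t n)).
  by rewrite /freeq /freeq'; apply: is_derive_eq; rewrite /GRing.scale/=; field.
rewrite -E0 -{2}E0'; apply: (@wsol_construct _ _ _ _ (fun n => `|a n| + `|b n|) 0) => //.
- move=> t n; rewrite /freeq mulrC divfK// (le_trans (ler_normD _ _))//.
  by rewrite !normrM lerD// ler_piMr.
- move=> t n; rewrite /freeq' addrC (le_trans (ler_normD _ _))// normrN.
  by rewrite !normrM lerD// ler_piMr.
- move=> n; exact: is_derive_continuous (dq' n).
- move=> psi; apply: eq_intg (intg_cst 0 T 0) => s _.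
  by rewrite ip0l.
- by move=> _; rewrite normr0.
- move=> n t t0 tT.
  rewrite (@eq_itg _ _ _ _ (fun s => - (lam n ^+ 2 * freeq a b s n))); last first.
    by move=> s _; rewrite ip0l sub0r.
  rewrite (@ftc2 _ _ _ (freeq' a b ^~ n))//; first by rewrite addrC subrK.
    apply: continuous_subspaceT; exact: is_derive_continuous (dq' n).
  apply: cwN; apply: cwM; apply: continuous_subspaceT; first exact: cst_continuous.
  exact: is_derive_continuous (dq n).
Qed.

Lemma sqs_freeq a b t : sqs a -> sqs b -> sqs (fun n => lam n * freeq a b t n).
Proof.
move=> sa sb.
have sin1 (x : R) : `|sin x| <= 1 by rewrite ler_norml sin_geN1 sin_le1.
have cos1 (x : R) : `|cos x| <= 1 by rewrite ler_norml cos_geN1 cos_le1.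
apply: (sqs_bound (b := fun n => `|a n| + `|b n|) (k := 1)).
  apply: sqsD.
    by apply: (sqs_bound sa (k := 1)) => n; rewrite normr_id mul1r.
  by apply: (sqs_bound sb (k := 1)) => n; rewrite normr_id mul1r.
move=> n; rewrite /freeq mulrC divfK ?gt_eqF ?lam_gt0// mul1r.
rewrite [leRHS]ger0_norm ?addr_ge0// (le_trans (ler_normD _ _))//.
by rewrite !normrM lerD// ler_piMr.
Qed.

(* Modes of the response at rest to the force g on [0, tau] and 0 afterwards. *)
Definition stepq (g : H) (tau t : R) n :=
  ip g (phi n) * (rampc (lam n) t - rampc (lam n) (t - tau)) / lam n ^+ 2.

Definition stepq' (g : H) (tau t : R) n :=
  ip g (phi n) * (ramps (lam n) t - ramps (lam n) (t - tau)) / lam n.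

Lemma wsol_step T tau g : 0 <= T -> 0 <= tau ->
  wsol T (fun t => if t <= tau then g else 0) 0 0
    (fun t => synth (stepq g tau t)) (fun t => synth (stepq' g tau t)).
Proof.
move=> T0 tau0.
have l0 n : lam n != 0 by rewrite gt_eqF// lam_gt0.
have synth0 : synth (fun=> 0) = 0.
  apply: (co_inj hH hphi) => n; rewrite ip0l (co_synth hH hphi)//.
  by exists 0 => N; rewrite big1// => i _; rewrite expr0n.
have E0 : synth (stepq g tau 0) = 0.
  rewrite -synth0; congr (synth _); apply/funext => n.
  by rewrite /stepq /rampc sub0r !max_r ?oppr_le0// subrr mulr0 mul0r.
have E0' : synth (stepq' g tau 0) = 0.
  rewrite -synth0; congr (synth _); apply/funext => n.
  by rewrite /stepq' /ramps sub0r !max_r ?oppr_le0// subrr mulr0 mul0r.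
have dr n t : is_derive t (1 : R) (fun t => rampc (lam n) (t - tau))
    (lam n * ramps (lam n) (t - tau)).
  have d : is_derive t (1 : R) (fun t => t - tau) 1.
    by apply: is_derive_eq; rewrite subr0.
  rewrite -[X in is_derive _ _ _ X]mulr1.
  exact: (@is_derive1_comp _ (rampc (lam n)) _ t _ _ (is_derive_rampc _ _) d).
have dq n t : is_derive t (1 : R) (stepq g tau ^~ n) (stepq' g tau t n).
  have h1 := is_derive_rampc (lam n) t; have h2 := dr n t.
  by rewrite /stepq /stepq'; apply: is_derive_eq; rewrite /GRing.scale/=; field.
have inv n : (lam n)^-1 <= lam0^-1 by rewrite lef_pV2 ?posrE ?lam_gt0.
have inv0 n : 0 <= (lam n)^-1 by rewrite invr_ge0 ltW// lam_gt0.
(* Each [rampc] is at most 2 in absolute value, hence the 4; the weight lam n cancels one of the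
   factors 1 / lam n and the other is at most 1 / lam0. *)
have := @wsol_construct T (fun t => if t <= tau then g else 0) (stepq g tau)
  (stepq' g tau) (fun n => 4 * lam0^-1 * `|ip g (phi n)|) `|g| T0.
rewrite E0 E0'; apply => //.
- apply: (sqs_bound (sqs_co hH hphi g) (k := 4 * lam0^-1)) => n.
  by rewrite normrM normr_id ger0_norm// mulr_ge0// invr_ge0 ltW.
- move=> t n.
  have -> : lam n * stepq g tau t n =
      ip g (phi n) * (rampc (lam n) t - rampc (lam n) (t - tau)) * (lam n)^-1.
    by rewrite /stepq; field.
  rewrite !normrM mulrC (ger0_norm (inv0 n)) mulrA mulrAC ler_wpM2r//.
  rewrite mulrC ler_pM// (le_trans (ler_normB _ _))//.
  have := rampc_le2 (lam n) t; have := rampc_le2 (lam n) (t - tau); lra.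
- move=> t n; rewrite /stepq' !normrM mulrC (ger0_norm (inv0 n)) mulrA mulrAC ler_wpM2r//.
  rewrite mulrC ler_pM// (le_trans (ler_normB _ _))//.
  have := ramps_le1 (lam n) t; have := ramps_le1 (lam n) (t - tau); lra.
- move=> n; apply: (cont_comp (g := fun x => x / lam n)
    (f := fun t => ip g (phi n) * (ramps (lam n) t - ramps (lam n) (t - tau)))).
    move=> t; apply: cvgM; first exact: cvg_cst.
    apply: cvgB; first exact: ramps_continuous.
    apply: (cont_comp (f := fun t => t - tau)); last exact: ramps_continuous.
    by move=> x; apply: cvgB; [exact: cvg_id|exact: cvg_cst].
  by move=> x; apply: cvgM; [exact: cvg_id|exact: cvg_cst].
- move=> psi; apply: eq_intg (intg_step 0 T tau (ip g psi) 0) => s _.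
  by case: ifP; rewrite ?ip0l.
- by move=> s; case: ifP; rewrite ?normr0.
- move=> n t t0 tT.
  have -> : stepq' g tau 0 n = 0.
    by rewrite /stepq' /ramps sub0r !max_r ?oppr_le0// subrr mulr0 mul0r.
  rewrite add0r (@eq_itg _ _ _ _ (fun s => ip g (phi n) *
    ((if s <= tau then 1 else 0) - (rampc (lam n) s - rampc (lam n) (s - tau))))).
    rewrite itgZ; first by rewrite itg_ramp ?lam_gt0// /stepq' mulrA.
    apply: intgB; first exact: intg_step.
    have c := is_derive_continuous (is_derive_rampc (lam n)).
    apply: intgB; apply: intg_cont; apply: continuous_subspaceT => //.
    exact: is_derive_continuous (dr n).
  move=> s _; rewrite /stepq; case: ifP => _; rewrite ?ip0l; field; exact: l0.
Qed.

End Solutions.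

(** * Density of the states reachable with step controls *)

Section Density.
Context (R : realType) (H : completeNormedModType R) (ip : {dot H for idfun}).
Hypothesis hH : induces_norm ip.

(** A nonnegative function of a that vanishes at 0 has no slope there. At a = - s / (k + 1) its
    value is - s^2 (k + 2) / (k + 1)^2; the shift by 1 covers k = 0. It serves for both first-order
    conditions below: the projection and the stationary optimum. *)
Lemma quadratic_ge0 (s k : R) : 0 <= k -> (forall a, 0 <= 2 * a * s + a ^+ 2 * k) ->
  s = 0.
Proof.
move=> k0 h; have k1 : 0 < k + 1 by rewrite ltr_wpDl.
have := h (- s / (k + 1)).
have -> : 2 * (- s / (k + 1)) * s + (- s / (k + 1)) ^+ 2 * k =
   - (s ^+ 2 * ((k + 2) / (k + 1) ^+ 2)) by field; rewrite gt_eqF.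
rewrite oppr_ge0 pmulr_lle0 ?divr_gt0 ?exprn_gt0 ?ltr_wpDl// => s2.
by apply/eqP; rewrite -sqrf_eq0 eq_le s2 sqr_ge0.
Qed.

(* The point of least norm in the closure of (x0, y0) + V is orthogonal to V. *)
Lemma dense_of_orth (V : set (H * H)) (x0 y0 : H) (e : R) :
  V 0 -> (forall u v, V u -> V v -> V (u + v)) -> (forall a v, V v -> V (a *: v)) ->
  (forall p q, (forall v, V v -> ip p v.1 + ip q v.2 = 0) -> p = 0 /\ q = 0) ->
  0 < e -> exists2 v, V v & `|x0 + v.1| ^+ 2 + `|y0 + v.2| ^+ 2 < e.
Proof.
move=> V0 VD VZ orth e0.
pose N (v : H * H) := `|x0 + v.1| ^+ 2 + `|y0 + v.2| ^+ 2.
have N0 v : 0 <= N v by rewrite addr_ge0 ?sqr_ge0.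
pose E := N @` V.
have hE : has_inf E.
  by split; [exists (N 0), 0|exists 0 => _ [v _ <-]].
pose d := inf E.
have dN v : V v -> d <= N v by move=> Vv; apply: ge_inf; [exact: hE.2|exists v].
have /choice[v hv] (n : nat) : exists v, V v /\ N v < d + n.+1%:R^-1.
  have r0 : 0 < n.+1%:R^-1 :> R by rewrite invr_gt0.
  have [_ [v Vv <-] h] := inf_adherent r0 hE.
  by exists v.
pose p n := x0 + (v n).1; pose q n := y0 + (v n).2.
(* Parallelogram identity. The midpoint of two terms belongs to the same affine space, so that its
   squared norm is at least [d], which makes the minimizing sequence Cauchy. *)
have par n m : `|p n - p m| ^+ 2 + `|q n - q m| ^+ 2 <= 2 * n.+1%:R^-1 + 2 * m.+1%:R^-1.
  have := dN (2^-1 *: (v n + v m)) (VZ _ _ (VD _ _ (hv n).1 (hv m).1)).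
  have [_ h1] := hv n; have [_ h2] := hv m.
  have id (z a b : H) : `|z + a - (z + b)| ^+ 2 = 2 * `|z + a| ^+ 2 + 2 * `|z + b| ^+ 2 -
      4 * `|z + 2^-1 *: (a + b)| ^+ 2.
    rewrite -!hH !(ipBl, ipBr, ipDl, ipDr, ipZl, ipZr) (ipC ip b a) (ipC ip a z) (ipC ip b z).
    by field.
  rewrite {1}/N /=; move: h1 h2; rewrite /N /p /q !id.
  by move: (n.+1%:R^-1) (m.+1%:R^-1) => rn rm h1 h2 h3; lra.
have cau (u : nat -> H) : (forall n m, `|u n - u m| ^+ 2 <= 2 * n.+1%:R^-1 + 2 * m.+1%:R^-1) ->
    cvg (u @ \oo).
  move=> hu; apply: cauchy_cvg; apply: cauchy_exP => r r0.
  have r4 : 0 < r ^+ 2 / 4 by rewrite divr_gt0 ?exprn_gt0.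
  have [k _ hk] := near_infty_natSinv_lt (PosNum r4).
  exists (u k); exists k => // n /= kn; rewrite /= -ball_normE/=.
  rewrite -(@ltr_pXn2r _ 2) ?nnegrE ?(ltW r0)//.
  apply: (le_lt_trans (hu _ _)).
  have := hk _ (leqnn k); have := hk _ kn => /=.
  by move: (n.+1%:R^-1) (k.+1%:R^-1) => rn rk h1 h2; lra.
have cp : cvg (p @ \oo).
  by apply: cau => n m; apply: le_trans (par n m); rewrite lerDl sqr_ge0.
have cq : cvg (q @ \oo).
  by apply: cau => n m; apply: le_trans (par n m); rewrite lerDr sqr_ge0.
set P := lim (p @ \oo) in cp; set Q := lim (q @ \oo) in cq.
have cN a b : `|p n + a| ^+ 2 + `|q n + b| ^+ 2 @[n --> \oo] -->
    `|P + a| ^+ 2 + `|Q + b| ^+ 2.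
  by apply: cvgD; apply: cvgM; apply: cvg_norm; apply: cvgD => //; exact: cvg_cst.
(* The limit lies only in the closure of the affine space; its minimality along the directions of
   [V] is inherited from the sequence. *)
have low w a : V w -> d <= `|P + a *: w.1| ^+ 2 + `|Q + a *: w.2| ^+ 2.
  move=> Vw; have c := cN (a *: w.1) (a *: w.2).
  rewrite -(cvg_lim _ c)//; apply: limr_ge; first exact: cvgP c.
  near=> n; have := dN (v n + a *: w) (VD _ _ (hv n).1 (VZ _ _ Vw)).
  by rewrite /N /p /q /= !addrA.
have up : `|P| ^+ 2 + `|Q| ^+ 2 <= d.
  have c := cN 0 0; rewrite !addr0 in c.
  rewrite -(cvg_lim _ c)//; apply/ler_addgt0Pr => r r0.
  apply: limr_le; first exact: cvgP c.
  near=> n; rewrite !addr0; apply/ltW; apply: (lt_trans (hv n).2); rewrite ltrD2l.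
  by near: n; exact: near_infty_natSinv_lt (PosNum r0).
have [P0 Q0] : P = 0 /\ Q = 0.
  apply: orth => w Vw; apply: (@quadratic_ge0 _ (`|w.1| ^+ 2 + `|w.2| ^+ 2)).
    by rewrite addr_ge0 ?sqr_ge0.
  move=> a; have := le_trans up (low w a Vw).
  rewrite !(norm2D hH) !ipZr -!hH !(ipZl, ipZr) => h; lra.
have c := cN 0 0; rewrite P0 Q0 !addr0 normr0 expr0n/= addr0 in c.
have [k _ hk] := (cvgr_lt 0 c) _ e0.
exists (v k); first exact: (hv k).1.
by have := hk k (leqnn k); rewrite /= !addr0.
Unshelve. all: by end_near. Qed.

Context (phi : nat -> H) (hphi : orthonormal_basis ip phi).
Context (lam : nat -> R) (lam0 : R).
Hypotheses (hlam0 : 0 < lam0) (hlam : forall n, lam0 <= lam n).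
Context (B : {linear H -> H}) (Bs : H -> H) (hBs : adjoint_of ip B Bs).
Context (T0 beta1 beta2 c : R) (hT0 : 0 < T0).
Hypothesis hobsB : forall (w0 w1 : H) (w wt : R -> H),
     wave_solution ip lam phi T0 (fun=> 0) w0 w1 w wt ->
     (normX2 ip lam phi beta1 w0 + normX2 ip lam phi beta2 w1
      <= c%:E * \int[lebesgue_measure]_(t in `[0%R, T0]) (`|Bs (wt t)| ^+ 2)%:E)%E.

Local Notation synth := (synth phi).
Local Notation Lop := (Lop ip phi lam).
Local Notation wsol := (wsol ip phi lam).

Lemma normX2_ge0 beta x : (0 <= normX2 ip lam phi beta x)%E.
Proof.
by apply: nneseries_ge0 => n _ _; rewrite lee_fin mulr_ge0 ?powR_ge0 ?sqr_ge0.
Qed.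

Lemma normX2_le0 beta x : (normX2 ip lam phi beta x <= 0)%E -> x = 0.
Proof.
move=> /normX2_leP h; apply: (co_inj hH hphi) => n; rewrite ip0l.
have := h n.+1; rewrite big_nat_recr//= => h'.
have p0 : 0 < lam n `^ (4 * beta) by rewrite powR_gt0// (lam_gt0 hlam0 hlam).
have : lam n `^ (4 * beta) * ip x (phi n) ^+ 2 <= 0.
  apply: le_trans h'; rewrite lerDr; apply: sumr_ge0 => i _.
  by rewrite mulr_ge0 ?powR_ge0 ?sqr_ge0.
rewrite pmulr_rle0// => x2; apply/eqP.
by rewrite -sqrf_eq0 eq_le x2 sqr_ge0.
Qed.

(** The difference quotients of ip (B h) (w s) vanish, hence B* w_t = 0 on [0, T0] and the
    right-hand side of the inequality on B is zero. A norm of the scale, even of negative order, is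
    definite because all its weights are positive. *)
Lemma unobservable w0 w1 w wt : wsol T0 (fun=> 0) w0 w1 w wt ->
  (forall h s, 0 <= s -> s <= T0 -> ip (B h) (w s) = ip (B h) (w T0)) ->
  w0 = 0 /\ w1 = 0.
Proof.
move=> sol hw; have [_ _ _ _ [hd _]] := sol.
have Bw h t : t \in `[0, T0] -> ip (wt t) (B h) = 0.
  move=> tT; have := cvg_ip hH (y := B h) (hd _ tT).
  move=> /(_ _)/cvgrPdist_lt cd; apply/eqP; apply/negP => /negP l0.
  have lp : 0 < `|ip (wt t) (B h)| by rewrite normr_gt0.
  have := cd _ lp; rewrite !near_withinE => -[d /= d0 hd'].
  move: (tT); rewrite in_itv/= => /andP[t0 tT0].
  (* The quotient is zero at every [s] of [0, T0] other than [t], although near [t] it is closer to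
     its limit than the size of that limit. It remains to exhibit one such [s]: to the right of [t],
     or to its left when t = T0. *)
  have contra s : `|t - s| < d -> s != t -> 0 <= s -> s <= T0 -> False.
    move=> h1 h2 h3 h4; have := hd' s h1 h2.
    rewrite in_itv/= h3 h4 => /(_ isT); rewrite ipZl ipBl !(ipC ip _ (B h)).
    by rewrite (hw _ s)// (hw _ t)// subrr mulr0 subr0 ltxx.
  have [tlt|] := ltP t T0.
    have m0 : 0 < Num.min (d / 2) (T0 - t) by rewrite lt_min divr_gt0//= subr_gt0.
    have m1 : Num.min (d / 2) (T0 - t) <= d / 2 by rewrite ge_min lexx.
    have m2 : Num.min (d / 2) (T0 - t) <= T0 - t by rewrite ge_min lexx orbT.
    apply: (contra (t + Num.min (d / 2) (T0 - t))).
    - by rewrite opprD addrA subrr sub0r normrN gtr0_norm//; lra.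
    - by rewrite gt_eqF// ltrDl.
    - by rewrite addr_ge0// ltW.
    - by lra.
  move=> tge; have tE : t = T0 by apply/eqP; rewrite eq_le tT0 tge.
  have m0 : 0 < Num.min (d / 2) T0 by rewrite lt_min divr_gt0.
  have m1 : Num.min (d / 2) T0 <= d / 2 by rewrite ge_min lexx.
  have m2 : Num.min (d / 2) T0 <= T0 by rewrite ge_min lexx orbT.
  apply: (contra (t - Num.min (d / 2) T0)).
  - by rewrite opprB addrC subrK gtr0_norm//; lra.
  - by rewrite lt_eqF// ltrBlDr ltrDl.
  - by lra.
  - by lra.
have Bs0 t : t \in `[0, T0] -> `|Bs (wt t)| ^+ 2 = 0.
  by move=> tT; rewrite -hH -hBs ipC Bw.
have := hobsB ((wave_solutionP hH hphi (lam_gt0 hlam0 hlam) _ _ _ _ _ _).2 sol).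
rewrite (@eq_integral _ _ _ _ _ (cst 0%E)); last first.
  by move=> t; rewrite inE/= => tT; rewrite Bs0.
rewrite integral0 mule0 => h.
split; [apply: (@normX2_le0 beta1)|apply: (@normX2_le0 beta2)]; apply: le_trans h.
  by rewrite leeDl// normX2_ge0.
by rewrite leeDr// normX2_ge0.
Qed.

(* Up to the free evolution, the state (Lop w, w_t) at time T0 produced by the
   step controls p.2 on [0, p.1], p in s. *)
Definition final1 (s : seq (R * H)) : H :=
  \sum_(p <- s) Lop (synth (stepq ip phi lam (B p.2) p.1 T0)).

Definition final2 (s : seq (R * H)) : H :=
  \sum_(p <- s) synth (stepq' ip phi lam (B p.2) p.1 T0).

Definition ctrl_times (s : seq (R * H)) := forall p, p \in s -> 0 <= p.1 <= T0.

Lemma sqs_stepq' g tau t : sqs (stepq' ip phi lam g tau t).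
Proof.
apply: (sqs_bound (sqs_co hH hphi g) (k := 2 * lam0^-1)) => n.
have l0 := lam_gt0 hlam0 hlam n.
rewrite /stepq' !normrM mulrC mulrA mulrAC ler_wpM2r//.
rewrite mulrC ler_pM// ?normr_ge0//.
  have := ler_normB (ramps (lam n) t) (ramps (lam n) (t - tau)).
  have := ramps_le1 (lam n) t; have := ramps_le1 (lam n) (t - tau); lra.
by rewrite ger0_norm ?invr_ge0 ?(ltW l0)// lef_pV2 ?posrE.
Qed.

Lemma sqs_stepq g tau t : sqs (fun n => lam n * stepq ip phi lam g tau t n).
Proof.
apply: (sqs_bound (sqs_co hH hphi g) (k := 4 * lam0^-1)) => n.
have l0 := lam_gt0 hlam0 hlam n.
have -> : lam n * stepq ip phi lam g tau t n =
   ip g (phi n) * (rampc (lam n) t - rampc (lam n) (t - tau)) * (lam n)^-1.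
  by rewrite /stepq; field; rewrite gt_eqF.
rewrite !normrM mulrC mulrA mulrAC ler_wpM2r//.
rewrite mulrC ler_pM// ?normr_ge0//.
  have := ler_normB (rampc (lam n) t) (rampc (lam n) (t - tau)).
  have := rampc_le2 (lam n) t; have := rampc_le2 (lam n) (t - tau); lra.
by rewrite ger0_norm ?invr_ge0 ?(ltW l0)// lef_pV2 ?posrE.
Qed.

Lemma final_cat s t : final1 (s ++ t) = final1 s + final1 t /\
  final2 (s ++ t) = final2 s + final2 t.
Proof. by rewrite /final1 /final2 !big_cat. Qed.

Lemma final_scale a s : final1 [seq (p.1, a *: p.2) | p <- s] = a *: final1 s /\
  final2 [seq (p.1, a *: p.2) | p <- s] = a *: final2 s.
Proof.
rewrite /final1 /final2 !big_map !scaler_sumr; split; apply: eq_bigr => p _ /=.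
  rewrite !(Lop_synth hH hphi hlam0 hlam); try exact: sqs_stepq.
  apply: (co_inj hH hphi) => n; rewrite ipZl !(co_synth hH hphi); try exact: sqs_stepq.
  by rewrite /stepq linearZ/= ipZl; ring.
apply: (co_inj hH hphi) => n; rewrite ipZl !(co_synth hH hphi); try exact: sqs_stepq'.
by rewrite /stepq' linearZ/= ipZl; ring.
Qed.

(** Duality. Let psi be the free solution with lam_n psi_n(0) = p_n and velocity -q at 0, the sign
    coming from time reversal. The pairing of (p, q) with the response to the pulse h on [0, T0 - s]
    equals ip (B h) (psi s - psi T0), as the modes show. Orthogonality to all pulses therefore makes
    psi unobservable. *)
Lemma final_orth p q :
  (forall tau h, 0 <= tau -> tau <= T0 ->
     ip p (Lop (synth (stepq ip phi lam (B h) tau T0))) +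
     ip q (synth (stepq' ip phi lam (B h) tau T0)) = 0) -> p = 0 /\ q = 0.
Proof.
move=> orth.
pose a n := ip p (phi n); pose b n := ip (- q) (phi n).
have sa : sqs a by exact: sqs_co. have sb : sqs b by exact: sqs_co.
have sol := wsol_free hH hphi hlam0 hlam (ltW hT0) sa sb.
have l0 n : lam n != 0 by rewrite gt_eqF// (lam_gt0 hlam0 hlam).
have sU t : sqs (freeq lam a b t).
  by apply: (sqs_divlam hlam0 hlam); exact: (sqs_freeq hlam0 hlam).
have [w00 w10] : synth (fun n => a n / lam n) = 0 /\ synth b = 0.
  apply: (unobservable sol) => h s s0 sT.
  have tau0 : 0 <= T0 - s by rewrite subr_ge0.
  have tauT : T0 - s <= T0 by rewrite lerBlDr lerDl.
  have := orth (T0 - s) h tau0 tauT; set X := _ + _.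
  suff -> : X = ip (B h) (synth (freeq lam a b s) - synth (freeq lam a b T0)).
    by rewrite ipBr => /eqP; rewrite subr_eq0 => /eqP.
  rewrite /X; set x := Lop _; set y := synth _.
  have c1 := @cvg_parseval _ _ _ hH _ hphi p x.
  have c2 := @cvg_parseval _ _ _ hH _ hphi q y.
  have c3 := @cvg_parseval _ _ _ hH _ hphi (B h)
    (synth (freeq lam a b s) - synth (freeq lam a b T0)).
  have c4 : \sum_(0 <= n < N) ip p (phi n) * ip x (phi n) +
      \sum_(0 <= n < N) ip q (phi n) * ip y (phi n) @[N --> \oo] --> ip p x + ip q y.
    exact: cvgD.
  have E N : \sum_(0 <= n < N) ip p (phi n) * ip x (phi n) +
      \sum_(0 <= n < N) ip q (phi n) * ip y (phi n) =
      \sum_(0 <= n < N) ip (B h) (phi n) *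
        ip (synth (freeq lam a b s) - synth (freeq lam a b T0)) (phi n).
    rewrite -big_split/=; apply: eq_bigr => n _.
    rewrite /x /y (Lop_synth hH hphi hlam0 hlam); last exact: sqs_stepq.
    rewrite ipBl !(co_synth hH hphi) //; try exact: sqs_stepq; try exact: sqs_stepq'.
    rewrite /freeq /stepq /stepq' /rampc /ramps (_ : T0 - (T0 - s) = s); last by ring.
    rewrite !max_l// ?(ltW hT0)// /b -[- q]scaleN1r ipZl -/(a n) mulN1r.
    by field; exact: l0.
  have c5 : \sum_(0 <= n < N) ip p (phi n) * ip x (phi n) +
      \sum_(0 <= n < N) ip q (phi n) * ip y (phi n) @[N --> \oo] -->
      ip (B h) (synth (freeq lam a b s) - synth (freeq lam a b T0)).
    by under eq_fun do rewrite E.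
  exact: (cvg_unique _ c4 c5).
split.
  apply: (co_inj hH hphi) => n; rewrite ip0l -/(a n).
  have sd : sqs (fun n => a n / lam n).
    apply: (sqs_divlam hlam0 hlam); apply: (sqs_bound sa (k := 1)) => i.
    by rewrite mulrC divfK// mul1r.
  have := co_synth hH hphi n sd; rewrite w00 ip0l => /esym/eqP.
  by rewrite mulf_eq0 invr_eq0 (negbTE (l0 n)) orbF => /eqP.
apply: (co_inj hH hphi) => n; rewrite ip0l.
have := co_synth hH hphi n sb; rewrite w10 ip0l /b -scaleN1r ipZl mulN1r => /eqP.
by rewrite eq_sym oppr_eq0 => /eqP.
Qed.

(** The final states form a subspace: concatenating lists of pulses adds them, and scaling the
    amplitudes scales them. Its orthogonal is trivial by [final_orth]. *)
Lemma steer (x0 y0 : H) (e : R) : 0 < e -> exists2 s, ctrl_times s &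
  `|x0 + final1 s| ^+ 2 + `|y0 + final2 s| ^+ 2 < e.
Proof.
move=> e0.
pose V := [set v : H * H | exists2 s, ctrl_times s & v = (final1 s, final2 s)].
have [||||_ [s hs ->] h] := @dense_of_orth V x0 y0 e _ _ _ _ e0; last by exists s.
- by exists [::] => //; rewrite /final1 /final2 !big_nil.
- move=> _ _ [s hs ->] [t ht ->]; exists (s ++ t).
    by move=> p; rewrite mem_cat => /orP[/hs|/ht].
  by have [-> ->] := final_cat s t.
- move=> a _ [s hs ->]; exists [seq (p.1, a *: p.2) | p <- s].
    by move=> _ /mapP[p ps ->] /=; exact: hs.
  by have [-> ->] := final_scale a s.
- move=> p q hpq; apply: final_orth => tau h tau0 tauT.
  have := hpq (final1 [:: (tau, h)], final2 [:: (tau, h)]).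
  rewrite /= /final1 /final2 !big_seq1/=; apply; exists [:: (tau, h)].
    by move=> r; rewrite inE => /eqP -> /=; rewrite tau0.
  by rewrite /final1 /final2 !big_seq1.
Qed.

End Density.

(** * A competitor whose cost grows slowly with the horizon *)

Section Competitor.
Context (R : realType) (H : completeNormedModType R) (ip : {dot H for idfun}).
Hypothesis hH : induces_norm ip.
Context (phi : nat -> H) (hphi : orthonormal_basis ip phi).
Context (lam : nat -> R) (lam0 : R).
Hypotheses (hlam0 : 0 < lam0) (hlam : forall n, lam0 <= lam n).

Local Notation synth := (synth phi).
Local Notation Lop := (Lop ip phi lam).
Local Notation X12 := (X12 ip phi lam).
Local Notation wsol := (wsol ip phi lam).

Lemma rotation_le (A B x : R) : (A * cos x + B * sin x) ^+ 2 <= A ^+ 2 + B ^+ 2.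
Proof.
have := cos2Dsin2 x; have := sqr_ge0 (A * sin x - B * cos x); nra.
Qed.

(** Without force, each pair (lam n * w_n, w_t,n) rotates, so that neither component exceeds the
    energy at time [a]. The force is assumed to vanish after [a] but not at [a], where a pulse may
    still be on. *)
Lemma energy_free T f w0 w1 w wt a t : 0 <= a -> a <= t -> t <= T ->
  wsol T f w0 w1 w wt -> (forall psi, intg 0 T (fun s => ip (f s) psi)) ->
  (forall s, a < s -> f s = 0) ->
  `|Lop (w t)| ^+ 2 <= `|Lop (w a)| ^+ 2 + `|wt a| ^+ 2 /\
  `|wt t| ^+ 2 <= `|Lop (w a)| ^+ 2 + `|wt a| ^+ 2.
Proof.
move=> a0 at_ tT sol hf f0; have [_ hX _ _ _] := sol.
have wX s : 0 <= s -> s <= T -> X12 (w s).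
  by move=> s0 sT; apply: hX; rewrite in_itv/= s0.
have Xa : X12 (w a) by apply: wX => //; exact: le_trans at_ tT.
have Xt : X12 (w t) by apply: wX => //; exact: le_trans at_.
have zero n (th : R -> R) : measurable_fun `[a, t] th -> (forall s, `|th s| <= 1) ->
    itg a t (fun s => th s * ip (f s) (phi n)) = 0.
  move=> mth th1; rewrite (@eq_itg_oc _ _ _ _ (cst 0)).
  - by rewrite itg_cst// mul0r.
  - by move=> s; rewrite in_itv/= => /andP[/f0 -> _]; rewrite ip0l mulr0.
  - by apply: (intgM (K := 1) (intgS a0 tT (hf (phi n)))).
  - exact: intg_cst.
have sin1 (x : R) : `|sin x| <= 1 by rewrite ler_norml sin_geN1 sin_le1.
have cos1 (x : R) : `|cos x| <= 1 by rewrite ler_norml cos_geN1 cos_le1.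
have carg n : continuous (fun s => lam n * (t - s)).
  by move=> s; apply: cvgM; [exact: cvg_cst|apply: cvgB; [exact: cvg_cst|exact: cvg_id]].
have msin n : measurable_fun `[a, t] (fun s => sin (lam n * (t - s))).
  apply: measurable_funTS; apply: continuous_measurable_fun.
  by apply: (cont_comp (carg n)); exact: continuous_sin.
have mcos n : measurable_fun `[a, t] (fun s => cos (lam n * (t - s))).
  apply: measurable_funTS; apply: continuous_measurable_fun.
  by apply: (cont_comp (carg n)); exact: continuous_cos.
have D n := wsol_duhamel hH hphi (lam_gt0 hlam0 hlam) a0 at_ tT sol (hf (phi n)).
have main (x : H) : (forall n, ip x (phi n) ^+ 2 <=
      (lam n * ip (w a) (phi n)) ^+ 2 + ip (wt a) (phi n) ^+ 2) ->
    `|x| ^+ 2 <= `|Lop (w a)| ^+ 2 + `|wt a| ^+ 2.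
  move=> hx; apply: (norm2_le hH hphi) => N.
  apply: le_trans (lerD (bessel hH hphi (Lop (w a)) N) (bessel hH hphi (wt a) N)).
  rewrite -big_split/=; apply: ler_sum => n _.
  by rewrite (co_Lop hH hphi)//; exact: hx.
split; apply: main => n; have [D1 D2] := D n.
  rewrite (co_Lop hH hphi)// D1 zero// addr0.
  apply: le_trans (rotation_le _ _ (lam n * (t - a))).
  by rewrite le_eqVlt; apply/orP; left; apply/eqP; ring.
rewrite D2 zero// addr0.
have := rotation_le (ip (wt a) (phi n)) (- (lam n * ip (w a) (phi n))) (lam n * (t - a)).
rewrite sqrrN [X in _ <= X -> _]addrC; apply: le_trans.
by rewrite le_eqVlt; apply/orP; left; apply/eqP; ring.
Qed.

Lemma X12_sum (I : Type) (s : seq I) (x : I -> H) : (forall i, X12 (x i)) ->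
  X12 (\sum_(i <- s) x i).
Proof.
by move=> hx; apply: big_ind => // [|u v]; [exact: X12_0|exact: X12D].
Qed.

Lemma Lop_sum (I : Type) (s : seq I) (x : I -> H) : (forall i, X12 (x i)) ->
  Lop (\sum_(i <- s) x i) = \sum_(i <- s) Lop (x i).
Proof.
move=> hx; elim: s => [|i s IH]; last by rewrite !big_cons (LopD hH hphi) ?IH//; exact: X12_sum.
rewrite !big_nil; apply: (co_inj hH hphi) => n.
by rewrite (co_Lop hH hphi) ?ip0l ?mulr0//; exact: X12_0.
Qed.

Lemma synth_co x : synth (fun n => ip x (phi n)) = x.
Proof.
by apply: (co_inj hH hphi) => n; rewrite (co_synth hH hphi)//; exact: sqs_co.
Qed.

Definition ctrl (s : seq (R * H)) (t : R) : H :=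
  \sum_(p <- s) (if t <= p.1 then p.2 else 0).

Lemma bmeasurable_ctrl T s : bmeasurable T (ctrl s).
Proof.
(* Carrying the shift [x] through the induction makes every step a case distinction on [t], without
   any sum of measurable functions in H. *)
suff h (x : H) : bmeasurable T (fun t => x + ctrl s t).
  have -> : ctrl s = (fun t => 0 + ctrl s t) by apply/funext => t; rewrite add0r.
  exact: h.
elim: s x => [|p s IH] x.
  have -> : (fun t => x + ctrl [::] t) = cst x.
    by apply/funext => t; rewrite /ctrl big_nil addr0.
  by rewrite /bmeasurable; exact: measurable_cst.
have -> : (fun t => x + ctrl (p :: s) t) =
    (fun t => if t <= p.1 then (x + p.2) + ctrl s t else x + ctrl s t).
  by apply/funext => t; rewrite /ctrl big_cons; case: ifP => _; rewrite ?add0r// addrA.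
apply: measurable_fun_if => //.
- by apply: measurable_funTS; apply: measurable_fun_ler.
- apply: measurable_funS (IH (x + p.2)) => //; exact: mitv.
- apply: measurable_funS (IH x) => //; exact: mitv.
Qed.

Lemma ctrl_norm s t : `|ctrl s t| <= \sum_(p <- s) `|p.2|.
Proof.
apply: (le_trans (ler_norm_sum _ _ _)); apply: ler_sum => p _.
by case: ifP => //; rewrite normr0.
Qed.

Lemma L2_ctrl T s : L2 T (ctrl s).
Proof.
apply/L2P; split; first exact: bmeasurable_ctrl.
apply: (@intg_dom _ _ _ _ (fun=> (\sum_(p <- s) `|p.2|) ^+ 2)).
- apply: measurable_funX.
  apply: (bmeasurable_real (g := fun x => `|x|) (@bmeasurable_ctrl T s)).
  exact: norm_continuous_H.
- exact: intg_cst.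
- move=> t _; rewrite ger0_norm ?sqr_ge0// lerXn2r ?nnegrE ?sumr_ge0//.
  exact: ctrl_norm.
Qed.

Context (B : {linear H -> H}).
Context (Bs : H -> H) (hBs : adjoint_of ip B Bs).
Context (T0 beta1 beta2 c : R) (hT0 : 0 < T0).
Hypothesis hobsB : forall (w0 w1 : H) (w wt : R -> H),
     wave_solution ip lam phi T0 (fun=> 0) w0 w1 w wt ->
     (normX2 ip lam phi beta1 w0 + normX2 ip lam phi beta2 w1
      <= c%:E * \int[lebesgue_measure]_(t in `[0%R, T0]) (`|Bs (wt t)| ^+ 2)%:E)%E.

(** Superposition of the pulses, one at a time, on the free solution. The formula for the state is
    the same for all horizons T. *)
Lemma wsol_ctrl T s y0 y1 : 0 <= T -> X12 y0 -> ctrl_times T0 s ->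
  let a n := lam n * ip y0 (phi n) in let b n := ip y1 (phi n) in
  wsol T (B \o ctrl s) y0 y1
    (fun t => synth (freeq lam a b t) +
       \sum_(p <- s) synth (stepq ip phi lam (B p.2) p.1 t))
    (fun t => synth (freeq' lam a b t) +
       \sum_(p <- s) synth (stepq' ip phi lam (B p.2) p.1 t)).
Proof.
move=> hT y0X + a b.
have l0 n : lam n != 0 by rewrite gt_eqF// (lam_gt0 hlam0 hlam).
elim: s => [|p s IH] hs.
  have := wsol_free hH hphi hlam0 hlam hT y0X (sqs_co hH hphi y1).
  have -> : (fun n => lam n * ip y0 (phi n) / lam n) = (fun n => ip y0 (phi n)).
    by apply/funext => n; rewrite mulrAC divff// mul1r.
  rewrite !synth_co; congr wsol; apply/funext => t /=.
  - by rewrite /ctrl big_nil linear0.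
  - by rewrite big_nil addr0.
  - by rewrite big_nil addr0.
have hs' : ctrl_times T0 s by move=> q qs; apply: hs; rewrite inE qs orbT.
have /andP[p0 _] := hs p (mem_head _ _).
have ic psi : intg 0 T (fun t => ip ((B \o ctrl s) t) psi).
  apply: (eq_intg (f := fun t => ip (ctrl s t) (Bs psi))); last exact: L2_ip (L2_ctrl T s).
  by move=> t _; rewrite hBs.
have is_ psi : intg 0 T (fun t => ip (if t <= p.1 then B p.2 else 0) psi).
  apply: eq_intg (intg_step 0 T p.1 (ip (B p.2) psi) 0) => t _.
  by case: ifP; rewrite ?ip0l.
have := wsol_add hH hphi ic is_ (IH hs') (wsol_step hH hphi hlam0 hlam (B p.2) hT p0).
rewrite !addr0; congr wsol; apply/funext => t /=.
- rewrite /ctrl big_cons linearD/= addrC; congr (_ + _).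
  by case: ifP => //; rewrite linear0.
- by rewrite big_cons addrAC addrA.
- by rewrite big_cons addrAC addrA.
Qed.

Context (C : H -> H) (M : R) (hM : 0 <= M).
Hypothesis hClin : linear_on X12 C.
Hypothesis hCM : forall x, X12 x -> `|C x| ^+ 2 <= M * `|Lop x| ^+ 2.

Lemma C_sub x y : X12 x -> X12 y -> C (x - y) = C x - C y.
Proof.
move=> xX yX; rewrite -[x - y]addrC -(scaleN1r y) hClin//.
by rewrite scaleN1r addrC.
Qed.

Lemma C_add x y : X12 x -> X12 y -> C (x + y) = C x + C y.
Proof. by move=> xX yX; rewrite -{1}[x]scale1r hClin// scale1r. Qed.

Lemma C_continuous (T : R) (y : R -> H) : (forall t, t \in `[0, T] -> X12 (y t)) ->
  {within `[0, T], continuous (Lop \o y)} -> {within `[0, T], continuous (C \o y)}.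
Proof.
move=> yX /subspace_continuousP cy; apply/subspace_continuousP => t tT.
have /cvgrPdist_lt c1 := cy t tT.
apply/cvgrPdist_lt => e e0.
have M1 : 0 < M + 1 by rewrite ltr_wpDl.
have d0 : 0 < e / (M + 1) by rewrite divr_gt0.
have := c1 _ d0; rewrite !near_withinE; apply: filterS => s h sT.
have {}h := h sT; rewrite /= in h *.
have tX := yX _ tT; have sX := yX _ sT.
rewrite -C_sub// -(@ltr_pXn2r _ 2) ?nnegrE ?(ltW e0)//.
apply: (le_lt_trans (hCM (X12B tX sX))); rewrite (LopB hH hphi)//.
have h2 : `|Lop (y t) - Lop (y s)| ^+ 2 <= (e / (M + 1)) ^+ 2.
  by rewrite lerXn2r ?nnegrE ?(ltW d0) ?(ltW h)//.
apply: (@le_lt_trans _ _ (M * (e / (M + 1)) ^+ 2)); first by rewrite ler_wpM2l.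
rewrite expr_div_n mulrCA gtr_pMr ?exprn_gt0// ltr_pdivrMr ?exprn_gt0// mul1r.
nra.
Qed.

Lemma intg_C2 (T : R) (y : R -> H) : (forall t, t \in `[0, T] -> X12 (y t)) ->
  {within `[0, T], continuous (Lop \o y)} -> intg 0 T (fun t => `|C (y t)| ^+ 2).
Proof.
move=> yX cy; apply: intg_cont; have cC := C_continuous yX cy.
have cn : {within `[0, T], continuous (fun t => `|C (y t)|)}.
  by move=> t; apply: cvg_norm; exact: cC.
exact: cwM.
Qed.

(** The control, the state and [K] are fixed before T, since one control, zero after T0, serves all
    horizons. [K] is the cost on [0, T0]; later the energy is below [e], which bounds both the rate
    M * e of the cost and the final velocity, on which the boundary term of the competitor
    depends. *)
Lemma competitor y0 y1 e : 0 < e -> X12 y0 -> exists v y yt K, forall T, T0 <= T ->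
  [/\ L2 T v, wsol T (B \o v) y0 y1 y yt,
    itg 0 T (fun t => `|v t| ^+ 2 + `|C (y t)| ^+ 2) <= K + M * e * T &
    `|yt T| ^+ 2 <= e].
Proof.
move=> e0 y0X.
pose a n := lam n * ip y0 (phi n); pose b n := ip y1 (phi n).
have [s hs hfin] := steer hH hphi hlam0 hlam hBs hT0 hobsB
  (Lop (synth (freeq lam a b T0))) (synth (freeq' lam a b T0)) e0.
pose y t := synth (freeq lam a b t) +
       \sum_(p <- s) synth (stepq ip phi lam (B p.2) p.1 t).
pose yt t := synth (freeq' lam a b t) +
       \sum_(p <- s) synth (stepq' ip phi lam (B p.2) p.1 t).
have sol T : 0 <= T -> wsol T (B \o ctrl s) y0 y1 y yt.
  by move=> hT; exact: wsol_ctrl.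
have ic T psi : intg 0 T (fun t => ip ((B \o ctrl s) t) psi).
  apply: (eq_intg (f := fun t => ip (ctrl s t) (Bs psi))); last exact: L2_ip (L2_ctrl T s).
  by move=> t _; rewrite hBs.
have ctrl0 t : T0 < t -> ctrl s t = 0.
  move=> tT; rewrite /ctrl big1_seq// => p /= /hs /andP[_ pT].
  by rewrite leNgt (le_lt_trans pT tT).
have stX p t : X12 (synth (stepq ip phi lam (B p.2) p.1 t)).
  by apply: (X12_synth hH hphi hlam0 hlam); exact: (sqs_stepq hH hphi hlam0 hlam).
have frX t : 0 <= t -> X12 (synth (freeq lam a b t)).
  move=> t0; have [_ + _ _ _] := wsol_free hH hphi hlam0 hlam t0 y0X (sqs_co hH hphi y1).
  by move=> /(_ t); apply; rewrite in_itv/= t0 lexx.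
have fin : `|Lop (y T0)| ^+ 2 + `|yt T0| ^+ 2 < e.
  rewrite (LopD hH hphi); [|exact: frX (ltW hT0)|exact: X12_sum].
  by rewrite (Lop_sum _ (fun p => stX p T0)).
exists (ctrl s), y, yt, (itg 0 T0 (fun t => `|ctrl s t| ^+ 2 + `|C (y t)| ^+ 2)) => T hT.
have hT' : 0 <= T := le_trans (ltW hT0) hT.
have solT := sol T hT'; have [_ yX cy _ _] := solT.
have [_ iv] := (L2P _ _).1 (L2_ctrl T s).
have iC := intg_C2 yX cy.
have en t : T0 <= t -> t <= T -> `|Lop (y t)| ^+ 2 <= e /\ `|yt t| ^+ 2 <= e.
  move=> h1 h2; have [] := energy_free (ltW hT0) h1 h2 solT (ic T).
    by move=> r rT /=; rewrite ctrl0// linear0.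
  by move=> h3 h4; split; apply: ltW; [apply: le_lt_trans h3 fin|apply: le_lt_trans h4 fin].
split => //.
- exact: L2_ctrl.
- rewrite (itg_split (ltW hT0) hT); last exact: intgD.
  rewrite lerD2l.
  have i1 : intg T0 T (fun t => `|C (y t)| ^+ 2) by apply: intgS iC => //; exact: ltW.
  rewrite (@eq_itg_oc _ _ _ _ (fun t => `|C (y t)| ^+ 2))//; last 2 first.
  + by move=> t; rewrite in_itv/= => /andP[/ctrl0 -> _]; rewrite normr0 expr0n add0r.
  + by apply: intgS (intgD iv iC) => //; exact: ltW.
  apply: (@le_trans _ _ (itg T0 T (cst (M * e)))).
    apply: le_itg => //; first exact: intg_cst.
    move=> t; rewrite in_itv/= => /andP[t0 tT]; have [h _] := en t t0 tT.
    have tX : X12 (y t) by apply: yX; rewrite in_itv/= tT (le_trans (ltW hT0)).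
    by apply: (le_trans (hCM tX)); rewrite ler_wpM2l.
  rewrite itg_cst// ler_wpM2l ?mulr_ge0 ?(ltW e0)//.
  by rewrite lerBlDr lerDl ltW.
- by have [_] := en T hT (lexx _).
Qed.

End Competitor.

(** * Bounds on the final velocity by the cost *)

Section Estimates.
Context (R : realType) (H : completeNormedModType R) (ip : {dot H for idfun}).
Hypothesis hH : induces_norm ip.
Context (phi : nat -> H) (hphi : orthonormal_basis ip phi).
Context (lam : nat -> R) (lam0 : R).
Hypotheses (hlam0 : 0 < lam0) (hlam : forall n, lam0 <= lam n).

Local Notation synth := (synth phi).
Local Notation Lop := (Lop ip phi lam).
Local Notation X12 := (X12 ip phi lam).
Local Notation wsol := (wsol ip phi lam).
Local Notation normX2 := (normX2 ip lam phi).
Local Notation mu := (@lebesgue_measure R).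

Lemma itg_EFin a b (f : R -> R) : intg a b f ->
  (\int[mu]_(t in `[a, b]) (f t)%:E)%E = (itg a b f)%:E.
Proof. by move=> hf; rewrite /itg /Rintegral fineK//; exact: integrable_fin_num. Qed.

Lemma itg_shift (a L : R) (g : R -> R) : 0 <= L -> {within `[a, a + L], continuous g} ->
  itg 0 L (fun s => g (a + s)) = itg a (a + L) g.
Proof.
move=> L0 cg; rewrite /itg /Rintegral; congr fine.
have dF x : is_derive x (1 : R) (fun s => a + s) 1.
  by apply: is_derive_eq; rewrite /GRing.scale/=; ring.
have F' : (fun s : R => a + s)^`()%classic = cst (1 : R).
  by apply/funext => x; rewrite derive1E; have h := dF x; exact: derive_val.
have cF : continuous (fun s : R => a + s) by exact: is_derive_continuous dF.
have := @integration_by_substitution_increasing R (fun s => a + s) g 0 L L0.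
rewrite addr0 F' => ->.
- by apply: eq_integral => x _; rewrite /= mulr1.
- by move=> x y _ _ xy; rewrite ltrD2l.
- by move=> x _; exact: cvg_cst.
- exact: is_cvg_cst.
- exact: is_cvg_cst.
- split=> [x _||]; first by have [] := dF x.
    by apply: cvg_at_right_filter; exact: cF.
  by apply: cvg_at_left_filter; exact: cF.
- exact: cg.
Qed.

Lemma wsol_X12 T f w0 w1 w wt t : wsol T f w0 w1 w wt -> 0 <= t -> t <= T -> X12 (w t).
Proof. by move=> [_ hX _ _ _] t0 tT; apply: hX; rewrite in_itv/= t0. Qed.

(* The subtracted terms are the modes of the free evolution issued at time a. *)
Lemma wsol_deviation T f w0 w1 w wt a t N (e := itg a t (fun s => `|f s|)) :
  0 <= a -> a <= t -> t <= T ->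
  wsol T f w0 w1 w wt -> (forall psi, intg 0 T (fun s => ip (f s) psi)) ->
  intg 0 T (fun s => `|f s|) ->
  \sum_(0 <= n < N) (lam n * ip (w t) (phi n) -
     (lam n * cos (lam n * (t - a)) * ip (w a) (phi n) +
      sin (lam n * (t - a)) * ip (wt a) (phi n))) ^+ 2 <= e ^+ 2 /\
  \sum_(0 <= n < N) (ip (wt t) (phi n) - (cos (lam n * (t - a)) * ip (wt a) (phi n) -
    lam n * sin (lam n * (t - a)) * ip (w a) (phi n))) ^+ 2 <= e ^+ 2.
Proof.
move=> a0 at_ tT sol hf hn.
have sin1 (x : R) : `|sin x| <= 1 by rewrite ler_norml sin_geN1 sin_le1.
have cos1 (x : R) : `|cos x| <= 1 by rewrite ler_norml cos_geN1 cos_le1.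
have carg n : continuous (fun s => lam n * (t - s)).
  by move=> s; apply: cvgM; [exact: cvg_cst|apply: cvgB; [exact: cvg_cst|exact: cvg_id]].
have msin n : measurable_fun `[a, t] (fun s => sin (lam n * (t - s))).
  apply: measurable_funTS; apply: continuous_measurable_fun.
  by apply: (cont_comp (carg n)); exact: continuous_sin.
have mcos n : measurable_fun `[a, t] (fun s => cos (lam n * (t - s))).
  apply: measurable_funTS; apply: continuous_measurable_fun.
  by apply: (cont_comp (carg n)); exact: continuous_cos.
have D n := wsol_duhamel hH hphi (lam_gt0 hlam0 hlam) a0 at_ tT sol (hf (phi n)).
have hn' : intg a t (fun s => `|f s|) by exact: intgS hn.
have hf' n : intg a t (fun s => ip (f s) (phi n)) by exact: intgS (hf (phi n)).
split.
- have := @minkowski_modes _ _ _ hH _ hphi a t f (fun n s => sin (lam n * (t - s))) N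
    at_ hn' (fun n => intgM (hf' n) (msin n) (fun s _ => sin1 _)) (fun n s => sin1 _).
  apply: le_trans; apply: ler_sum => n _; have [-> _] := D n.
  by rewrite addrC addKr.
- have := @minkowski_modes _ _ _ hH _ hphi a t f (fun n s => cos (lam n * (t - s))) N
    at_ hn' (fun n => intgM (hf' n) (mcos n) (fun s _ => cos1 _)) (fun n s => cos1 _).
  apply: le_trans; apply: ler_sum => n _; have [_ ->] := D n.
  by rewrite addrC addKr.
Qed.

(** The velocity is a rotation of the initial data plus a response bounded by [wsol_deviation]; the
    factors 2 come from X^2 <= 2 F^2 + 2 (X - F)^2, where F is the rotated part of a mode. *)
Lemma velocity_bound T f w0 w1 w wt : 0 <= T -> wsol T f w0 w1 w wt ->
  (forall psi, intg 0 T (fun s => ip (f s) psi)) -> intg 0 T (fun s => `|f s|) ->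
  `|wt T| ^+ 2 <= 2 * (`|Lop w0| ^+ 2 + `|w1| ^+ 2) + 2 * itg 0 T (fun s => `|f s|) ^+ 2.
Proof.
move=> T0 sol hf hn; have [[E0 E1] _ _ _ _] := sol.
have w0X : X12 w0 by rewrite -E0; apply: (wsol_X12 sol).
apply: (norm2_le hH hphi) => N.
have [_ dev] := wsol_deviation N (lexx 0) T0 (lexx T) sol hf hn.
rewrite E0 E1 in dev.
have h1 := bessel hH hphi (Lop w0) N; have h2 := bessel hH hphi w1 N.
set d := fun n => _ in dev; rewrite -/d in dev.
apply: (@le_trans _ _ (2 * (\sum_(0 <= n < N) ip (Lop w0) (phi n) ^+ 2 +
   \sum_(0 <= n < N) ip w1 (phi n) ^+ 2) + 2 * \sum_(0 <= n < N)
   (ip (wt T) (phi n) - (cos (lam n * (T - 0)) * ip w1 (phi n) -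
    lam n * sin (lam n * (T - 0)) * ip w0 (phi n))) ^+ 2)); last first.
  by rewrite lerD// ler_wpM2l// lerD.
rewrite -big_split/= !mulr_sumr -big_split/=; apply: ler_sum => n _.
rewrite (co_Lop hH hphi)//.
have r := rotation_le (ip w1 (phi n)) (- (lam n * ip w0 (phi n))) (lam n * (T - 0)).
set X := ip (wt T) _; set F := cos _ * _ - _.
have rF : F ^+ 2 <= ip w1 (phi n) ^+ 2 + (lam n * ip w0 (phi n)) ^+ 2.
  rewrite -(sqrrN (lam n * _)); apply: le_trans r.
  by rewrite /F le_eqVlt; apply/orP; left; apply/eqP; ring.
have := sqr_ge0 (X - 2 * F).
move: rF; move: (ip w1 _ ^+ 2) (( _ * ip w0 _) ^+ 2) (F) => x1 x2 F' h3 h4; nra.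
Qed.

Context (B : {linear H -> H}) (hB : continuous B).
Context (Bs : H -> H) (hBs : adjoint_of ip B Bs).
Context (b : R) (hBb : forall x, `|B x| <= b * `|x|).

Lemma norm_B_continuous : continuous (fun x => `|B x|).
Proof. by move=> x; apply: cvg_norm; exact: hB. Qed.

Lemma intg_ipB T v psi : L2 T v -> intg 0 T (fun s => ip ((B \o v) s) psi).
Proof.
move=> hv; apply: (eq_intg (f := fun t => ip (v t) (Bs psi))); last exact: L2_ip hv.
by move=> t _; rewrite hBs.
Qed.

Lemma intg_normB T v : L2 T v -> intg 0 T (fun s => `|(B \o v) s|).
Proof.
move=> hv; apply: (L2_intg (g := fun x => `|B x|) hv norm_B_continuous (k := b)).
by move=> x; rewrite normr_id.
Qed.

(** Cauchy-Schwarz in time, whence the factor T - a. On the whole interval it is T and lets the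
    velocity grow; on a last window of length T1 it is a constant. The two uses treat high and low
    modes respectively. *)
Lemma itg_normB_le T v a : L2 T v -> 0 <= a -> a <= T ->
  itg a T (fun s => `|(B \o v) s|) ^+ 2 <=
  b ^+ 2 * ((T - a) * itg 0 T (fun s => `|v s| ^+ 2)).
Proof.
move=> hv a0 aT.
have i1 := intgS a0 (lexx T) (intg_normB hv).
have i2 := intgS a0 (lexx T) (L2_norm hv).
have [_ i3] := (L2P T v).1 hv; have i3' := intgS a0 (lexx T) i3.
have h1 : itg a T (fun s => `|(B \o v) s|) <= b * itg a T (fun s => `|v s|).
  rewrite -itgZ//; apply: le_itg => //; first exact: intgZ.
  by move=> s _; exact: hBb.
have h0 : 0 <= itg a T (fun s => `|(B \o v) s|) by apply: itg_ge0.
have h2 := cauchy_schwarz_itg aT i2 i3'.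
have h3 : itg a T (fun s => `|v s| ^+ 2) <= itg 0 T (fun s => `|v s| ^+ 2).
  by apply: le_itg_sub => // s _; exact: sqr_ge0.
apply: (@le_trans _ _ ((b * itg a T (fun s => `|v s|)) ^+ 2)).
  by rewrite lerXn2r ?nnegrE// (le_trans h0).
rewrite exprMn ler_wpM2l ?sqr_ge0//; apply: (le_trans h2).
by rewrite ler_wpM2l// subr_ge0.
Qed.

Context (C : H -> H) (M : R) (hM : 0 <= M).
Hypothesis hClin : linear_on X12 C.
Hypothesis hCM : forall x, X12 x -> `|C x| ^+ 2 <= M * `|Lop x| ^+ 2.
Context (T1 beta1 beta2 c : R) (hT1 : 0 < T1) (hc : 0 < c).
Hypothesis hobsC : forall (w0 w1 : H) (w wt : R -> H),
     wave_solution ip lam phi T1 (fun=> 0) w0 w1 w wt ->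
     (normX2 beta1 w0 + normX2 beta2 w1
      <= c%:E * \int[lebesgue_measure]_(t in `[0%R, T1]) (`|C (w t)| ^+ 2)%:E)%E.

Lemma intg_vC T (v : R -> H) f w0 w1 w wt : L2 T v -> wsol T f w0 w1 w wt ->
  intg 0 T (fun t => `|v t| ^+ 2 + `|C (w t)| ^+ 2).
Proof.
move=> hv [_ wX cw _ _]; apply: intgD; first by have [] := (L2P T v).1 hv.
exact: (intg_C2 hH hphi hM hClin hCM).
Qed.

(** The factor 2 + 2 M b^2 T1^2 bounds the observation of a free solution on the last window, the
    inverse weights turn norms of the scale into bounds on the mode n, b^2 T1 accounts for the
    control on that window, and 3 comes from a square of a sum. It may grow with n, and is therefore
    applied to finitely many modes. *)
Definition low_const n := 3 * (c * (2 + 2 * M * b ^+ 2 * T1 ^+ 2) *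
  ((lam n `^ (4 * beta2))^-1 + lam n ^+ 2 * (lam n `^ (4 * beta1))^-1) + b ^+ 2 * T1).

Lemma low_const_ge0 n : 0 <= low_const n.
Proof.
have p0 beta : 0 <= (lam n `^ (4 * beta))^-1 by rewrite invr_ge0 powR_ge0.
rewrite /low_const; have T10 := ltW hT1; have c0 := ltW hc.
have q0 := mulr_ge0 (mulr_ge0 (mulr_ge0 (ler0n R 2) hM) (sqr_ge0 b)) (sqr_ge0 T1).
have q1 := mulr_ge0 (sqr_ge0 b) T10.
have q2 := mulr_ge0 (sqr_ge0 (lam n)) (p0 beta1).
rewrite mulr_ge0// addr_ge0// mulr_ge0//; last exact: addr_ge0.
by rewrite mulr_ge0// addr_ge0.
Qed.

Lemma normX2_mode beta x K n : (normX2 beta x <= K%:E)%E ->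
  ip x (phi n) ^+ 2 <= K * (lam n `^ (4 * beta))^-1.
Proof.
move=> /normX2_leP/(_ n.+1); rewrite big_nat_recr//= => h.
have p0 : 0 < lam n `^ (4 * beta) by rewrite powR_gt0// (lam_gt0 hlam0 hlam).
rewrite ler_pdivlMr// mulrC; apply: le_trans h; rewrite lerDr.
by apply: sumr_ge0 => i _; rewrite mulr_ge0 ?powR_ge0 ?sqr_ge0.
Qed.

(** On the window [T - T1, T] the state is compared with the free solution [ps] having the same
    position and velocity at T - T1. They differ in energy by at most e^2, where [e] is the integral
    of |B v| on the window, so that the observation of [ps] is bounded by I. The inequality on C
    then bounds each mode at T - T1, and Duhamel's formula carries the bound to T. *)
Lemma low_mode T (v : R -> H) w0 w1 w wt n
    (I := itg 0 T (fun t => `|v t| ^+ 2 + `|C (w t)| ^+ 2)) :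
  T1 <= T -> L2 T v -> wsol T (B \o v) w0 w1 w wt ->
  ip (wt T) (phi n) ^+ 2 <= low_const n * I.
Proof.
move=> hT hv sol; pose t0 := T - T1.
have T10 := ltW hT1.
have t00 : 0 <= t0 by rewrite subr_ge0.
have t0T : t0 <= T by rewrite lerBlDr lerDl.
have hf psi := intg_ipB psi hv; have hn := intg_normB hv.
have [_ wX cw _ _] := sol.
have iC : intg 0 T (fun t => `|C (w t)| ^+ 2) by exact: (intg_C2 hH hphi hM hClin hCM).
have [_ iv] := (L2P T v).1 hv.
have Iv : itg 0 T (fun t => `|v t| ^+ 2) <= I.
  by apply: le_itg => //; [exact: intgD|move=> t _; rewrite lerDl sqr_ge0].
have IC : itg 0 T (fun t => `|C (w t)| ^+ 2) <= I.
  by apply: le_itg => //; [exact: intgD|move=> t _; rewrite lerDr sqr_ge0].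
have I0 : 0 <= I by apply: le_trans Iv; apply: itg_ge0 => t _; exact: sqr_ge0.
have TE : T - t0 = T1 by rewrite /t0; ring.
pose e := itg t0 T (fun s => `|(B \o v) s|).
have e0 : 0 <= e by apply: itg_ge0.
have e2 : e ^+ 2 <= b ^+ 2 * T1 * I.
  apply: (le_trans (itg_normB_le hv t00 t0T)); rewrite TE -mulrA.
  by rewrite ler_wpM2l ?sqr_ge0// ler_wpM2l.
have X0 : X12 (w t0) by apply: (wsol_X12 sol).
pose p k := lam k * ip (w t0) (phi k); pose q k := ip (wt t0) (phi k).
have solf := wsol_free hH hphi hlam0 hlam T10 X0 (sqs_co hH hphi (wt t0)).
rewrite -/p -/q (synth_co hH hphi) in solf.
have l0 k : lam k != 0 by rewrite gt_eqF// (lam_gt0 hlam0 hlam).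
rewrite (_ : synth (fun k => p k / lam k) = w t0) in solf; last first.
  rewrite -[RHS](synth_co hH hphi); congr (synth _); apply/funext => k.
  by rewrite /p mulrAC divff// mul1r.
set ps := fun t => synth (freeq lam p q t) in solf.
have [_ psX cps _ _] := solf.
have iCp : intg 0 T1 (fun t => `|C (ps t)| ^+ 2) by exact: (intg_C2 hH hphi hM hClin hCM).
have close s : 0 <= s -> s <= T1 ->
    `|C (ps s)| ^+ 2 <= 2 * `|C (w (t0 + s))| ^+ 2 + 2 * (M * e ^+ 2).
  move=> s0 sT1.
  have h1 : t0 <= t0 + s by rewrite lerDl.
  have h2 : t0 + s <= T by rewrite /t0; lra.
  have Xw : X12 (w (t0 + s)) by apply: (wsol_X12 sol) => //; exact: le_trans h1.
  have Xp : X12 (ps s) by apply: (wsol_X12 solf).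
  have dif : `|Lop (ps s - w (t0 + s))| ^+ 2 <= e ^+ 2.
    apply: (norm2_le hH hphi) => N.
    have [dev _] := wsol_deviation N t00 h1 h2 sol hf hn.
    apply: (@le_trans _ _ (itg t0 (t0 + s) (fun r => `|(B \o v) r|) ^+ 2)); last first.
      rewrite lerXn2r ?nnegrE ?itg_ge0//; apply: le_itg_sub => //.
      by apply: intgS hn.
    apply: le_trans dev; apply: ler_sum => k _.
    rewrite (co_Lop hH hphi); last exact: X12B.
    rewrite ipBl /ps (co_synth hH hphi); last first.
      by apply: (sqs_divlam hlam0 hlam); apply: (sqs_freeq hlam0 hlam) => //; exact: sqs_co.
    rewrite -sqrrN le_eqVlt; apply/orP; left; apply/eqP; congr (_ ^+ 2).
    rewrite /freeq /p /q (_ : t0 + s - t0 = s); last by ring.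
    by field.
  have -> : C (ps s) = C (w (t0 + s)) + C (ps s - w (t0 + s)).
    by rewrite (C_sub hClin)// addrC subrK.
  apply: (le_trans (norm2D_le hH _ _)); rewrite lerD2l ler_wpM2l//.
  by apply: (le_trans (hCM (X12B Xp Xw))); rewrite ler_wpM2l.
have cCw : {within `[0, T], continuous (fun t => `|C (w t)| ^+ 2)}.
  have cC := C_continuous hH hphi hM hClin hCM wX cw.
  have cn : {within `[0, T], continuous (fun t => `|C (w t)|)}.
    by move=> t; apply: cvg_norm; exact: cC.
  exact: cwM.
have cCw' : {within `[t0, t0 + T1], continuous (fun t => `|C (w t)| ^+ 2)}.
  apply: continuous_subspaceW cCw => x /=; rewrite !in_itv/= => /andP[h1 h2].
  by rewrite (le_trans t00 h1) (le_trans h2)// /t0 subrK.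
have sh := itg_shift T10 cCw'.
have ishift : intg 0 T1 (fun s => `|C (w (t0 + s))| ^+ 2).
  apply: intg_cont; apply/subspace_continuousP => s sT.
  have sT' : `[t0, t0 + T1]%classic (t0 + s).
    by move: sT; rewrite /= !in_itv/= lerDl lerD2l.
  move/subspace_continuousP : cCw' => /(_ _ sT')/cvgrPdist_lt cc.
  apply/cvgrPdist_lt => r /cc; rewrite !near_withinE => -[d /= d0 hd].
  exists d => //= u su uT; apply: hd; rewrite /=.
    by rewrite opprD addrACA subrr add0r.
  by move: uT; rewrite !in_itv/= lerDl lerD2l.
have Z : itg 0 T1 (fun t => `|C (ps t)| ^+ 2) <= (2 + 2 * M * b ^+ 2 * T1 ^+ 2) * I.
  apply: (@le_trans _ _ (itg 0 T1 (fun s => 2 * `|C (w (t0 + s))| ^+ 2 + 2 * (M * e ^+ 2)))).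
    apply: le_itg => //; first by apply: intgD; [exact: intgZ|exact: intg_cst].
    by move=> s; rewrite in_itv/= => /andP[s0 sT]; exact: close.
  rewrite itgD; [|exact: intgZ|exact: intg_cst].
  rewrite (itgZ 2 ishift) sh (itg_cst (2 * (M * e ^+ 2)) T10) subr0.
  have h1 : itg t0 (t0 + T1) (fun t => `|C (w t)| ^+ 2) <= I.
    apply: le_trans IC; rewrite (_ : t0 + T1 = T); last by rewrite /t0; ring.
    by apply: le_itg_sub => // s _; exact: sqr_ge0.
  have h2 : M * e ^+ 2 * T1 <= M * (b ^+ 2 * T1 * I) * T1.
    by rewrite ler_wpM2r// ler_wpM2l.
  have -> : (2 + 2 * M * b ^+ 2 * T1 ^+ 2) * I = 2 * I + 2 * (M * (b ^+ 2 * T1 * I) * T1).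
    by ring.
  by rewrite -[X in _ + X]mulrA lerD// ler_wpM2l.
have obs := hobsC ((wave_solutionP hH hphi (lam_gt0 hlam0 hlam) _ _ _ _ _ _).2 solf).
rewrite itg_EFin// -EFinM in obs.
set ZZ := c * _ in obs.
have ZZle : ZZ <= c * ((2 + 2 * M * b ^+ 2 * T1 ^+ 2) * I) by rewrite ler_wpM2l// ltW.
have o1 : ip (w t0) (phi n) ^+ 2 <= ZZ * (lam n `^ (4 * beta1))^-1.
  by apply: normX2_mode; apply: le_trans obs; rewrite leeDl// normX2_ge0.
have o2 : ip (wt t0) (phi n) ^+ 2 <= ZZ * (lam n `^ (4 * beta2))^-1.
  apply: normX2_mode; apply: le_trans obs.
  by rewrite leeDr// normX2_ge0.
(* Among the modes 0 to n, only the last one is kept; the other squares are dropped. *)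
have [_ dev] := wsol_deviation n.+1 t00 t0T (lexx T) sol hf hn.
rewrite big_nat_recr//= -/e in dev.
have {}dev := le_trans (ler_wpDl (sumr_ge0 _ (fun i _ => sqr_ge0 _)) (lexx _)) dev.
have r := rotation_le (ip (wt t0) (phi n)) (- (lam n * ip (w t0) (phi n))) (lam n * (T - t0)).
move: dev; set X := ip (wt T) _; set F := cos _ * _ - _ => dev.
have rF : F ^+ 2 <= ip (wt t0) (phi n) ^+ 2 + lam n ^+ 2 * ip (w t0) (phi n) ^+ 2.
  rewrite -exprMn -(sqrrN (lam n * _)); apply: le_trans r.
  by rewrite /F le_eqVlt; apply/orP; left; apply/eqP; ring.
have XF : X ^+ 2 <= 3 * F ^+ 2 + 3 * (X - F) ^+ 2.
  have := sqr_ge0 (X - 2 * F); have := sqr_ge0 (X - F); have := sqr_ge0 F; nra.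
have P0 beta : 0 <= (lam n `^ (4 * beta))^-1 by rewrite invr_ge0 powR_ge0.
have l2 : 0 <= lam n ^+ 2 by exact: sqr_ge0.
rewrite /low_const.
have s1 : lam n ^+ 2 * ip (w t0) (phi n) ^+ 2 <= lam n ^+ 2 * (ZZ * (lam n `^ (4 * beta1))^-1).
  by rewrite ler_wpM2l.
have s2 : ZZ * ((lam n `^ (4 * beta2))^-1 + lam n ^+ 2 * (lam n `^ (4 * beta1))^-1) <=
   c * ((2 + 2 * M * b ^+ 2 * T1 ^+ 2) * I) *
   ((lam n `^ (4 * beta2))^-1 + lam n ^+ 2 * (lam n `^ (4 * beta1))^-1).
  by rewrite ler_wpM2r// addr_ge0// mulr_ge0.
have -> : 3 * (c * (2 + 2 * M * b ^+ 2 * T1 ^+ 2) *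
  ((lam n `^ (4 * beta2))^-1 + lam n ^+ 2 * (lam n `^ (4 * beta1))^-1) + b ^+ 2 * T1) * I =
  3 * (c * ((2 + 2 * M * b ^+ 2 * T1 ^+ 2) * I) *
   ((lam n `^ (4 * beta2))^-1 + lam n ^+ 2 * (lam n `^ (4 * beta1))^-1)) + 3 * (b ^+ 2 * T1 * I).
  by ring.
move: rF XF s1 s2 o2 dev e2.
move: (b ^+ 2 * T1 * I) (c * _ * _) => x1 x2.
move: (lam n `^ (4 * beta1))^-1 (lam n `^ (4 * beta2))^-1 (lam n ^+ 2) => m1 m2 l.
move: (F ^+ 2) ((X - F) ^+ 2) (X ^+ 2) (ip (w t0) (phi n) ^+ 2) (ip (wt t0) (phi n) ^+ 2) (e ^+ 2).
by move=> f1 f2 f3 f4 f5 f6 H1 H2 H3 H4 H5 H6 H7; nra.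
Qed.

End Estimates.

(** * The estimate I = o(T) for the optimal pair *)

Section Turnpike.
Context (R : realType) (H : completeNormedModType R) (ip : {dot H for idfun}).
Hypothesis hH : induces_norm ip.
Context (phi : nat -> H) (hphi : orthonormal_basis ip phi).
Context (lam : nat -> R) (lam0 : R).
Hypotheses (hlam0 : 0 < lam0) (hlam : forall n, lam0 <= lam n).

Local Notation synth := (synth phi).
Local Notation Lop := (Lop ip phi lam).
Local Notation X12 := (X12 ip phi lam).
Local Notation wsol := (wsol ip phi lam).
Local Notation normX2 := (normX2 ip lam phi).
Local Notation mu := (@lebesgue_measure R).

Context (B : {linear H -> H}) (hB : continuous B).
Context (Bs : H -> H) (hBs : adjoint_of ip B Bs).
Context (b : R) (hBb : forall x, `|B x| <= b * `|x|).

Context (C : H -> H) (M : R) (hM : 0 <= M).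
Hypothesis hClin : linear_on X12 C.
Hypothesis hCM : forall x, X12 x -> `|C x| ^+ 2 <= M * `|Lop x| ^+ 2.
Context (T0 T1 beta1 beta2 beta3 beta4 c : R).
Hypotheses (hT0 : 0 < T0) (hT1 : 0 < T1) (hc : 0 < c).
Hypothesis hobsB : forall (w0 w1 : H) (w wt : R -> H),
     wave_solution ip lam phi T0 (fun=> 0) w0 w1 w wt ->
     (normX2 beta3 w0 + normX2 beta4 w1
      <= c%:E * \int[lebesgue_measure]_(t in `[0%R, T0]) (`|Bs (wt t)| ^+ 2)%:E)%E.
Hypothesis hobsC : forall (w0 w1 : H) (w wt : R -> H),
     wave_solution ip lam phi T1 (fun=> 0) w0 w1 w wt ->
     (normX2 beta1 w0 + normX2 beta2 w1
      <= c%:E * \int[lebesgue_measure]_(t in `[0%R, T1]) (`|C (w t)| ^+ 2)%:E)%E.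

Context (z wbar ubar pbar : H).
Hypotheses (wbarX : X12 wbar) (pbarX : X12 pbar).
Hypothesis wbarE : forall n, lam n ^+ 2 * ip wbar (phi n) = ip (B ubar) (phi n).
Hypothesis ubarE : forall h, ip ubar h = - ip pbar (B h).
Hypothesis pbarE : forall x, X12 x -> ip (C wbar - z) (C x) = ip (Lop pbar) (Lop x).

(** By the stationary system, the cross terms 2 (v, ubar) + 2 (C y, C wbar - z) are -2 ((B v, pbar)
    - (Lop y, Lop pbar)), which is formally -2 times the time derivative of (y_t, pbar). Only
    boundary terms survive integration. *)
Lemma cost_identity T (v : R -> H) y0 y1 y yt : 0 <= T -> L2 T v ->
  wsol T (B \o v) y0 y1 y yt ->
  intg 0 T (fun t => `|v t + ubar| ^+ 2 + `|C (y t + wbar) - z| ^+ 2) /\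
  itg 0 T (fun t => `|v t + ubar| ^+ 2 + `|C (y t + wbar) - z| ^+ 2) =
    itg 0 T (fun t => `|v t| ^+ 2 + `|C (y t)| ^+ 2) +
    2 * (ip y1 pbar - ip (yt T) pbar) + (`|ubar| ^+ 2 + `|C wbar - z| ^+ 2) * T.
Proof.
move=> T0' hv sol.
have [_ yX cy _ [_ hw]] := sol.
have i1 := intg_vC hH hphi hM hClin hCM hv sol.
have i2 : intg 0 T (fun s => ip ((B \o v) s) pbar - ip (Lop (y s)) (Lop pbar)).
  apply: intgB; first exact: (intg_ipB hH hBs).
  by apply: intg_cont; apply: (cw_ip hH (u := Lop \o y)).
set k := `|ubar| ^+ 2 + _.
have E t : t \in `[0, T] -> `|v t + ubar| ^+ 2 + `|C (y t + wbar) - z| ^+ 2 =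
   `|v t| ^+ 2 + `|C (y t)| ^+ 2 +
   (- 2) * (ip ((B \o v) t) pbar - ip (Lop (y t)) (Lop pbar)) + k.
  move=> tT; have yt_X := yX t tT.
  rewrite (C_add hClin)// -addrA (norm2D hH (v t)) (norm2D hH (C (y t))) (ipC ip (v t)) ubarE.
  rewrite (ipC ip (C (y t))) pbarE// (ipC ip pbar) (ipC ip (Lop pbar)) /k /=.
  by ring.
have i3 : intg 0 T (fun t => `|v t| ^+ 2 + `|C (y t)| ^+ 2 +
   (- 2) * (ip ((B \o v) t) pbar - ip (Lop (y t)) (Lop pbar)) + k).
  by apply: intgD; [apply: intgD => //; exact: intgZ|exact: intg_cst].
split; first by apply: eq_intg i3 => t tT; rewrite E.
rewrite (eq_itg E) itgD; [|by apply: intgD => //; exact: intgZ|exact: intg_cst].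
rewrite itgD//; last exact: intgZ.
rewrite (itgZ (- 2) i2) (itg_cst k T0') subr0.
rewrite (hw pbar T pbarX); last by rewrite in_itv/= T0' lexx.
rewrite -[Rintegral _ _ _]/(itg 0 T _).
by ring.
Qed.

Lemma wsol_shift T (u : R -> H) w0 w1 w wt x u0 : L2 T u -> X12 x ->
  (forall n, lam n ^+ 2 * ip x (phi n) = ip (B u0) (phi n)) ->
  wsol T (B \o u) w0 w1 w wt ->
  wsol T (B \o (fun t => u t + u0)) (w0 + x) w1 (fun t => w t + x) wt.
Proof.
move=> hu xX xE sol.
have ic psi : intg 0 T (fun=> ip (B u0) psi) by exact: intg_cst.
have := wsol_add hH hphi (fun psi => intg_ipB hH hBs psi hu) ic sol
  (wsol_const hH hphi T xX xE).
rewrite addr0; congr wsol; apply/funext => t /=.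
- by rewrite linearD.
- by rewrite addr0.
Qed.

(** Translation by the stationary pair maps admissible pairs to solutions issued from (w0 - wbar,
    w1) and back. The terms of [cost_identity] that do not depend on the pair cancel. *)
Lemma optimal_le w0 w1 T (w u : R -> H) : 0 < T ->
  optimal ip lam phi B C z w0 w1 T w u ->
  L2 T (fun t => u t - ubar) /\ exists wt,
  wsol T (B \o (fun t => u t - ubar)) (w0 - wbar) w1 (fun t => w t - wbar) wt /\
  forall v' y' yt', L2 T v' -> wsol T (B \o v') (w0 - wbar) w1 y' yt' ->
    itg 0 T (fun t => `|u t - ubar| ^+ 2 + `|C (w t - wbar)| ^+ 2) - 2 * ip (wt T) pbar <=
    itg 0 T (fun t => `|v' t| ^+ 2 + `|C (y' t)| ^+ 2) - 2 * ip (yt' T) pbar.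
Proof.
move=> hT [[hu [wt /(wave_solutionP hH hphi (lam_gt0 hlam0 hlam)) sol]] hmin].
have hv := L2_addc (- ubar) hu; split => //.
have NwX : X12 (- wbar) by rewrite -scaleN1r; exact: X12Z.
have NwE n : lam n ^+ 2 * ip (- wbar) (phi n) = ip (B (- ubar)) (phi n).
  by rewrite linearN -(scaleN1r wbar) -(scaleN1r (B ubar)) !ipZl -wbarE; ring.
have sol' := wsol_shift hu NwX NwE sol.
exists wt; split => // v' y' yt' hv' sy'.
have hu' := L2_addc ubar hv'.
have su' := wsol_shift hv' wbarX wbarE sy'; rewrite subrK in su'.
have := hmin _ _ (conj hu' (ex_intro _ _
  ((wave_solutionP hH hphi (lam_gt0 hlam0 hlam) _ _ _ _ _ _).2 su'))).
have [j1 e1] := cost_identity (ltW hT) hv sol'.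
have [j2 e2] := cost_identity (ltW hT) hv' sy'.
have eq1 : {in `[0, T], (fun t => `|u t - ubar + ubar| ^+ 2 + `|C (w t - wbar + wbar) - z| ^+ 2)
   =1 (fun t => `|u t| ^+ 2 + `|C (w t) - z| ^+ 2)}.
  by move=> t _; rewrite !subrK.
have j1' := eq_intg eq1 j1; rewrite (eq_itg eq1) in e1.
rewrite /cost !itg_EFin// -!EFinM lee_fin ler_pM2l//.
by rewrite e1 e2 => h; lra.
Qed.

Lemma young (x y k : R) : 0 < k -> 2 * (x * y) <= x ^+ 2 / k + k * y ^+ 2.
Proof.
move=> k0; have : 0 <= (x - k * y) ^+ 2 / k by rewrite divr_ge0 ?sqr_ge0// ltW.
have -> : (x - k * y) ^+ 2 / k = x ^+ 2 / k + k * y ^+ 2 - 2 * (x * y).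
  by field; rewrite gt_eqF.
by rewrite subr_ge0.
Qed.

Lemma ip_young (x y : H) k : 0 < k -> 2 * ip x y <= `|x| ^+ 2 / k + k * `|y| ^+ 2.
Proof.
move=> k0; apply: le_trans (young _ _ k0); rewrite ler_wpM2l//.
by apply: le_trans (cauchy_schwarz hH x y); exact: ler_norm.
Qed.

(* Young's inequality lets the left-hand side absorb every multiple of the cost
   that bounds the boundary term ip (wt T) pbar. *)
Lemma turnpike w0 w1 (wT uT : R -> R -> H) delta : 0 < delta ->
  X12 (w0 - wbar) ->
  (forall T, 0 < T -> optimal ip lam phi B C z w0 w1 T (wT T) (uT T)) ->
  exists2 Ts, 0 < Ts & forall T, Ts <= T ->
  L2 T (fun t => uT T t - ubar) /\ exists2 wt,
    wsol T (B \o (fun t => uT T t - ubar)) (w0 - wbar) w1 (fun t => wT T t - wbar) wt &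
    itg 0 T (fun t => `|uT T t - ubar| ^+ 2 + `|C (wT T t - wbar)| ^+ 2) <= delta * T.
Proof.
move=> d0 y0X hopt.
have M1 : 0 < M + 1 by rewrite ltr_wpDl.
have b2 : 0 <= b ^+ 2 := sqr_ge0 b.
have b1 : 0 < b ^+ 2 + 1 by rewrite ltr_wpDl.
(* The boundary term absorbs I / 4 twice, so I / 2 is to be bounded by delta * T / 2. The rates M *
   e and 8 b^2 r2 are at most delta / 8 each, and [Ts] makes the remaining constants, gathered in
   K', at most delta * T / 4. *)
pose e := delta / (8 * (M + 1)).
pose r2 := delta / (64 * (b ^+ 2 + 1)).
have e0 : 0 < e by rewrite divr_gt0// mulr_gt0.
have r0 : 0 < r2 by rewrite divr_gt0// mulr_gt0.
have Me : M * e <= delta / 8.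
  have -> : M * e = M / (M + 1) * (delta / 8).
    by rewrite /e; field; rewrite gt_eqF.
  by rewrite ler_piMl ?divr_ge0 ?(ltW d0)// ler_pdivrMr// mul1r lerDl.
have br : b ^+ 2 * r2 <= delta / 64.
  have -> : b ^+ 2 * r2 = b ^+ 2 / (b ^+ 2 + 1) * (delta / 64).
    by rewrite /r2; field; rewrite gt_eqF.
  by rewrite ler_piMl ?divr_ge0 ?(ltW d0)// ler_pdivrMr// mul1r lerDl.
have [v' [y' [yt' [K hcomp]]]] := competitor hH hphi hlam0 hlam hBs hT0 hobsB
  hM hClin hCM w1 e0 y0X.
have [N rN] : exists N, `|pbar - psum phi (fun n => ip pbar (phi n)) N| ^+ 2 <= r2.
  have s0 : 0 < Num.sqrt r2 by rewrite sqrtr_gt0.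
  have := @cvg_psum_co _ _ _ _ hphi pbar.
  move=> /cvgrPdist_le/(_ _ s0)[N _ hN].
  exists N; rewrite -(sqr_sqrtr (ltW r0)) lerXn2r ?nnegrE ?sqrtr_ge0//.
  exact: hN (leqnn N).
set pN := psum phi _ N in rN; set r := pbar - pN in rN.
pose SK := \sum_(0 <= n < N) low_const lam b M T1 beta1 beta2 c n.
have SK0 : 0 <= SK by apply: sumr_ge0 => n _; exact: low_const_ge0.
(* Weight in Young's inequality for the modes below N: SK / kap <= 1 / 4, so that they use at most I
   / 4. *)
pose kap := 4 * SK + 1.
have kap0 : 0 < kap by rewrite ltr_wpDl// mulr_ge0.
pose E := 2 * (`|Lop (w0 - wbar)| ^+ 2 + `|w1| ^+ 2).
have E0 : 0 <= E by rewrite mulr_ge0// addr_ge0 ?sqr_ge0.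
pose K' := `|K| + e + `|pbar| ^+ 2 + kap * `|pbar| ^+ 2 + E + 8 * r2.
have K0 : 0 <= K'.
  by rewrite /K' !addr_ge0// ?(ltW e0) ?sqr_ge0// mulr_ge0 ?sqr_ge0// ltW.
pose Ts := T0 + T1 + 4 * K' / delta.
have h4 : 0 <= 4 * K' / delta by rewrite divr_ge0 ?(ltW d0)// mulr_ge0.
exists Ts => [|T hTs]; first by rewrite /Ts ltr_pwDl// addr_gt0.
have TT0 : T0 <= T by apply: le_trans hTs; rewrite /Ts -addrA lerDl addr_ge0// ltW.
have TT1 : T1 <= T.
  by apply: le_trans hTs; rewrite /Ts [T0 + _]addrC -addrA lerDl addr_ge0// ltW.
have T_gt0 : 0 < T := lt_le_trans hT0 TT0.
have KT : 4 * K' <= delta * T.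
  have : 4 * K' / delta <= T.
    by apply: le_trans hTs; rewrite /Ts lerDr addr_ge0// ltW.
  by rewrite ler_pdivrMr// [T * _]mulrC.
have [hv [wt [sol hle]]] := optimal_le T_gt0 (hopt T T_gt0).
split => //; exists wt => //.
have [c1 c2 c3 c4] := hcomp T TT0.
have {hle} := hle _ _ _ c1 c2.
have lowb n := low_mode hH hphi hlam0 hlam hB hBs hBb hM hClin hCM hT1 hc hobsC n TT1 hv sol.
set I := itg 0 T _ in lowb *; set I' := itg 0 T _ => hle.
have i1 := intg_vC hH hphi hM hClin hCM hv sol.
have I0 : 0 <= I by apply: itg_ge0 => t _; rewrite addr_ge0 ?sqr_ge0.
have Iv : itg 0 T (fun t => `|uT T t - ubar| ^+ 2) <= I.
  by apply: le_itg => //; [have [] := (L2P _ _).1 hv|move=> t _; rewrite lerDl sqr_ge0].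
have vel : `|wt T| ^+ 2 <= E + 2 * (b ^+ 2 * (T * I)).
  apply: (le_trans (velocity_bound hH hphi hlam0 hlam (ltW T_gt0) sol
    (fun psi => intg_ipB hH hBs psi hv) (intg_normB hB hBb hv))).
  rewrite lerD2l ler_wpM2l//; apply: (le_trans (itg_normB_le hB hBb hv (lexx 0) (ltW T_gt0))).
  by rewrite subr0 ler_wpM2l// ler_wpM2l// ltW.
have t1 : - (2 * ip (yt' T) pbar) <= e + `|pbar| ^+ 2.
  have := ip_young (- yt' T) pbar (ltr01 : 0 < (1 : R)).
  rewrite -scaleN1r ipZl normrZ normrN1 mul1r divr1 mul1r mulN1r mulrN => h.
  by apply: (le_trans h); rewrite lerD2r.
have t2 : 2 * ip (wt T) pN <= I / 4 + kap * `|pbar| ^+ 2.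
  rewrite ipC ip_psum mulr_sumr.
  apply: (@le_trans _ _ (\sum_(0 <= n < N) (low_const lam b M T1 beta1 beta2 c n * I / kap +
      kap * ip pbar (phi n) ^+ 2))).
    apply: ler_sum => n _; rewrite [ip pbar _ * _]mulrC.
    apply: (le_trans (young _ _ kap0)); rewrite lerD2r ler_wpM2r ?invr_ge0 ?(ltW kap0)//.
  rewrite big_split/= -mulr_sumr -!mulr_suml -/SK; apply: lerD; last first.
    by rewrite ler_wpM2l ?(ltW kap0)//; exact: bessel.
  rewrite ler_pdivrMr// mulrAC ler_pdivlMr//.
  by rewrite /kap; nra.
(* Weight for the tail of pbar. It grows linearly in T, like the coefficient of I in [vel]; hence at
   most E + I / 4 on one side, and on the other Dk * r2, linear in T with a small slope. *)
pose Dk := 8 * b ^+ 2 * T + 8.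
have Dk0 : 0 < Dk by rewrite /Dk ltr_wpDl// mulr_ge0 ?(ltW T_gt0)// mulr_ge0.
have t3 : 2 * ip (wt T) r <= E + I / 4 + Dk * r2.
  apply: (le_trans (ip_young _ _ Dk0)); apply: lerD; last by rewrite ler_wpM2l// ltW.
  rewrite ler_pdivrMr//; apply: (le_trans vel).
  have bT : 0 <= b ^+ 2 * T by rewrite mulr_ge0// ltW.
  have h1 : 0 <= E * (b ^+ 2 * T) by rewrite mulr_ge0.
  rewrite /Dk; nra.
have t4 : ip (wt T) pbar = ip (wt T) pN + ip (wt T) r.
  by rewrite -ipDr /r addrC subrK.
have Kn := ler_norm K.
have MeT : M * e * T <= delta / 8 * T by rewrite ler_wpM2r// ltW.
have brT : 8 * (b ^+ 2 * r2) * T <= delta / 8 * T.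
  by rewrite ler_wpM2r ?(ltW T_gt0)//; lra.
move: t1 t2 t3 c3 KT hle MeT brT; rewrite t4 /K' /Dk -/I'.
have -> : (8 * b ^+ 2 * T + 8) * r2 = 8 * (b ^+ 2 * r2) * T + 8 * r2 by ring.
have -> : delta / 8 * T = delta * T / 8 by rewrite mulrAC.
move: (M * e * T) (8 * (b ^+ 2 * r2) * T) (delta * T) => x1 x2 x3.
move: (kap * `|pbar| ^+ 2) (`|pbar| ^+ 2) => x4 x5.
move: Kn; move: (`|K|) => x6; lra.
Qed.

End Turnpike.

(** * The Bochner integral and the time average of a solution *)

Section Mean.
Context (R : realType) (H : completeNormedModType R) (ip : {dot H for idfun}).
Hypothesis hH : induces_norm ip.
Context (phi : nat -> H) (hphi : orthonormal_basis ip phi).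
Context (lam : nat -> R) (lam0 : R).
Hypotheses (hlam0 : 0 < lam0) (hlam : forall n, lam0 <= lam n).

Local Notation synth := (synth phi).
Local Notation Lop := (Lop ip phi lam).
Local Notation X12 := (X12 ip phi lam).
Local Notation wsol := (wsol ip phi lam).
Local Notation normX2 := (normX2 ip lam phi).
Local Notation mu := (@lebesgue_measure R).


Definition mpieces (s : seq (set R * H)) :=
  forall p, p \in s -> measurable (p.1 : set (measurableTypeR R)).

Lemma mpieces_cons p s : mpieces (p :: s) ->
  measurable (p.1 : set (measurableTypeR R)) /\ mpieces s.
Proof.
move=> h; split; first by apply: h; rewrite mem_head.
by move=> q qs; apply: h; rewrite inE qs orbT.
Qed.

Lemma intg_indic T (A : set R) : measurable (A : set (measurableTypeR R)) ->
  intg 0 T (fun t => \1_A t).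
Proof.
move=> mA; apply: (@intg_dom _ _ _ _ (fun=> 1)); last 2 first.
- exact: intg_cst.
- by move=> t _; rewrite indicE; case: (_ \in _); rewrite ?normr1 ?normr0.
- by have := measurable_indic (D := `[0, T]%classic : set (measurableTypeR R)) (R := R) mA.
Qed.

Lemma simple_co T s y : mpieces s ->
  intg 0 T (fun t => ip (simple_fun s t) y) /\
  itg 0 T (fun t => ip (simple_fun s t) y) = ip (simple_integral T s) y.
Proof.
elim: s => [|p s IH] => [_|/mpieces_cons[mp /IH[i1 e1]]].
  have E : {in `[0, T], cst 0 =1 (fun t => ip (@simple_fun _ H [::] t) y)}.
    by move=> t _; rewrite /simple_fun big_nil ip0l.
  split; first by apply: eq_intg E _; exact: intg_cst.
  rewrite -(eq_itg E) /simple_integral big_nil ip0l.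
  by rewrite /itg /Rintegral integral0.
have i2 := intgZ (ip p.2 y) (intg_indic T mp).
have E : {in `[0, T], (fun t => ip p.2 y * \1_(p.1) t + ip (simple_fun s t) y) =1
    (fun t => ip (simple_fun (p :: s) t) y)}.
  by move=> t _; rewrite /simple_fun big_cons ipDl ipZl mulrC.
split; first by apply: (eq_intg E); exact: intgD.
rewrite -(eq_itg E) itgD// e1 (itgZ _ (intg_indic T mp)).
rewrite /simple_integral big_cons ipDl ipZl mulrC; congr (_ * _ + _).
rewrite /itg /Rintegral; congr fine; rewrite setIC.
by rewrite (integral_indic mu (mitv 0 T) mp).
Qed.

Lemma bmeasurable_sub_simple T u s : bmeasurable T u -> mpieces s ->
  bmeasurable T (fun t => u t - simple_fun s t).
Proof.
elim: s u => [|p s IH] u mu_ => [_|/mpieces_cons[mp ms]].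
  by have -> : (fun t => u t - simple_fun [::] t) = u
    by apply/funext => t; rewrite /simple_fun big_nil subr0.
have -> : (fun t => u t - simple_fun (p :: s) t) =
    (fun t => if t \in p.1 then (u t - p.2) - simple_fun s t else u t - simple_fun s t).
  apply/funext => t; rewrite /simple_fun big_cons indicE.
  by case: ifP => _; rewrite ?scale1r ?scale0r ?add0r// opprD addrA.
have mu2 : bmeasurable T (fun t => u t - p.2).
  apply: (bmeasurable_comp (g := fun x => x - p.2) mu_) => x.
  by apply: cvgB; [exact: cvg_id|exact: cvg_cst].
apply: measurable_fun_if => //.
- apply: (measurable_fun_bool true).
  rewrite (_ : _ @^-1` _ = p.1); first by apply: measurableI => //; exact: mitv.
  by apply/seteqP; split => t /=; [move=> /set_mem|move=> /mem_set].
- apply: measurable_funS (IH _ mu2 ms) => //; exact: mitv.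
- apply: measurable_funS (IH _ mu_ ms) => //; exact: mitv.
Qed.

Lemma norm_phi n : `|phi n| = 1.
Proof.
apply/eqP; rewrite -(@eqrXn2 _ 2)// -hH ip_phi// eqxx expr1n//.
Qed.

(** Coordinates commute with the integral of simple functions, hence with its L^1 limits. In
    particular the value does not depend on the approximating sequence. *)
Lemma bochner_co T y v n : is_bochner_integral T y v ->
  intg 0 T (fun t => ip (y t) (phi n)) ->
  ip v (phi n) = itg 0 T (fun t => ip (y t) (phi n)).
Proof.
move=> [my [s [ms es vs]]] iy.
have c1 : ip (simple_integral T (s k)) (phi n) @[k --> \oo] --> ip v (phi n).
  by apply: (cvg_ip hH); exact: vs.
have c2 : ip (simple_integral T (s k)) (phi n) @[k --> \oo] -->
    itg 0 T (fun t => ip (y t) (phi n)).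
  apply/cvgrPdist_le => e e0.
  move/fine_cvgP : es => [es1 /cvgrPdist_le/(_ _ e0) es2].
  move: es1 es2; apply: filterS2 => k fin; rewrite /= sub0r normrN => le.
  have [i1 e1] := simple_co T (phi n) (ms k).
  have md := bmeasurable_sub_simple my (ms k).
  have idf : intg 0 T (fun t => `|y t - simple_fun (s k) t|).
    apply/integrableP; split.
      apply/measurable_EFinP.
      by apply: (bmeasurable_real (g := fun x => `|x|) md); exact: norm_continuous_H.
    under eq_integral do rewrite /= normr_id.
    by rewrite ltey_eq fin.
  rewrite -e1 -itgB//; apply: (le_trans (norm_itg (intgB iy i1))).
  apply: le_trans le; apply: le_trans (ler_norm _).
  apply: le_itg => //; first exact/intg_norm/intgB.
  move=> t _; rewrite -ipBl; apply: (le_trans (cauchy_schwarz hH _ _)).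
  by rewrite norm_phi mulr1.
exact: (cvg_unique _ c1 c2).
Qed.

(** Values at left ends of a uniform subdivision. The pieces are half open, so one more, starting at
    T, is added to cover T itself. *)
Definition grid (T : R) (y : R -> H) (N : nat) : seq (set R * H) :=
  [seq (`[i%:R * (T / N.+1%:R), i.+1%:R * (T / N.+1%:R)[%classic,
        y (i%:R * (T / N.+1%:R))) | i <- iota 0 N.+2].

Lemma mpieces_grid T y N : mpieces (grid T y N).
Proof. by move=> _ /mapP[i _ ->] /=; exact: measurable_itv. Qed.

Lemma grid_close T y N K t : 0 < T -> 0 <= K ->
  (forall s t, 0 <= s -> s <= t -> t <= T -> `|y t - y s| <= K * (t - s)) ->
  0 <= t -> t <= T -> `|y t - simple_fun (grid T y N) t| <= K * (T / N.+1%:R).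
Proof.
move=> T0 K0 lip t0 tT; set h := T / N.+1%:R.
have h0 : 0 < h by rewrite divr_gt0.
have th0 : 0 <= t / h by rewrite divr_ge0// ltW.
have /andP[t1 t2] := Num.Theory.truncn_itv th0.
set i0 := Num.truncn (t / h) in t1 t2.
have i0N : (i0 < N.+2)%N.
  rewrite ltnS -(@ler_nat R); apply: (le_trans t1); rewrite ler_pdivrMr//.
  by rewrite /h mulrC divfK// gt_eqF.
have -> : simple_fun (grid T y N) t = y (i0%:R * h).
  rewrite /simple_fun /grid big_map (bigD1_seq i0) ?iota_uniq ?mem_iota//=.
  rewrite -/h big1 ?addr0.
    rewrite indicE mem_set ?scale1r//= in_itv/=.
    by rewrite -ler_pdivlMr// -ltr_pdivrMr// t1.
  move=> i ii; rewrite indicE memNset ?scale0r//= in_itv/=.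
  rewrite -ler_pdivlMr// -ltr_pdivrMr// => it.
  by move/eqP : ii; apply; rewrite /i0 (Num.Theory.truncn_def it).
have s1 : i0%:R * h <= t by rewrite -ler_pdivlMr.
apply: (le_trans (lip _ _ _ s1 tT)); first by rewrite mulr_ge0// ltW.
rewrite ler_wpM2l// lerBlDl; apply/ltW; move: t2.
by rewrite ltr_pdivrMr// -natr1 mulrDl mul1r.
Qed.

(** [bochner_integral] is a choice, informative only once an integral exists. The Lipschitz bound
    makes the step functions on [grid] converge uniformly; the candidate is given by its
    coordinates, and [minkowski_modes] with all multipliers equal to 1 turns L^1 convergence into
    convergence of the integrals in H. *)
Lemma bochner_exists T (y : R -> H) K : 0 < T -> 0 <= K -> {within `[0, T], continuous y} ->
  (forall s t, 0 <= s -> s <= t -> t <= T -> `|y t - y s| <= K * (t - s)) ->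
  exists v, is_bochner_integral T y v.
Proof.
move=> T0 K0 cy lip.
have my := bmeasurable_cont cy.
have iy n : intg 0 T (fun t => ip (y t) (phi n)).
  by apply: intg_cont; exact: (cw_ip hH).
have iny : intg 0 T (fun t => `|y t|).
  by apply: intg_cont => t; apply: cvg_norm; exact: cy.
pose err N : R := K * (T / N.+1%:R) * T.
have cerr : err N @[N --> \oo] --> (0 : R).
  have -> : err = (fun N => N.+1%:R^-1 * (K * T * T)).
    by apply/funext => N; rewrite /err; ring.
  rewrite -(mul0r (K * T * T)); apply: cvgM; last exact: cvg_cst.
  exact: cvg_harmonic.
have idf N : intg 0 T (fun t => `|y t - simple_fun (grid T y N) t|).
  apply: (@intg_dom _ _ _ _ (fun=> K * (T / N.+1%:R))).
  - apply: (bmeasurable_real (g := fun x => `|x|)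
      (bmeasurable_sub_simple my (@mpieces_grid T y N))).
    exact: norm_continuous_H.
  - exact: intg_cst.
  - by move=> t; rewrite in_itv/= normr_id => /andP[t0 tT]; exact: grid_close.
have ile N : itg 0 T (fun t => `|y t - simple_fun (grid T y N) t|) <= err N.
  have -> : err N = itg 0 T (cst (K * (T / N.+1%:R))).
    by rewrite itg_cst ?(ltW T0)// subr0.
  apply: le_itg => //; first exact: intg_cst.
  by move=> t; rewrite in_itv/= => /andP[t0 tT]; exact: grid_close.
have i1 n : intg 0 T (fun t => 1 * ip (y t) (phi n)) by exact: intgZ.
have E1 n : itg 0 T (fun t => 1 * ip (y t) (phi n)) = itg 0 T (fun t => ip (y t) (phi n)).
  by apply: eq_itg => t _; rewrite mul1r.
have sq : sqs (fun n => itg 0 T (fun t => ip (y t) (phi n))).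
  exists (itg 0 T (fun t => `|y t|) ^+ 2) => N.
  have := @minkowski_modes _ _ _ hH _ hphi 0 T y (fun _ _ => 1) N (ltW T0) iny i1
    (fun _ _ => ltac:(by rewrite normr1)).
  by apply: le_trans; apply: ler_sum => n _; rewrite E1.
exists (synth (fun n => itg 0 T (fun t => ip (y t) (phi n)))); split => //.
exists (grid T y); split.
- by move=> N p; exact: mpieces_grid.
- apply/fine_cvgP; split.
    by apply: nearW => N; exact: (integrable_fin_num (mitv 0 T) (idf N)).
  apply: (@squeeze_cvgr _ _ _ _ (cst 0) err) => //; last exact: cvg_cst.
  apply: nearW => N; rewrite /= -[fine _]/(itg 0 T (fun t => `|y t - simple_fun (grid T y N) t|)).
  by rewrite ile itg_ge0.
- apply/cvgrPdist_le => e e0; move/cvgrPdist_le : cerr => /(_ _ e0).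
  apply: filterS => N; rewrite sub0r normrN => le.
  apply: le_trans le; apply: le_trans (ler_norm _); apply: le_trans (ile N).
  rewrite -(@ler_pXn2r _ 2) ?nnegrE ?itg_ge0//; apply: (norm2_le hH hphi) => m.
  have i2 n : intg 0 T (fun t => 1 * ip (y t - simple_fun (grid T y N) t) (phi n)).
    have [j1 _] := simple_co T (phi n) (@mpieces_grid T y N).
    by apply: eq_intg (intgB (iy n) j1) => t _; rewrite mul1r ipBl.
  have := @minkowski_modes _ _ _ hH _ hphi 0 T (fun t => y t - simple_fun (grid T y N) t)
    (fun _ _ => 1) m (ltW T0) (idf N) i2 (fun _ _ => ltac:(by rewrite normr1)).
  apply: le_trans; apply: ler_sum => n _.
  have [j1 j2] := simple_co T (phi n) (@mpieces_grid T y N).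
  rewrite ipBl (co_synth hH hphi)// -j2 -itgB//.
  rewrite le_eqVlt; apply/orP; left; apply/eqP; congr (_ ^+ 2).
  by apply: eq_itg => t _; rewrite mul1r ipBl.
Qed.

(** The increment of w is the integral of wt, read on each mode and summed by [minkowski_modes]; K
    is the maximum of |wt| on [0, T]. *)
Lemma wsol_lipschitz T f w0 w1 w wt : 0 < T -> wsol T f w0 w1 w wt ->
  (forall psi, intg 0 T (fun s => ip (f s) psi)) ->
  exists2 K, 0 <= K & forall s t, 0 <= s -> s <= t -> t <= T ->
    `|w t - w s| <= K * (t - s).
Proof.
move=> T0 sol hf; have [_ _ _ cwt _] := sol.
have cn : {within `[0, T], continuous (fun t => `|wt t|)}.
  by move=> t; apply: cvg_norm; exact: cwt.
have [r _ hr] := EVT_max (ltW T0) cn.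
exists `|wt r| => // s t s0 st tT.
have sub : `[s, t]%classic `<=` `[0, T]%classic.
  move=> x /=; rewrite !in_itv/= => /andP[h1 h2].
  by rewrite (le_trans s0 h1) (le_trans h2 tT).
have in_ : intg s t (fun t => `|wt t|) by apply: intg_cont; exact: (continuous_subspaceW sub cn).
have ble : itg s t (fun t => `|wt t|) <= `|wt r| * (t - s).
  rewrite -itg_cst//; apply: le_itg => //; first exact: intg_cst.
  by move=> x xst; apply: hr; exact: (sub x xst).
rewrite -(@ler_pXn2r _ 2) ?nnegrE ?mulr_ge0 ?subr_ge0//.
apply: (norm2_le hH hphi) => N.
apply: (@le_trans _ _ (itg s t (fun t => `|wt t|) ^+ 2)); last first.
  by rewrite lerXn2r ?nnegrE ?itg_ge0// mulr_ge0 ?subr_ge0.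
have modes n := wsol_modes hH hphi (lam_gt0 hlam0 hlam) sol (hf (phi n)).
have i1 n : intg s t (fun x => 1 * ip (wt x) (phi n)).
  apply: intgZ; apply: intg_cont; apply: continuous_subspaceW sub _.
  by have [_ h _ _] := modes n.
have := @minkowski_modes _ _ _ hH _ hphi s t wt (fun _ _ => 1) N st in_ i1
  (fun _ _ => ltac:(by rewrite normr1)).
apply: le_trans; apply: ler_sum => n _.
rewrite le_eqVlt; apply/orP; left; apply/eqP; congr (_ ^+ 2).
rewrite ipBl; have [c1 c2 d _] := modes n.
have d' x : x \in `]s, t[ ->
    is_derive x (1 : R) (fun u => ip (w u) (phi n)) (ip (wt x) (phi n)).
  rewrite in_itv/= => /andP[h1 h2]; apply: d.
  by rewrite in_itv/= (le_lt_trans s0 h1) (lt_le_trans h2 tT).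
have <- := ftc2 st (continuous_subspaceW sub c1) (continuous_subspaceW sub c2) d'.
by apply: eq_itg => x _; rewrite mul1r.
Qed.

Lemma wsol_continuous T f w0 w1 w wt : 0 < T -> wsol T f w0 w1 w wt ->
  (forall psi, intg 0 T (fun s => ip (f s) psi)) -> {within `[0, T], continuous w}.
Proof.
move=> T0 sol hf; have [K K0 lip] := wsol_lipschitz T0 sol hf.
apply/subspace_continuousP => t tT; apply/cvgrPdist_lt => e e0.
have d0 : 0 < e / (K + 1) by rewrite divr_gt0// ltr_wpDl.
rewrite near_withinE; exists (e / (K + 1)) => //= s ts sT.
have K1 : 0 < K + 1 by rewrite ltr_wpDl.
move: tT sT; rewrite /= !in_itv/= => /andP[t0 tT] /andP[s0 sT].
have h : `|w t - w s| <= K * `|t - s|.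
  have [st|/ltW st] := leP s t; first by rewrite (ger0_norm (x := t - s)) ?subr_ge0//; exact: lip.
  by rewrite distrC (distrC t) (ger0_norm (x := s - t)) ?subr_ge0//; exact: lip.
apply: (le_lt_trans h); move: ts => /=; rewrite ltr_pdivlMr// => ts.
by apply: le_lt_trans ts; rewrite mulrC ler_wpM2l// lerDl.
Qed.

(** In the mode n the integrated equation is divided by lam_n^2. Squared and weighted by the lam_n^2
    of the X_{1/2} norm, this leaves lam_n^-2 <= lam0^-2; the 3 comes from the square of a sum of
    three terms. *)
Lemma mean_bound T f w0 w1 w wt : 0 < T -> wsol T f w0 w1 w wt ->
  (forall psi, intg 0 T (fun s => ip (f s) psi)) -> intg 0 T (fun s => `|f s|) ->
  (normX2 (1 / 2) (T^-1 *: bochner_integral T w) <=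
   (3 * lam0 ^- 2 * T ^- 2 * (`|w1| ^+ 2 + `|wt T| ^+ 2 +
     itg 0 T (fun s => `|f s|) ^+ 2))%:E)%E.
Proof.
move=> T0 sol hf hn.
have [K K0 lip] := wsol_lipschitz T0 sol hf.
have cw := wsol_continuous T0 sol hf.
have bex := bochner_exists T0 K0 cw lip.
have bm : is_bochner_integral T w (bochner_integral T w) by apply: getPex.
apply/normX2_leP => N.
have iw n : intg 0 T (fun t => ip (w t) (phi n)).
  by apply: intg_cont; exact: (cw_ip hH).
have i1 n : intg 0 T (fun t => 1 * ip (f t) (phi n)) by exact: intgZ.
have mk := @minkowski_modes _ _ _ hH _ hphi 0 T f (fun _ _ => 1) N (ltW T0) hn i1
  (fun _ _ => ltac:(by rewrite normr1)).
have b1 := bessel hH hphi w1 N; have b2 := bessel hH hphi (wt T) N.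
set Q := itg 0 T (fun s => `|f s|) in mk *.
have c0 : 0 <= 3 * lam0 ^- 2 * T ^- 2.
  by rewrite !mulr_ge0// invr_ge0 sqr_ge0.
apply: (@le_trans _ _ (3 * lam0 ^- 2 * T ^- 2 * (\sum_(0 <= n < N) ip w1 (phi n) ^+ 2 +
   \sum_(0 <= n < N) ip (wt T) (phi n) ^+ 2 +
   \sum_(0 <= n < N) itg 0 T (fun t => 1 * ip (f t) (phi n)) ^+ 2))); last first.
  by rewrite ler_wpM2l// lerD// lerD.
rewrite -!big_split/= mulr_sumr; apply: ler_sum => n _.
rewrite (powR_half (lam_gt0 hlam0 hlam)) ipZl (bochner_co bm (iw n)).
have [_ _ _ hv] := wsol_modes hH hphi (lam_gt0 hlam0 hlam) sol (hf (phi n)).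
have := hv T; rewrite in_itv/= (ltW T0) lexx => /(_ isT).
rewrite itgB//; last exact: intgZ.
rewrite (itgZ _ (iw n)); set m := itg 0 T (fun t => ip (w t) (phi n)).
have -> : itg 0 T (fun t => 1 * ip (f t) (phi n)) = itg 0 T (fun t => ip (f t) (phi n)).
  by apply: eq_itg => t _; rewrite mul1r.
set F := itg 0 T (fun t => ip (f t) (phi n)) => E.
have l0 := lam_gt0 hlam0 hlam n.
have mE : m = (ip w1 (phi n) - ip (wt T) (phi n) + F) / lam n ^+ 2.
  by rewrite E; field; rewrite gt_eqF.
have -> : lam n ^+ 2 * (T^-1 * m) ^+ 2 =
    lam n ^- 2 * (T ^- 2 * (ip w1 (phi n) - ip (wt T) (phi n) + F) ^+ 2).
  by rewrite mE; field; rewrite !gt_eqF.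
have -> : 3 * lam0 ^- 2 * T ^- 2 * (ip w1 (phi n) ^+ 2 + ip (wt T) (phi n) ^+ 2 + F ^+ 2) =
   lam0 ^- 2 * (T ^- 2 * (3 * (ip w1 (phi n) ^+ 2 + ip (wt T) (phi n) ^+ 2 + F ^+ 2))).
  by ring.
apply: ler_pM.
- by rewrite invr_ge0 sqr_ge0.
- by rewrite mulr_ge0 ?invr_ge0 ?sqr_ge0.
- rewrite lef_pV2 ?posrE ?exprn_gt0//.
  by rewrite lerXn2r ?nnegrE ?(ltW l0) ?(ltW hlam0).
rewrite ler_wpM2l ?invr_ge0 ?sqr_ge0//.
move: (ip w1 _) (ip (wt T) _) (F) => x1 x2 x3.
have := sqr_ge0 (x1 + x2); have := sqr_ge0 (x1 - x3); have := sqr_ge0 (x2 + x3); nra.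
Qed.

End Mean.

(** * The inverse of A and the stationary optimality condition *)

Section Stationary.
Context (R : realType) (H : completeNormedModType R) (ip : {dot H for idfun}).
Hypothesis hH : induces_norm ip.
Context (phi : nat -> H) (hphi : orthonormal_basis ip phi).
Context (lam : nat -> R) (lam0 : R).
Hypotheses (hlam0 : 0 < lam0) (hlam : forall n, lam0 <= lam n).
Context (D : set H) (A : H -> H).
Hypotheses (hD : linear_subspace D) (hAlin : linear_on D A).
Hypotheses (hAsa : self_adjoint ip D A) (heig : eigenpairs D A lam phi).

Local Notation X12 := (X12 ip phi lam).
Local Notation Lop := (Lop ip phi lam).

Lemma co_A x n : D x -> ip (A x) (phi n) = lam n ^+ 2 * ip x (phi n).
Proof.
move=> Dx; have [_ sym _] := hAsa; have [_ Dn An] := heig n.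
by rewrite sym// An ipZr.
Qed.

Lemma D_X12 x : D x -> X12 x.
Proof.
move=> Dx; apply: (sqs_bound (sqs_co hH hphi (A x)) (k := lam0^-1)) => n.
rewrite co_A// expr2 -mulrA [in leRHS]normrM mulrA.
have l0 := lam_gt0 hlam0 hlam n.
rewrite ler_peMl// (gtr0_norm l0) -(ler_pM2l hlam0) mulrA mulfV ?gt_eqF//.
by rewrite mul1r mulr1.
Qed.

Definition invA (g : H) := synth phi (fun n => ip g (phi n) / lam n ^+ 2).

Lemma co_invA g n : ip (invA g) (phi n) = ip g (phi n) / lam n ^+ 2.
Proof.
apply: (co_synth hH hphi).
apply: (sqs_bound (sqs_co hH hphi g) (k := lam0 ^- 2)) => i.
have l0 := lam_gt0 hlam0 hlam i.
rewrite normrM mulrC ler_wpM2r// ger0_norm ?invr_ge0 ?sqr_ge0//.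
rewrite lef_pV2 ?posrE ?exprn_gt0//.
by rewrite lerXn2r ?nnegrE ?(ltW l0) ?(ltW hlam0).
Qed.

(** The maximality of the domain in [self_adjoint]: by Parseval, ip (A x) (invA g) = ip x g for
    every x in D, which forces [invA g] into D. *)
Lemma D_invA g : D (invA g).
Proof.
have [_ _ dom] := hAsa; apply: (dom _ g) => x Dx.
have c1 := @cvg_parseval _ _ _ hH _ hphi (A x) (invA g).
have c2 : \sum_(0 <= n < N) ip (A x) (phi n) * ip (invA g) (phi n) @[N --> \oo] --> ip x g.
  have E N : \sum_(0 <= n < N) ip (A x) (phi n) * ip (invA g) (phi n) =
      \sum_(0 <= n < N) ip x (phi n) * ip g (phi n).
    apply: eq_bigr => n _; rewrite co_A// co_invA; field.
    by rewrite gt_eqF// (lam_gt0 hlam0 hlam).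
  by under eq_fun do rewrite E; exact: (@cvg_parseval _ _ _ hH _ hphi x g).
exact: (cvg_unique _ c1 c2).
Qed.

Lemma invAK g : A (invA g) = g.
Proof.
apply: (co_inj hH hphi) => n; rewrite (co_A _ (D_invA g)) co_invA; field.
by rewrite gt_eqF// (lam_gt0 hlam0 hlam).
Qed.

Context (B : {linear H -> H}) (C : H -> H).
Hypothesis hClin : linear_on X12 C.

(* First-order optimality along (invA (B h), h). *)
Lemma stationary_control z wbar ubar pbar h :
  stationary_optimal D A B C z wbar ubar -> X12 pbar ->
  (forall x, X12 x -> ip (C wbar - z) (C x) = ip (Lop pbar) (Lop x)) ->
  ip ubar h = - ip pbar (B h).
Proof.
move=> [Dw Aw hmin] pX hp; set w' := invA (B h).
have wX := D_X12 Dw; have w'X := D_X12 (D_invA (B h)).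
have [_ Dlin] := hD.
have s0 : ip ubar h + ip (C wbar - z) (C w') = 0.
  apply: (@quadratic_ge0 _ _ (`|h| ^+ 2 + `|C w'| ^+ 2)).
    by rewrite addr_ge0 ?sqr_ge0.
  move=> a; have := hmin (a *: w' + wbar) (a *: h + ubar).
  rewrite hAlin//; last exact: D_invA.
  rewrite invAK Aw linearP hClin// => /(_ (Dlin _ _ _ (D_invA _) Dw) erefl).
  rewrite -addrA !(norm2D hH (a *: _)) !ipZl !normrZ !exprMn !real_normK ?num_real//.
  by rewrite (ipC ip h) (ipC ip (C w')) => hh; lra.
(* By the adjoint equation and [Lop_weak], since A w' = B h, the pairing of C wbar - z with C w' is
   ip pbar (B h). *)
apply/eqP; rewrite -addr_eq0 -s0; apply/eqP; congr (_ + _).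
rewrite hp// (ipC ip (Lop pbar)) (Lop_weak hH hphi (g := B h) w'X _ pX) ?(ipC ip pbar)// => n.
by rewrite co_invA; field; rewrite gt_eqF// (lam_gt0 hlam0 hlam).
Qed.

End Stationary.

(** * Passage to the limit and the theorem *)

Lemma cvg_pinfty_ereal0 (R : realType) (F : R -> \bar R) :
  (forall e, 0 < e -> exists Ts, forall T, Ts <= T -> (0 <= F T <= e%:E)%E) ->
  F T @[T --> +oo] --> 0%E.
Proof.
move=> h; have near_ e : 0 < e -> \forall T \near +oo, (0 <= F T <= e%:E)%E.
  by move=> /h[Ts hTs]; near=> T; apply: hTs; near: T; apply: nbhs_pinfty_ge; exact: num_real.
apply/fine_cvgP; split.
  apply: filterS (near_ 1 ltr01) => T /andP[F0 F1].
  by rewrite ge0_fin_numE// (le_lt_trans F1)// ltry.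
apply/cvgrPdist_le => e /near_; apply: filterS => T /andP[F0 Fe] /=.
rewrite sub0r normrN ger0_norm ?fine_ge0// -lee_fin fineK//.
by rewrite ge0_fin_numE// (le_lt_trans Fe)// ltry.
Unshelve. all: by end_near. Qed.

Lemma linear_bound (R : realType) (H : completeNormedModType R) (B : {linear H -> H}) :
  continuous B -> exists b, forall x, `|B x| <= b * `|x|.
Proof.
move=> /linear_bounded_continuous/linear_boundedP[r [_ hr]].
by exists (r + 1) => x; apply: hr; rewrite ltrDl ltr01.
Qed.

Theorem theorem2p2 (R : realType) (H : completeNormedModType R)
  (ip : {dot H for idfun}) (hH : induces_norm ip)
  (D : set H) (A : H -> H)
  (hD : linear_subspace D) (hAlin : linear_on D A) (hAsa : self_adjoint ip D A)
  (hApos : strictly_positive ip D A) (hAcpt : compact_resolvent D A)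
  (lam : nat -> R) (phi : nat -> H)
  (heig : eigenpairs D A lam phi) (hbasis : orthonormal_basis ip phi)
  (B : {linear H -> H}) (hB : continuous B)
  (Bs : H -> H) (hBs : adjoint_of ip B Bs)
  (C : H -> H) (hClin : linear_on (X ip lam phi (1 / 2)) C)
  (hC : boundedX ip lam phi (1 / 2) C)
  (rho eta T0 T1 c : R)
  (hrho : 0 < rho) (heta : 0 < eta) (hT0 : 0 < T0) (hT1 : 0 < T1) (hc : 0 < c)
  (hobsB : forall (w0 w1 : H) (w wt : R -> H),
     wave_solution ip lam phi T0 (fun=> 0) w0 w1 w wt ->
     (normX2 ip lam phi (1 / 2 - 1 / (2 * rho)) w0
        + normX2 ip lam phi (- (1 / (2 * rho))) w1
      <= c%:E * \int[lebesgue_measure]_(t in `[0%R, T0]) (`|Bs (wt t)| ^+ 2)%:E)%E)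
  (hobsC : forall (w0 w1 : H) (w wt : R -> H),
     wave_solution ip lam phi T1 (fun=> 0) w0 w1 w wt ->
     (normX2 ip lam phi (1 / 2 - 1 / (2 * eta)) w0
        + normX2 ip lam phi (- (1 / (2 * eta))) w1
      <= c%:E * \int[lebesgue_measure]_(t in `[0%R, T1]) (`|C (w t)| ^+ 2)%:E)%E)
  (z w0 w1 : H) (wT uT : R -> R -> H)
  (hopt : forall T, 0 < T -> optimal ip lam phi B C z w0 w1 T (wT T) (uT T))
  (wbar ubar : H) (hbar : stationary_optimal D A B C z wbar ubar)
  (pbar : H) (hpbarX : X ip lam phi (1 / 2) pbar)
  (hpbar : eq_Xminus ip lam phi (Aext ip lam phi pbar) (Cstar ip C (C wbar - z)))
  (k : R) (hk : 0 < k) (hdata : domain_pow ip lam phi k (w0 - wbar) w1)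
  (ktilde : R) (hktilde : 1 <= ktilde)
  (hpbark : X ip lam phi ((ktilde + 1) / 2) pbar) :
  ((T^-1)%:E * \int[lebesgue_measure]_(t in `[0%R, T])
      (`|C (wT T t - wbar)| ^+ 2 + `|uT T t - ubar| ^+ 2)%:E)%E
    @[T --> +oo] --> 0%E
  /\
  normX2 ip lam phi (1 / 2)
      (T^-1 *: bochner_integral T (fun t => wT T t - wbar))
    @[T --> +oo] --> 0%E.

Proof.
have [m m0 hm] := hApos.
(* Strict positivity tested on phi_n gives m <= lam_n^2: the frequencies are uniformly bounded away
   from 0. *)
have hlam n : Num.sqrt m <= lam n.
  have [l0 Dn An] := heig n.
  rewrite -(@ler_pXn2r _ 2) ?nnegrE ?sqrtr_ge0 ?(ltW l0)// sqr_sqrtr ?(ltW m0)//.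
  have := hm _ Dn; rewrite An ipZl -hH (ip_phi hbasis) eqxx /=.
  by rewrite !mulr1.
set lam0 := Num.sqrt m in hlam.
have hlam0 : 0 < lam0 by rewrite sqrtr_gt0.
have lamP := lam_gt0 hlam0 hlam.
have [b hb] := linear_bound hB.
have hClin' : linear_on (X12 ip phi lam) C.
  by move=> a x y xX yX; apply: hClin; apply/(X12P ip phi lamP).
have [M' hM'] := hC.
(* [boundedX] leaves the sign of its constant free; the absolute value is a nonnegative bound. *)
pose M := `|M'|; have hM : 0 <= M by exact: normr_ge0.
have hCM x : X12 ip phi lam x -> `|C x| ^+ 2 <= M * `|Lop ip phi lam x| ^+ 2.
  move=> xX; have := hM' x ((X12P ip phi lamP x).2 xX).
  rewrite (normX2_half hH hbasis lamP xX) -EFinM lee_fin => h.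
  by apply: (le_trans h); rewrite ler_wpM2r ?sqr_ge0// ler_norm.
have [Dw Aw _] := hbar.
have wbarX := D_X12 hH hbasis hlam0 hlam hAsa heig Dw.
have wbarE n : lam n ^+ 2 * ip wbar (phi n) = ip (B ubar) (phi n).
  by rewrite -Aw (co_A hAsa heig).
have pbarX := (X12P ip phi lamP pbar).1 hpbarX.
have pbarE x : X12 ip phi lam x ->
    ip (C wbar - z) (C x) = ip (Lop ip phi lam pbar) (Lop ip phi lam x).
  move=> xX; rewrite -(dotX_half hH hbasis lamP pbarX xX); symmetry.
  by apply: hpbar; apply/(X12P ip phi lamP).
have ubarE h := stationary_control hH hbasis hlam0 hlam hD hAlin hAsa heig
  hClin' h hbar pbarX pbarE.
(* Membership of w0 in X_{1/2} is read off the optimal state on the horizon 1, of which it is the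
   initial value. *)
have y0X : X12 ip phi lam (w0 - wbar).
  apply: X12B => //; have [[_ [wt sol]] _] := hopt 1 ltr01.
  have [[<- _] h _ _ _] := sol.
  by have [/(X12P ip phi lamP) ? _] := h 0 ltac:(by rewrite in_itv/= lexx ler01).
have tp delta (d0 : 0 < delta) := turnpike hH hbasis hlam0 hlam hB hBs hb hM hClin' hCM
  hT0 hT1 hc hobsB hobsC wbarX pbarX wbarE ubarE pbarE d0 y0X hopt.
split.
  apply: cvg_pinfty_ereal0 => e e0; have [Ts Ts0 hTs] := tp e e0.
  exists Ts => T TsT; have [hv [wt sol le]] := hTs T TsT.
  have T0' : 0 < T := lt_le_trans Ts0 TsT.
  have i1 := intg_vC hH hbasis hM hClin' hCM hv sol.
  have EI : (\int[lebesgue_measure]_(t in `[0%R, T])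
      (`|C (wT T t - wbar)| ^+ 2 + `|uT T t - ubar| ^+ 2)%:E)%E =
      (itg 0 T (fun t => `|uT T t - ubar| ^+ 2 + `|C (wT T t - wbar)| ^+ 2))%:E.
    by rewrite -itg_EFin//; apply: eq_integral => t _; rewrite addrC.
  rewrite EI -EFinM !lee_fin mulr_ge0 ?invr_ge0 ?(ltW T0')//=; last first.
    by apply: itg_ge0 => t _; rewrite addr_ge0 ?sqr_ge0.
  by rewrite mulrC ler_pdivrMr.
apply: cvg_pinfty_ereal0 => e e0.
pose K := 3 * lam0 ^- 2.
have K0 : 0 < K by rewrite mulr_gt0// invr_gt0 exprn_gt0.
pose E := `|w1| ^+ 2 + 2 * (`|Lop ip phi lam (w0 - wbar)| ^+ 2 + `|w1| ^+ 2).
have E0 : 0 <= E by rewrite /E !addr_ge0 ?sqr_ge0// mulr_ge0// addr_ge0 ?sqr_ge0.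
have b0 : 0 < b ^+ 2 + 1 by rewrite ltr_wpDl ?sqr_ge0.
(* The squared integral of |B v| enters once directly and twice through the velocity, hence the 3 in
   [bd]. This [delta] keeps that part below e / 2; for the data, T >= 1 and 2 K E <= e T leave the
   other half. *)
pose delta := e / (6 * K * (b ^+ 2 + 1)).
have d0 : 0 < delta by rewrite divr_gt0// mulr_gt0// mulr_gt0.
have [Ts Ts0 hTs] := tp delta d0.
exists (Ts + 1 + 2 * K * E / e) => T hT.
have q0 : 0 <= 2 * K * E / e by rewrite divr_ge0 ?(ltW e0)// mulr_ge0// mulr_ge0// (ltW K0).
have TsT : Ts <= T by apply: le_trans hT; rewrite -addrA lerDl addr_ge0.
have T1' : 1 <= T.
  by apply: le_trans hT; rewrite addrAC lerDr addr_ge0// (ltW Ts0).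
have TE : 2 * K * E <= e * T.
  have : 2 * K * E / e <= T by apply: le_trans hT; rewrite lerDr addr_ge0// (ltW Ts0).
  by rewrite ler_pdivrMr// [T * _]mulrC.
have T0' : 0 < T := lt_le_trans Ts0 TsT.
have [hv [wt sol le]] := hTs T TsT.
have fi psi := intg_ipB hH hBs psi hv.
have fn := intg_normB hB hb hv.
have mb := mean_bound hH hbasis hlam0 hlam T0' sol fi fn.
have vb := velocity_bound hH hbasis hlam0 hlam (ltW T0') sol fi fn.
have nb := itg_normB_le hB hb hv (lexx 0) (ltW T0').
rewrite normX2_ge0/=; apply: (le_trans mb); rewrite lee_fin.
set Q := itg 0 T (fun s => `|(B \o _) s|) in vb nb *.
have [_ iv] := (L2P _ _).1 hv.
have Q2 : Q ^+ 2 <= b ^+ 2 * delta * T ^+ 2.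
  apply: (le_trans nb); rewrite subr0 -mulrA ler_wpM2l ?sqr_ge0//.
  rewrite expr2 mulrCA ler_wpM2l ?(ltW T0')//; apply: le_trans le.
  apply: le_itg => //; first exact: (intg_vC hH hbasis hM hClin' hCM hv sol).
  by move=> t _; rewrite lerDl sqr_ge0.
have bd : K * (3 * (b ^+ 2 * delta)) <= e / 2.
  have -> : K * (3 * (b ^+ 2 * delta)) = b ^+ 2 / (b ^+ 2 + 1) * (e / 2).
    by rewrite /delta; field; rewrite !gt_eqF.
  by rewrite ler_piMl ?divr_ge0 ?(ltW e0)// ler_pdivrMr// mul1r lerDl.
apply: (@le_trans _ _ (K * T ^- 2 * (E + 3 * (b ^+ 2 * delta * T ^+ 2)))).
  rewrite ler_wpM2l ?mulr_ge0 ?invr_ge0 ?sqr_ge0 ?(ltW K0)//.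
  by rewrite /E; lra.
have -> : K * T ^- 2 * (E + 3 * (b ^+ 2 * delta * T ^+ 2)) =
    K * E / T ^+ 2 + K * (3 * (b ^+ 2 * delta)).
  by field; rewrite gt_eqF.
have : K * E / T ^+ 2 <= e / 2.
  rewrite ler_pdivrMr ?exprn_gt0//; apply: (@le_trans _ _ (e / 2 * T)); first by lra.
  by rewrite ler_wpM2l ?divr_ge0 ?(ltW e0)// expr2 ler_peMr// ltW.
lra.
Qed.
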